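(* Let $(X,\mu)$ be a $\sigma$-finite measure space, let $p$ be a pointwise consistent $\mu$-heat kernel with associated self-adjoint operator $H_p\ge0$ in $\mathsf{L}^2(X,\mathrm{d}\mu)$, let $q\ge1$, and let $F_1:X\to(0,\infty)$ be an $\mathsf{L}^q$-control function for $p$. Assume that the measurable function $V:X\to\mathbb{R}$ admits a decomposition $V=V_1+V_2$ such that either $$q=1,\quad V_1\in\mathsf{L}^2(X,F_1\mathrm{d}\mu),\quad V_2\in\mathsf{L}_\infty(X,F_1\mathrm{d}\mu)\cap\mathsf{L}^\infty_\infty(X,\mathrm{d}\mu),$$ or $$q>1,\quad F_1\equiv1,\quad V_1\in\mathsf{L}^{2q}(X,\mathrm{d}\mu),\quad V_2\in\mathsf{L}^\infty_\infty(X,\mathrm{d}\mu).$$ Then for all $a>0$ the operator $\hat V(H_p+a)^{-1}$ is compact in $\mathsf{L}^2(X,\mathrm{d}\mu)$. In particular, $\mathrm{Dom}(H_p+\hat V)=\mathrm{Dom}(H_p)$, and $H_p+\hat V$ is self-adjoint and semibounded from below with $\sigma_{\mathrm{ess}}(H_p+\hat V)=\sigma_{\mathrm{ess}}(H_p)$.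
   Context: Let $(X,\mu)$ be a $\sigma$-finite measure space (not necessarily complete). A measurable map $p:(0,\infty)\times X\times X\to[0,\infty)$ is called a pointwise consistent $\mu$-heat kernel if (1) $p(t+s,x,y)=\int_X p(t,x,z)p(s,z,y)\,\mathrm{d}\mu(z)$ for all $t,s>0$, $x,y\in X$; (2) $p(t,x,y)=p(t,y,x)$ for all $t>0$, $x,y\in X$; (3) $\int_X p(t,x,y)\,\mathrm{d}\mu(y)\le1$ for all $t>0$, $x\in X$; (4) with $P_tf(x):=\int_X p(t,x,y)f(y)\,\mathrm{d}\mu(y)$, $t>0$, $f\in\mathsf{L}^2(X,\mathrm{d}\mu)$, one has $\lim_{t\to0+}\|P_tf-f\|_{\mathsf{L}^2(X,\mathrm{d}\mu)}=0$. With $P_0:=\mathrm{id}$, $(P_t)_{t\ge0}$ is a strongly continuous contraction semigroup of self-adjoint operators, and $H_p$ is the unique self-adjoint nonnegative operator in $\mathsf{L}^2(X,\mathrm{d}\mu)$ with $\mathrm{e}^{-tH_p}=P_t$ for all $t\ge0$. Given $q\ge1$, a measurable function $F_1:X\to(0,\infty)$ is called an $\mathsf{L}^q$-control function for $p$ if there is a measurable function $F_2:(0,\infty)\to(0,\infty)$ with $p(t,x,x)\le F_1(x)F_2(t)$ for all $t>0$, $x\in X$, and $\int_0^\infty\mathrm{e}^{-t}F_2(t)^{1/(2q)}\,\mathrm{d}t<\infty$. $F_1\mathrm{d}\mu$ denotes the measure with density $F_1$ with respect to $\mu$. For a measure $\nu$ on $X$, $\mathsf{L}_\infty(X,\mathrm{d}\nu)$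 denotes the set of $\nu$-equivalence classes of measurable functions $h:X\to\mathbb{C}$ with $\nu\{|h|\ge c\}<\infty$ for all $c>0$, and $\mathsf{L}^\infty_\infty(X,\mathrm{d}\nu):=\mathsf{L}^\infty(X,\mathrm{d}\nu)\cap\mathsf{L}_\infty(X,\mathrm{d}\nu)$. $\hat V$ is the maximally defined multiplication operator: $\mathrm{Dom}(\hat V)=\{f\in\mathsf{L}^2(X,\mathrm{d}\mu):Vf\in\mathsf{L}^2(X,\mathrm{d}\mu)\}$, $\hat Vf=Vf$. The sum $H_p+\hat V$ is defined on $\mathrm{Dom}(H_p)\cap\mathrm{Dom}(\hat V)$. *)

(* Defs.v *)
From HB Require Import structures.
From mathcomp Require Import all_boot all_order all_algebra.
From mathcomp Require Import all_classical all_reals all_analysis.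
From mathcomp Require Import measurable_realfun.
From mathcomp Require Import complex.

Set Implicit Arguments.
Unset Strict Implicit.
Unset Printing Implicit Defensive.
Import Order.TTheory GRing.Theory Num.Theory.
Import numFieldNormedType.Exports.
Import ComplexField.Normc.
Import mathcomp.real_closed.complex.

Local Open Scope classical_set_scope.
Local Open Scope ring_scope.
Local Open Scope complex_scope.

Section complex_functions.
Context d (T : measurableType d) (R : realType).
Implicit Types (f g : T -> R[i]) (mu : {measure set T -> \bar R}).

Definition cmeasurable f : Prop :=
  measurable_fun [set: T] (@Re R \o f) /\ measurable_fun [set: T] (@Im R \o f).

Definition Lp mu (p : \bar R) f : Prop :=
  cmeasurable f /\ finite_norm mu p (@normc R \o f).

(* L_oo and Loo_oo are the spaces L_\infty and L^\infty_\infty. *)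
Definition L_oo mu f : Prop :=
  cmeasurable f /\
  forall c : R, 0 < c -> (mu [set x | (c <= normc (f x))%R] < +oo)%E.

Definition Loo_oo mu f : Prop := Lp mu +oo%E f /\ L_oo mu f.

Definition cintegral mu f : R[i] :=
  (\int[mu]_x Re (f x)) +i* (\int[mu]_x Im (f x)).

Lemma cmeasurableD f g :
  cmeasurable f -> cmeasurable g -> cmeasurable (fun x => f x + g x).
Proof.
move=> [f1 f2] [g1 g2]; split.
- rewrite (_ : _ \o _ = (@Re R \o f) \+ (@Re R \o g)); first exact: measurable_funD.
  by apply/funext => x /=; case: (f x) (g x) => ? ? [].
- rewrite (_ : _ \o _ = (@Im R \o f) \+ (@Im R \o g)); first exact: measurable_funD.
  by apply/funext => x /=; case: (f x) (g x) => ? ? [].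
Qed.

Lemma cmeasurableZ (a : R[i]) f :
  cmeasurable f -> cmeasurable (fun x => a * f x).
Proof.
case: a => a b [f1 f2]; split.
- rewrite (_ : _ \o _ = (fun x => a * Re (f x)) \- (fun x => b * Im (f x))).
    by apply: measurable_funB; apply: measurable_funM.
  by apply/funext => x /=; case: (f x).
- rewrite (_ : _ \o _ = (fun x => a * Im (f x)) \+ (fun x => b * Re (f x))).
    by apply: measurable_funD; apply: measurable_funM.
  by apply/funext => x /=; case: (f x).
Qed.

Lemma normc_ge0 (z : R[i]) : 0 <= normc z.
Proof. by case: z => a b; rewrite sqrtr_ge0. Qed.

Lemma measurable_normc f :
  cmeasurable f -> measurable_fun [set: T] (@normc R \o f).
Proof.
move=> [f1 f2].
rewrite (_ : _ \o _ = @Num.sqrt R \o (fun x => Re (f x) ^+ 2 + Im (f x) ^+ 2)).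
  apply: measurableT_comp; first exact: (continuous_measurable_fun (@sqrt_continuous R)).
  by apply: measurable_funD; apply: measurable_funX.
by apply/funext => x /=; case: (f x).
Qed.

End complex_functions.


Section l2_space.
Context d (T : measurableType d) (R : realType).
Variable mu : {measure set T -> \bar R}.

Definition L2_enorm (f : T -> R[i]) : \bar R := Lnorm mu 2%:E (EFin \o (@normc R \o f)).

Lemma measurable_pow2 (f : T -> R) : measurable_fun [set: T] f ->
  measurable_fun [set: T] (fun x => poweR `|(EFin \o f) x|%E 2).
Proof.
move=> mf; apply/measurable_EFinP.
apply: (@measurableT_comp _ _ _ _ _ _ (@powR R ^~ 2)); first exact: measurable_powR.
exact: measurableT_comp.
Qed.

Lemma le_Lnorm2 (f g : T -> R) : measurable_fun [set: T] f ->
  measurable_fun [set: T] g -> (forall x, 0 <= f x <= g x) ->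
  (Lnorm mu 2%:E (EFin \o f) <= Lnorm mu 2%:E (EFin \o g))%E.
Proof.
move=> mf mg fg.
have g0 x : 0 <= g x by case/andP: (fg x) => /le_trans; apply.
rewrite unlock /Lnorm; apply: gt0_ler_poweR.
- by rewrite invr_ge0.
- by rewrite in_itv/= leey andbT integral_ge0// => x _; rewrite poweR_ge0.
- by rewrite in_itv/= leey andbT integral_ge0// => x _; rewrite poweR_ge0.
apply: ge0_le_integral => //.
- by move=> x _; exact: poweR_ge0.
- exact: measurable_pow2.
- exact: measurable_pow2.
- move=> x _; case/andP: (fg x) => f0 fgx; rewrite /= lee_fin ge0_ler_powR ?nnegrE//.
  by rewrite !ger0_norm.
Qed.

Lemma L2_enorm_ge0 f : (0 <= L2_enorm f)%E. Proof. exact: Lnorm_ge0. Qed.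

Lemma L2_enormD f g : cmeasurable f -> cmeasurable g ->
  (L2_enorm (fun x => (f x + g x)%R) <= L2_enorm f + L2_enorm g)%E.
Proof.
move=> mf mg; have mf' := measurable_normc mf; have mg' := measurable_normc mg.
apply: le_trans (minkowski_EFin mu mf' mg' _); last by rewrite ler1n.
apply: le_Lnorm2; first exact/measurable_normc/cmeasurableD.
  exact: measurable_funD.
by move=> x /=; rewrite normc_ge0 le_normcD.
Qed.

Lemma L2_enormZ a f : cmeasurable f ->
  L2_enorm (fun x => (a * f x)%R) = ((normc a)%:E * L2_enorm f)%E.
Proof.
move=> mf; have mf' := measurable_normc mf.
rewrite /L2_enorm unlock /Lnorm.
under eq_integral do rewrite /= normcM normrM powRM// EFinM.
rewrite ge0_integralZl//; last exact: (measurable_pow2 mf').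
rewrite poweRM ?integral_ge0//.
by rewrite poweR_EFin -powRrM mulfV// powRr1// ger0_norm ?normc_ge0.
Qed.

Lemma L2_enorm0 : L2_enorm (fun=> 0) = 0%E.
Proof.
rewrite /L2_enorm (_ : EFin \o _ = cst 0%E) ?Lnorm0//.
by apply/funext => x /=; rewrite expr0n/= addr0 sqrtr0.
Qed.

Definition L2_pred : {pred T -> R[i]^o} :=
  fun f => `[< Lp mu 2%:E (f : T -> R[i]) >].

Lemma L2_predP (f : T -> R[i]^o) :
  reflect (Lp mu 2%:E (f : T -> R[i])) (f \in L2_pred).
Proof. exact: asboolP. Qed.

Lemma L2_submod_closed : submod_closed L2_pred.
Proof.
split.
  apply/L2_predP; split; first by split; exact: measurable_cst.
  by rewrite /finite_norm [ltLHS]L2_enorm0 ltry.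
move=> a f g /L2_predP[mf nf] /L2_predP[mg ng]; apply/L2_predP; split.
  by apply: cmeasurableD => //; exact: cmeasurableZ.
have maf := cmeasurableZ a mf.
apply: le_lt_trans (L2_enormD maf mg) _; rewrite L2_enormZ//.
by rewrite lte_add_pinfty// lte_mul_pinfty ?lee_fin ?normc_ge0.
Qed.

HB.instance Definition _ :=
  GRing.isSubmodClosed.Build _ _ L2_pred L2_submod_closed.

Definition L2_fun : Type := {f : T -> R[i]^o | f \in L2_pred}.
HB.instance Definition _ := SubChoice.on L2_fun.
HB.instance Definition _ := [SubChoice_isSubLmodule of L2_fun by <:].

Definition L2_null : {pred L2_fun} := fun f => `[< \val f = cst 0 %[ae mu] >].

Lemma L2_nullP (f : L2_fun) : reflect (\val f = cst 0 %[ae mu]) (f \in L2_null).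
Proof. exact: asboolP. Qed.

Lemma L2_null_zmod_closed : zmod_closed L2_null.
Proof.
split; first exact/L2_nullP/ae_eq_refl.
move=> f g /L2_nullP f0 /L2_nullP g0; apply/L2_nullP.
apply: filterS2 f0 g0 => x /= fx gx xT.
exact: etrans (f_equal2 (fun a b : R[i] => a - b) (fx xT) (gx xT)) (subr0 _).
Qed.

HB.instance Definition _ :=
  GRing.isZmodClosed.Build _ L2_null L2_null_zmod_closed.

(* Complex L^2(T, mu): square-integrable functions modulo a.e. equality. *)
Definition L2 : Type := Quotient.quot L2_null.
HB.instance Definition _ := GRing.Zmodule.on L2.
HB.instance Definition _ := EqQuotient.on L2.

Definition L2_repr (u : L2) : T -> R[i] := \val (repr u).

Lemma L2_eqP (f g : L2_fun) :
  reflect (\val f = \val g %[ae mu]) (f == g %[mod L2])%qT.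
Proof.
rewrite -Quotient.idealrBE; apply: (iffP (L2_nullP _)).
  by apply: filterS => x /= fg xT; apply/eqP; rewrite -subr_eq0; exact/eqP/fg.
apply: filterS => x /= fg xT.
exact: etrans (f_equal (fun a : R[i] => a - \val g x) (fg xT)) (subrr _).
Qed.

Lemma L2_reprP (f : L2_fun) : L2_repr (\pi_L2 f)%qT = \val f %[ae mu].
Proof. by apply/L2_eqP; rewrite reprK. Qed.

Definition L2_scale (a : R[i]) (u : L2) : L2 := (\pi_L2 (a *: repr u))%qT.

Lemma pi_L2_scale a (f : L2_fun) :
  (L2_scale a (\pi_L2 f) = \pi_L2 (a *: f))%qT.
Proof.
apply/eqP/L2_eqP; have := L2_reprP f; apply: filterS => x /= fx xT.
exact (f_equal (fun z : R[i] => a * z) (fx xT)).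
Qed.

Lemma L2_scalerA a b u : L2_scale a (L2_scale b u) = L2_scale (a * b) u.
Proof. by elim/quotW: u => f; rewrite (pi_L2_scale b f) !pi_L2_scale scalerA. Qed.

Lemma L2_scale1r : left_id 1 L2_scale.
Proof. by elim/quotW => f; rewrite pi_L2_scale scale1r. Qed.

Lemma L2_scalerDr : right_distributive L2_scale +%R.
Proof.
move=> a; elim/quotW => f; elim/quotW => g.
by rewrite -(raddfD \pi_L2)%qT !pi_L2_scale scalerDr (raddfD \pi_L2)%qT.
Qed.

Lemma L2_scalerDl u : {morph L2_scale^~ u : a b / a + b}.
Proof.
elim/quotW: u => f a b.
by rewrite !pi_L2_scale scalerDl (raddfD \pi_L2)%qT.
Qed.

HB.instance Definition _ := GRing.Zmodule_isLmodule.Build R[i] L2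
  L2_scalerA L2_scale1r L2_scalerDr L2_scalerDl.

Lemma L2_reprLp (u : L2) : Lp mu 2%:E (L2_repr u).
Proof. by have /L2_predP := valP (repr u). Qed.

Lemma L2_reprD (u v : L2) :
  L2_repr (u + v) = (fun x => L2_repr u x + L2_repr v x) %[ae mu].
Proof.
rewrite -[in L2_repr (u + v)](reprK u) -[in L2_repr (_ + v)](reprK v).
by rewrite -(raddfD \pi_L2)%qT; exact: L2_reprP.
Qed.

Lemma L2_reprZ a (u : L2) :
  L2_repr (a *: u) = (fun x => a * L2_repr u x) %[ae mu].
Proof. exact: L2_reprP. Qed.

Lemma eq_L2_enorm (f g : T -> R[i]) : cmeasurable f -> cmeasurable g ->
  f = g %[ae mu] -> L2_enorm f = L2_enorm g.
Proof.
move=> mf mg fg; rewrite /L2_enorm unlock /Lnorm; congr poweR.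
apply: ae_eq_integral => //; try exact/measurable_pow2/measurable_normc.
by apply: filterS fg => x /= fgx xT; rewrite (fgx xT).
Qed.

Definition L2_norm (u : L2) : R[i] :=
  (fine (L2_enorm (L2_repr u)))%:C.

Lemma L2_norm_fineK (u : L2) : (fine (L2_enorm (L2_repr u)))%:E = L2_enorm (L2_repr u).
Proof.
have [_ ufin] := L2_reprLp u.
by rewrite fineK// ge0_fin_numE ?L2_enorm_ge0.
Qed.

Lemma L2_ler_normD u v : L2_norm (u + v) <= L2_norm u + L2_norm v.
Proof.
have [mu1 _] := L2_reprLp u; have [mv1 _] := L2_reprLp v.
have [muv _] := L2_reprLp (u + v).
rewrite /L2_norm -(rmorphD (real_complex R)) lecR -lee_fin [leRHS]EFinD !L2_norm_fineK.
rewrite (eq_L2_enorm muv (cmeasurableD mu1 mv1) (L2_reprD u v)); exact: L2_enormD.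
Qed.

Lemma L2_normZ a u : L2_norm (a *: u) = `|a| * L2_norm u.
Proof.
have [mu1 _] := L2_reprLp u; have [mau _] := L2_reprLp (a *: u).
rewrite [`|a|]normc_def -(rmorphM (real_complex R)); congr (_%:C); apply: EFin_inj.
rewrite [RHS]EFinM !L2_norm_fineK (eq_L2_enorm mau (cmeasurableZ a mu1) (L2_reprZ a u)) L2_enormZ//.
by case: a {mau}.
Qed.

Lemma L2_norm_eq0 u : L2_norm u = 0 -> u = 0.
Proof.
have [mu1 _] := L2_reprLp u.
move=> /eqP; rewrite eq_complex/= eqxx andbT => /eqP u0.
have {}u0 : L2_enorm (L2_repr u) = 0%E by rewrite -L2_norm_fineK u0.
have mnu : measurable_fun [set: T] (EFin \o (@normc R \o L2_repr u)).
  exact/measurable_EFinP/measurable_normc.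
have {}u0 := Lnorm_eq0_eq0 mnu _ u0.
rewrite -[u]reprK -(raddf0 \pi_L2)%qT; apply/eqP/L2_eqP.
by apply: filterS (u0 _) => // x /= ux xT; apply: eq0_normc; case: (ux xT).
Qed.

HB.instance Definition _ := Lmodule_isNormed.Build R[i] L2
  L2_ler_normD L2_normZ L2_norm_eq0.

Definition L2_dot (u v : L2) : R[i] :=
  cintegral mu (fun x => L2_repr u x * (L2_repr v x)^*).

End l2_space.

(* An unbounded operator in L^2 is identified with its graph; a set of pairs
   need not be a graph, hence the predicate is_operator. *)
Section operators.
Context d (T : measurableType d) (R : realType).
Variable mu : {measure set T -> \bar R}.

Definition op : Type := set (L2 mu * L2 mu).
Implicit Types A B : op.

Definition is_operator A : Prop :=
  [/\ A (0, 0),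
      forall (a : R[i]) u v u' v',
        A (u, v) -> A (u', v') -> A (a *: u + u', a *: v + v') &
      forall v, A (0, v) -> v = 0].

Definition dom A : set (L2 mu) := [set u | exists v, A (u, v)].

Definition op_scalar (z : R[i]) : op := [set uv | uv.2 = z *: uv.1].

Definition op_add A B : op :=
  [set uw | exists v w, [/\ A (uw.1, v), B (uw.1, w) & uw.2 = v + w]].

Definition op_inv A : op := [set uv | A (uv.2, uv.1)].

Definition op_comp A B : op :=
  [set uw | exists v, B (uw.1, v) /\ A (v, uw.2)].

Definition mul_op (h : T -> R) : op :=
  [set uv | L2_repr uv.2 = (fun x => (h x)%:C * L2_repr uv.1 x) %[ae mu]].

Definition adjoint A : op :=
  [set vw | forall u u', A (u, u') -> L2_dot u' vw.1 = L2_dot u vw.2].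

Definition selfadjoint A : Prop :=
  [/\ is_operator A, dense (dom A) & A = adjoint A].

Definition nonnegative_op A : Prop :=
  forall u v, A (u, v) -> 0 <= L2_dot v u.

Definition semibounded A : Prop :=
  exists c : R, forall u v, A (u, v) -> c%:C * L2_dot u u <= L2_dot v u.

Definition bounded_op A : Prop :=
  [/\ is_operator A, dom A = setT &
      exists c : R, forall u v, A (u, v) -> `|v| <= c%:C * `|u|].

Definition compact_op A : Prop :=
  [/\ is_operator A, dom A = setT &
      precompact [set v | exists2 u, `|u| <= 1 & A (u, v)]].

Definition spectrum A : set R[i] :=
  [set z | ~ bounded_op (op_inv (op_add A (op_scalar (- z))))].

Definition op_eigenspace A (z : R[i]) : set (L2 mu) := [set u | A (u, z *: u)].

Definition finite_dimensional (E : set (L2 mu)) : Prop :=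
  exists n (e : 'I_n -> L2 mu),
    forall u, E u -> exists c : 'I_n -> R[i], u = \sum_(i < n) c i *: e i.

(* For a self-adjoint operator the essential spectrum is the complement, in the
   spectrum, of the isolated eigenvalues of finite multiplicity. *)
Definition discrete_spectrum A : set R[i] :=
  [set z | [/\ spectrum A z,
    exists2 e : R, 0 < e &
      forall w, spectrum A w -> `|w - z| < e%:C -> w = z,
    exists2 u, op_eigenspace A z u & u != 0 &
    finite_dimensional (op_eigenspace A z)]].

Definition ess_spectrum A : set R[i] := spectrum A `\` discrete_spectrum A.

End operators.
Arguments op_scalar {d T R} mu z.
Arguments mul_op {d T R} mu h.

Section exponential.
Context d (T : measurableType d) (R : realType).
Variable mu : {measure set T -> \bar R}.

(* U is a spectral representation of A: a unitary conjugating A to the maximal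
   multiplication operator by h. *)
Definition spectral_representation (A : op mu)
    d' (Y : measurableType d') (nu : {measure set Y -> \bar R})
    (h : Y -> R) (U : {linear L2 mu -> L2 nu}) : Prop :=
  [/\ measurable_fun [set: Y] h,
      forall w, exists u, U u = w,
      forall u v, L2_dot (U u) (U v) = L2_dot u v &
      forall u v, A (u, v) <-> mul_op nu h (U u, U v)].

(* P t = exp (- t A) for all t >= 0, by the functional calculus of the
   self-adjoint operator A: if A is multiplication by h in a spectral
   representation, then exp (- t A) is multiplication by exp (- t h). *)
Definition is_exp_semigroup (A : op mu) (P : R -> op mu) : Prop :=
  exists d' (Y : measurableType d') (nu : {measure set Y -> \bar R})
      (h : Y -> R) (U : {linear L2 mu -> L2 nu}),
    spectral_representation A h U /\
    forall t, 0 <= t -> forall u v,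
      P t (u, v) <-> mul_op nu (fun y => expR (- t * h y)) (U u, U v).

End exponential.

Section heat_kernels.
Context d (T : measurableType d) (R : realType).
Variable mu : {measure set T -> \bar R}.
(* Only the values p t x y with t > 0 are meaningful. *)
Implicit Type p : R -> T -> T -> R.

Definition heat_fun p (t : R) (f : T -> R[i]) (x : T) : R[i] :=
  cintegral mu (fun y => (p t x y)%:C * f y).

Record heat_kernel p : Prop := HeatKernel {
  heat_kernel_ge0 : forall (t : R) x y, 0 < t -> 0 <= p t x y ;
  heat_kernel_measurable :
    measurable_fun ([set t : R | 0 < t] `*` [set: T * T])
      (fun z : R * (T * T) => p z.1 z.2.1 z.2.2) ;
  heat_kernel_semigroup : forall (t s : R) x y, 0 < t -> 0 < s ->
    (p (t + s) x y)%:E = (\int[mu]_z (p t x z * p s z y)%:E)%E ;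
  heat_kernel_sym : forall (t : R) x y, 0 < t -> p t x y = p t y x ;
  heat_kernel_le1 : forall (t : R) x, 0 < t -> (\int[mu]_y (p t x y)%:E <= 1)%E ;
  heat_kernel_cvg : forall u : L2 mu,
    Lnorm mu 2%:E
      (fun x => (normc (heat_fun p t (L2_repr u) x - L2_repr u x))%:E)
      @[t --> 0^'+] --> 0%E
}.

(* The graph of P_t for t >= 0, with P_0 = id. *)
Definition heat_op p (t : R) : op mu :=
  if t == 0 then op_scalar mu 1
  else [set uv | L2_repr uv.2 = heat_fun p t (L2_repr uv.1) %[ae mu]].

Definition heat_generator p (H : op mu) : Prop :=
  [/\ selfadjoint H, nonnegative_op H & is_exp_semigroup H (heat_op p)].

Definition control_function p (q : R) (F1 : T -> R) : Prop :=
  [/\ measurable_fun [set: T] F1, forall x, 0 < F1 x &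
    exists F2 : R -> R,
    [/\ measurable_fun [set t : R | 0 < t] F2,
        forall t : R, 0 < t -> 0 < F2 t,
        forall (t : R) x, 0 < t -> p t x x <= F1 x * F2 t &
        (\int[lebesgue_measure]_(t in [set t : R | (0 < t)%R])
           (expR (- t) * (F2 t `^ (2 * q)^-1))%:E < +oo)%E]].

End heat_kernels.

Section density.
Context d (T : measurableType d) (R : realType).
Variable mu : {measure set T -> \bar R}.
Variables (F : T -> R) (mF : measurable_fun [set: T] F).
Hypothesis F0 : forall x, 0 < F x.

(* The measure F dmu. *)
Definition mdensity & measurable_fun [set: T] F & (forall x, 0 < F x) :
  set T -> \bar R := fun A => (\int[mu]_(x in A) (F x)%:E)%E.

Local Notation nu := (mdensity mF F0).

Lemma mdensity0 : nu set0 = 0%E.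
Proof. by rewrite /mdensity integral_set0. Qed.

Lemma mdensity_ge0 A : (0 <= nu A)%E.
Proof. by apply: integral_ge0 => x _; rewrite lee_fin ltW. Qed.

Lemma mdensity_sigma_additive : semi_sigma_additive nu.
Proof.
apply: semi_sigma_additive_nng_induced; first exact/measurable_EFinP.
by move=> x; rewrite lee_fin ltW.
Qed.

HB.instance Definition _ :=
  isMeasure.Build _ _ _ nu mdensity0 mdensity_ge0 mdensity_sigma_additive.

End density.

(* Main.v *)
(* [V] is compact relatively to [H], in the form: for all [eps > 0] there are
   finitely many vectors with
   [|V u - sum_i <u, e_i> g_i| <= eps (|u| + |H u|)] for [u] in [Dom H].
   Since [|P_t u (x)|^2 <= p (2t, x, x) |u|^2 <= F1 x * F2 (2t) * |u|^2], a function
   [W] satisfies [|W P_t u| <= C * F2 (2t)^(1/(2q)) * |u|] with [C] proportional to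
   the norm of [W] in [L^(2q) (F1 dmu)].  Decomposing
   [u = P_1 u + sum_k (P_(s_(k+1)) u - P_(s_k) u)], [s_k = 2^-k], with
   [P_s u - P_(2s) u = P_s (u - P_s u)] and [|u - P_s u| <= s |H u|], the
   integrability of [F2^(1/(2q))] gives [|W u| <= C' (|u| + |H u|)].  Large values of
   [V1] and small values of [V] thus contribute at most [eps (|u| + |H u|)].  What
   remains is a bounded [W] with [W^2 F1] integrable: there [W (u - P_t u)] is
   small, and [W P_t] is Hilbert-Schmidt.
   Relative compactness gives relative bound zero, hence self-adjointness and
   semiboundedness (Kato-Rellich).  A real [lam] is outside the essential spectrum
   of [A] iff [|u| <= C (|(A - lam) u| + sum_i |<u, e_i>|)] for finitely many [e_i],
   and such estimates survive relatively compact perturbations. *)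

Require Import Defs.
From mathcomp Require Import all_boot all_order all_algebra.
From mathcomp Require Import all_classical all_reals all_analysis.
From mathcomp Require Import measurable_realfun ess_sup_inf.
From mathcomp Require Import complex ring lra.
Set Implicit Arguments.
Unset Strict Implicit.
Unset Printing Implicit Defensive.
Import Order.TTheory GRing.Theory Num.Theory.
Import numFieldNormedType.Exports.
Import ComplexField.Normc.
Import mathcomp.real_closed.complex.
Local Open Scope classical_set_scope.
Local Open Scope ring_scope.
Local Open Scope complex_scope.

(** * Complex inner product spaces *)

(** A spectral representation is at hand only for [H], through [is_exp_semigroup]; nothing of the
    kind is given for [H + V]. Whatever is needed about spectra is therefore proved for any
    self-adjoint graph from its resolvent set. The difficult direction is that an isolated spectral
    point [lam] gives a lower bound for [A - lam] on the orthogonal complement of its eigenspace: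
    the absence of spectrum in an interval is turned into a quadratic inequality on the graph, and
    the inequalities on the two sides of [lam] are combined by polarization. The relative bound has
    its own obstacle: [V u] is not known in advance to be in L^2 for [u] in the domain of [H]. The
    dyadic estimate is proved for bounded multipliers, with a constant that depends on [F2], [q] and
    the L^(2q) integral but never on the sup norm, and it reaches unbounded ones by monotone
    convergence. Smallness comes from that same constant, which tends to 0 with the integral. Both
    alternatives of the theorem enter through one set of integral conditions on the real parts of
    [V1] and [V2]. *)

Lemma normc_sqr (R : realType) (z : R[i]) : normc z ^+ 2 = Re z ^+ 2 + Im z ^+ 2.
Proof. by case: z => a b; rewrite sqr_sqrtr ?addr_ge0 ?sqr_ge0. Qed.

Lemma normcR (R : realType) (a : R) : normc a%:C = `|a|.
Proof. by rewrite /= expr0n/= addr0 sqrtr_sqr. Qed.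

Lemma ler_Re_normc (R : realType) (z : R[i]) : `|Re z| <= normc z.
Proof.
rewrite -(ler_pXn2r (ltn0Sn 1)) ?nnegrE ?normc_ge0// normc_sqr real_normK ?num_real//.
by rewrite lerDl sqr_ge0.
Qed.

Lemma ler_Im_normc (R : realType) (z : R[i]) : `|Im z| <= normc z.
Proof.
rewrite -(ler_pXn2r (ltn0Sn 1)) ?nnegrE ?normc_ge0// normc_sqr real_normK ?num_real//.
by rewrite lerDr sqr_ge0.
Qed.

Lemma normc_conj (R : realType) (z : R[i]) : normc (conjc z) = normc z.
Proof. by case: z => a b /=; rewrite sqrrN. Qed.

Lemma ReZ (R : realType) (a : R) (z : R[i]) : Re (a%:C * z) = a * Re z.
Proof. by case: z => x y /=; rewrite mul0r subr0. Qed.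

Lemma ReD (R : realType) (z w : R[i]) : Re (z + w) = Re z + Re w.
Proof. by case: z => x y; case: w. Qed.

Lemma ImD (R : realType) (z w : R[i]) : Im (z + w) = Im z + Im w.
Proof. by case: z => x y; case: w. Qed.

Lemma ReN (R : realType) (z : R[i]) : Re (- z) = - Re z.
Proof. by case: z. Qed.

Lemma ReJ (R : realType) (z : R[i]) : Re (conjc z) = Re z.
Proof. by case: z. Qed.

Lemma conj_RtoC (R : realType) (a : R) : (conjc a%:C) = a%:C.
Proof. by rewrite /= oppr0. Qed.

Record inner_product (R : realType) (E : lmodType R[i]) (dot : E -> E -> R[i]) :
    Prop := InnerProduct {
  ip_addl : forall u v w, dot (u + v) w = dot u w + dot v w ;
  ip_scalel : forall a u v, dot (a *: u) v = a * dot u v ;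
  ip_conj : forall u v, dot u v = conjc (dot v u) ;
  ip_ge0 : forall u, 0 <= Re (dot u u) ;
  ip_eq0 : forall u, Re (dot u u) = 0 -> u = 0
}.

(** Real-valued, whereas the norm of [L2 mu] as a normed module over [R[i]] takes complex values;
    [L2_normE] is the bridge. *)
Definition ip_norm (R : realType) (E : lmodType R[i]) (dot : E -> E -> R[i]) (u : E) : R :=
  Num.sqrt (Re (dot u u)).

Section inner_product.
Context (R : realType) (E : lmodType R[i]) (dot : E -> E -> R[i]).
Hypothesis ip : inner_product dot.
Local Notation nrm := (ip_norm dot).
Implicit Types (u v w : E) (a : R[i]).

Lemma dotDl u v w : dot (u + v) w = dot u w + dot v w. Proof. exact: ip_addl. Qed.

Lemma dotZl a u v : dot (a *: u) v = a * dot u v. Proof. exact: ip_scalel. Qed.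

Lemma dotJ u v : (conjc (dot v u)) = dot u v. Proof. by rewrite -ip_conj. Qed.

Lemma dotNl u v : dot (- u) v = - dot u v.
Proof. by rewrite -scaleN1r dotZl mulN1r. Qed.

Lemma dotBl u v w : dot (u - v) w = dot u w - dot v w.
Proof. by rewrite dotDl dotNl. Qed.

Lemma dot0l u : dot 0 u = 0. Proof. by rewrite -(scale0r 0) dotZl mul0r. Qed.

Lemma dotDr u v w : dot u (v + w) = dot u v + dot u w.
Proof. by rewrite -dotJ dotDl rmorphD/= !dotJ. Qed.

Lemma dotZr a u v : dot u (a *: v) = (conjc a) * dot u v.
Proof. by rewrite -dotJ dotZl rmorphM/= !dotJ. Qed.

Lemma dotNr u v : dot u (- v) = - dot u v.
Proof. by rewrite -dotJ dotNl rmorphN/= !dotJ. Qed.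

Lemma dotBr u v w : dot u (v - w) = dot u v - dot u w.
Proof. by rewrite dotDr dotNr. Qed.

Lemma dot0r u : dot u 0 = 0.
Proof. by rewrite -dotJ dot0l conjc0. Qed.

Lemma Re_dotC u v : Re (dot u v) = Re (dot v u).
Proof. by rewrite -dotJ ReJ. Qed.

Lemma dot_suml (I : Type) (r : seq I) (P : pred I) (F : I -> E) v :
  dot (\sum_(i <- r | P i) F i) v = \sum_(i <- r | P i) dot (F i) v.
Proof. by elim/big_rec2: _ => [|i x y _ <-]; rewrite ?dot0l// dotDl. Qed.

Lemma dot_sumr (I : Type) (r : seq I) (P : pred I) (F : I -> E) v :
  dot v (\sum_(i <- r | P i) F i) = \sum_(i <- r | P i) dot v (F i).
Proof. by elim/big_rec2: _ => [|i x y _ <-]; rewrite ?dot0r// dotDr. Qed.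

Lemma nrm_ge0 u : 0 <= nrm u. Proof. exact: sqrtr_ge0. Qed.

Lemma nrm_sqr u : nrm u ^+ 2 = Re (dot u u).
Proof. by rewrite sqr_sqrtr// ip_ge0. Qed.

Lemma dot_nrm u : dot u u = (nrm u ^+ 2)%:C.
Proof.
apply/eqP; rewrite eq_complex nrm_sqr eqxx/=.
by have := dotJ u u; case: (dot u u) => x y /= [] yN; apply/eqP; lra.
Qed.

Lemma nrm0 : nrm 0 = 0.
Proof. by rewrite /ip_norm dot0l sqrtr0. Qed.

Lemma nrm_eq0 u : nrm u = 0 -> u = 0.
Proof. by move=> u0; apply: (ip_eq0 ip); rewrite -nrm_sqr u0 expr0n. Qed.

Lemma nrm_gt0 u : u != 0 -> 0 < nrm u.
Proof.
by move=> u0; rewrite lt_def nrm_ge0 andbT; apply: contraNneq u0 => /nrm_eq0 ->.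
Qed.

Lemma nrm_sqrD u v : nrm (u + v) ^+ 2 = nrm u ^+ 2 + nrm v ^+ 2 + 2 * Re (dot u v).
Proof.
by rewrite !nrm_sqr !dotDl !dotDr !ReD (Re_dotC v u); ring.
Qed.

Lemma nrmZ a u : nrm (a *: u) = normc a * nrm u.
Proof.
apply/eqP; rewrite -(eqrXn2 (ltn0Sn 1)) ?mulr_ge0 ?nrm_ge0 ?normc_ge0//.
rewrite exprMn nrm_sqr dotZl dotZr dot_nrm mulrA normc_sqr.
by case: a => x y /=; apply/eqP; ring.
Qed.

Lemma nrmZR (a : R) u : nrm (a%:C *: u) = `|a| * nrm u.
Proof. by rewrite nrmZ normcR. Qed.

Lemma nrmN u : nrm (- u) = nrm u.
Proof. by rewrite /ip_norm dotNl dotNr opprK. Qed.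

Lemma nrmC u v : nrm (u - v) = nrm (v - u).
Proof. by rewrite -nrmN opprB. Qed.

Lemma nrm_sqrB u v : nrm (u - v) ^+ 2 = nrm u ^+ 2 + nrm v ^+ 2 - 2 * Re (dot u v).
Proof. by rewrite nrm_sqrD nrmN dotNr ReN; ring. Qed.

Lemma CauchySchwarz u v : normc (dot u v) <= nrm u * nrm v.
Proof.
have [->|v0] := eqVneq v 0; first by rewrite dot0r normc0 nrm0 mulr0.
have nv := nrm_gt0 v0.
rewrite -(ler_pXn2r (ltn0Sn 1)) ?nnegrE ?normc_ge0 ?mulr_ge0 ?nrm_ge0//.
have := sqr_ge0 (nrm (u - ((nrm v ^+ 2)^-1)%:C *: (dot u v *: v))).
rewrite nrm_sqrB nrmZR nrmZ dotZr dotZr conj_RtoC ReZ.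
have -> : Re ((conjc (dot u v)) * dot u v) = normc (dot u v) ^+ 2.
  by rewrite normc_sqr; case: (dot u v) => x y /=; ring.
rewrite ger0_norm ?invr_ge0 ?sqr_ge0//.
set N := normc _; set a := nrm u; have vn0 : nrm v != 0 by rewrite gt_eqF.
have -> : a ^+ 2 + ((nrm v ^+ 2)^-1 * (N * nrm v)) ^+ 2 - 2 * ((nrm v ^+ 2)^-1 * N ^+ 2)
   = a ^+ 2 - N ^+ 2 / nrm v ^+ 2 by field.
by rewrite subr_ge0 ler_pdivrMr ?exprn_gt0// exprMn.
Qed.

Lemma Re_dot_le u v : Re (dot u v) <= nrm u * nrm v.
Proof.
exact: le_trans (ler_norm _) (le_trans (ler_Re_normc _) (CauchySchwarz _ _)).
Qed.

Lemma nrmD u v : nrm (u + v) <= nrm u + nrm v.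
Proof.
rewrite -(ler_pXn2r (ltn0Sn 1)) ?nnegrE ?addr_ge0 ?nrm_ge0//.
by rewrite nrm_sqrD; have := Re_dot_le u v; nra.
Qed.

Lemma nrmB u v : nrm (u - v) <= nrm u + nrm v.
Proof. by rewrite (le_trans (nrmD _ _))// nrmN. Qed.

Lemma nrm_subD u v w : nrm (u - w) <= nrm (u - v) + nrm (v - w).
Proof. by rewrite -[u - w](subrKA v) nrmD. Qed.

Lemma nrm_le_subD u v : nrm u <= nrm (u - v) + nrm v.
Proof. by rewrite -[in leLHS](subrK v u) nrmD. Qed.

Lemma nrm_sum (I : Type) (r : seq I) (P : pred I) (F : I -> E) :
  nrm (\sum_(i <- r | P i) F i) <= \sum_(i <- r | P i) nrm (F i).
Proof.
elim/big_rec2: _ => [|i y x _ le]; rewrite ?nrm0//.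
by rewrite (le_trans (nrmD _ _))// lerD2l.
Qed.

Lemma nrm_parallelogram u v :
  nrm (u + v) ^+ 2 + nrm (u - v) ^+ 2 = 2 * nrm u ^+ 2 + 2 * nrm v ^+ 2.
Proof. by rewrite nrm_sqrD nrm_sqrB; ring. Qed.

End inner_product.

(** * Orthonormal families, Bessel's inequality and Hilbert-Schmidt operators *)

Section orthonormal.
Context (R : realType) (E : lmodType R[i]) (dot : E -> E -> R[i]).
Hypothesis ip : inner_product dot.
Local Notation nrm := (ip_norm dot).

Definition orthonormal n (e : 'I_n -> E) := forall i j, dot (e i) (e j) = (i == j)%:R.

Definition proj n (e : 'I_n -> E) (u : E) := \sum_i dot u (e i) *: e i.

Lemma dot_proj n (e : 'I_n -> E) u i : orthonormal e -> dot (proj e u) (e i) = dot u (e i).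
Proof.
move=> oe; rewrite dot_suml// (bigD1 i)//= dotZl// oe eqxx mulr1 big1 ?addr0// => j /negPf ji.
by rewrite dotZl// oe ji mulr0.
Qed.

Lemma dot_sub_proj n (e : 'I_n -> E) u i : orthonormal e -> dot (u - proj e u) (e i) = 0.
Proof. by move=> oe; rewrite dotBl// dot_proj// subrr. Qed.

Lemma nrm_proj_sqr n (e : 'I_n -> E) u : orthonormal e ->
  nrm (proj e u) ^+ 2 = \sum_i normc (dot u (e i)) ^+ 2.
Proof.
move=> oe; rewrite nrm_sqr// {2}/proj dot_sumr//.
under eq_bigr do rewrite dotZr// dot_proj//.
elim/big_rec2: _ => // i y x _ <-; rewrite ReD normc_sqr; congr +%R.
by case: (dot u (e i)) => a b /=; ring.
Qed.

Lemma dot_sub_proj_proj n (e : 'I_n -> E) u : orthonormal e ->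
  dot (u - proj e u) (proj e u) = 0.
Proof.
move=> oe; rewrite {2}/proj dot_sumr// big1// => i _.
by rewrite dotZr// dot_sub_proj// mulr0.
Qed.

Lemma nrm_sub_proj_sqr n (e : 'I_n -> E) u : orthonormal e ->
  nrm u ^+ 2 = nrm (u - proj e u) ^+ 2 + \sum_i normc (dot u (e i)) ^+ 2.
Proof.
move=> oe; have := nrm_sqrD ip (u - proj e u) (proj e u).
by rewrite subrK dot_sub_proj_proj// mulr0 addr0 nrm_proj_sqr.
Qed.

Lemma Bessel n (e : 'I_n -> E) u : orthonormal e ->
  \sum_i normc (dot u (e i)) ^+ 2 <= nrm u ^+ 2.
Proof. by move=> oe; rewrite (nrm_sub_proj_sqr u oe) lerDr sqr_ge0. Qed.

Lemma nrm_sub_proj_le n (e : 'I_n -> E) u : orthonormal e -> nrm (u - proj e u) <= nrm u.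
Proof.
move=> oe; rewrite -(ler_pXn2r (ltn0Sn 1)) ?nnegrE ?nrm_ge0//.
by rewrite (nrm_sub_proj_sqr u oe) lerDl sumr_ge0// => i _; exact: sqr_ge0.
Qed.

Lemma orthonormal_nrm n (e : 'I_n -> E) i : orthonormal e -> nrm (e i) = 1.
Proof.
move=> oe; apply/eqP; rewrite -(eqrXn2 (ltn0Sn 1)) ?nrm_ge0// nrm_sqr//.
by rewrite oe eqxx expr1n.
Qed.

(** The length bound provides a longest family; a unit vector in [P] orthogonal to it could be put
    in front, giving a longer one. *)
Lemma orthonormal_maximal (P : E -> Prop) (N : nat) :
  (forall n (e : 'I_n -> E), orthonormal e -> (forall i, P (e i)) -> (n <= N)%N) ->
  exists n (e : 'I_n -> E), [/\ orthonormal e, forall i, P (e i) &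
    forall f, nrm f = 1 -> (forall i, dot f (e i) = 0) -> ~ P f].
Proof.
move=> bd.
pose Q n := `[< exists e : 'I_n -> E, orthonormal e /\ forall i, P (e i) >].
have Q0 : exists n, Q n by exists 0%N; apply/asboolP; exists (fun=> 0); split; case.
have QN n : Q n -> (n <= N)%N by move=> /asboolP[e [oe Pe]]; exact: bd oe Pe.
case: (ex_maxnP Q0 QN) => n /asboolP[e [oe Pe]] nmax.
exists n, e; split => // f f1 fe Pf.
suff : Q n.+1 by move=> /nmax; rewrite ltnn.
apply/asboolP; exists (fun i => if unlift ord0 i is Some j then e j else f); split.
  move=> i j; case: unliftP => [i'|] ->; case: unliftP => [j'|] ->.
  - by rewrite oe (inj_eq (@lift_inj _ _)).
  - by rewrite -dotJ// fe conjc0.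
  - by rewrite fe.
  - by rewrite dot_nrm// f1 expr1n eqxx.
by move=> i; case: unliftP => [i'|] _.
Qed.

(* A Hilbert-Schmidt bound makes an operator a norm limit of finite rank ones:
   only boundedly many orthonormal vectors satisfy [eps <= |T e|]. *)
Lemma hilbert_schmidt_finite_rank (T : E -> E) (M eps : R) :
  (forall a u v, T (a *: u + v) = a *: T u + T v) ->
  (forall n (e : 'I_n -> E), orthonormal e -> \sum_i nrm (T (e i)) ^+ 2 <= M) ->
  0 < eps ->
  exists n (e g : 'I_n -> E), forall f,
    nrm (T f - \sum_i dot f (e i) *: g i) <= eps * nrm f.
Proof.
move=> Tlin TM eps0.
have T0 : T 0 = 0.
  have := Tlin 1 0 0; rewrite !scale1r addr0 => /eqP.
  by rewrite eq_sym -subr_eq0 addrK => /eqP.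
have M0 : 0 <= M.
  have := TM 0%N (fun=> 0); rewrite big_ord0; apply; by case.
have e20 : 0 < eps ^+ 2 by rewrite exprn_gt0.
have [n [e [oe Pe emax]]] :
    exists n (e : 'I_n -> E), [/\ orthonormal e, forall i, eps <= nrm (T (e i)) &
    forall f, nrm f = 1 -> (forall i, dot f (e i) = 0) -> ~ eps <= nrm (T f)].
  (* Each vector with [eps <= |T e|] takes at least [eps ^+ 2] out of the total [M]. *)
  apply: (@orthonormal_maximal _ (Num.truncn (M / eps ^+ 2))) => n e oe Pe.
  have Me0 : 0 <= M / eps ^+ 2 by rewrite divr_ge0// ltW.
  rewrite truncn_ge_nat// ler_pdivlMr//; apply: le_trans (TM _ _ oe).
  rewrite mulr_natl -[n in leLHS]card_ord -sumr_const; apply: ler_sum => i _.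
  by rewrite ler_pXn2r// nnegrE ?nrm_ge0// ltW.
have Tsum u : T (proj e u) = \sum_i dot u (e i) *: T (e i).
  rewrite /proj; elim/big_rec2: _ => // i y x _ <-; exact: Tlin.
exists n, e, (fun i => T (e i)) => f; rewrite -Tsum.
have -> : T f - T (proj e f) = T (f - proj e f).
  by rewrite addrC -scaleN1r -Tlin scaleN1r addrC.
apply: le_trans (_ : eps * nrm (f - proj e f) <= _); last first.
  by rewrite ler_pM2l// nrm_sub_proj_le.
set h := f - _; have [->|h0] := eqVneq h 0; first by rewrite T0 nrm0// mulr0.
have nh := nrm_gt0 ip h0.
have := emax (((nrm h)^-1)%:C *: h); rewrite nrmZR// ger0_norm ?invr_ge0 ?nrm_ge0//.
rewrite mulVf ?gt_eqF// => /(_ erefl); have -> : T ((nrm h)^-1%:C *: h) = (nrm h)^-1%:C *: T h.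
  by rewrite -[in LHS](addr0 (_ *: h)) Tlin T0 addr0.
rewrite nrmZR// ger0_norm ?invr_ge0 ?nrm_ge0// => /(_ _)/negP.
rewrite -ltNge mulrC ltr_pdivrMr// => H; apply/ltW/H => i.
by rewrite dotZl// dot_sub_proj// mulr0.
Qed.

End orthonormal.

(** * Convergence, completeness and orthogonal projection *)

Lemma invSn_le (R : realType) (eps : R) : 0 < eps ->
  exists N, forall n, (N <= n)%N -> n.+1%:R^-1 <= eps.
Proof.
move=> e0; exists (Num.truncn eps^-1) => n Nn.
rewrite -[leRHS]invrK lef_pV2 ?posrE ?invr_gt0// ltW//.
apply: lt_le_trans (truncnS_gt _) _.
by rewrite ler_nat.
Qed.

Lemma ler_eps (R : realType) (x y : R) : (forall e : R, 0 < e -> x <= y + e) -> x <= y.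
Proof. by move=> xy; apply/ler_addgt0Pr. Qed.

Section convergence.
Context (R : realType) (E : lmodType R[i]) (dot : E -> E -> R[i]).
Hypothesis ip : inner_product dot.
Local Notation nrm := (ip_norm dot).
Implicit Types (u v : nat -> E) (l : E).

Definition nrm_cvg u l := forall eps : R, 0 < eps ->
  exists N, forall n, (N <= n)%N -> nrm (u n - l) <= eps.

Definition nrm_cauchy u := forall eps : R, 0 < eps ->
  exists N, forall m n, (N <= m)%N -> (N <= n)%N -> nrm (u m - u n) <= eps.

Definition ip_complete := forall u, nrm_cauchy u -> exists l, nrm_cvg u l.

Lemma nrm_cvgD u v l m : nrm_cvg u l -> nrm_cvg v m -> nrm_cvg (fun n => u n + v n) (l + m).
Proof.
move=> ul vm e e0; have e2 : 0 < e / 2 by rewrite divr_gt0.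
have [N uN] := ul _ e2; have [M vM] := vm _ e2.
exists (maxn N M) => n; rewrite geq_max => /andP[/uN un /vM vn].
by rewrite opprD addrACA (le_trans (nrmD ip _ _))// (splitr e) lerD.
Qed.

Lemma nrm_cvgZ a u l : nrm_cvg u l -> nrm_cvg (fun n => a *: u n) (a *: l).
Proof.
move=> ul e e0; have a1 : 0 < normc a + 1 by rewrite ltr_wpDl ?normc_ge0.
have [N uN] := ul _ (divr_gt0 e0 a1).
exists N => n /uN; rewrite ler_pdivlMr// -scalerBr nrmZ//; apply: le_trans.
by rewrite mulrC ler_wpM2l ?nrm_ge0// lerDl.
Qed.

Lemma nrm_cvgB u v l m : nrm_cvg u l -> nrm_cvg v m -> nrm_cvg (fun n => u n - v n) (l - m).
Proof.
move=> ul /(nrm_cvgZ (-1)) vm; rewrite -scaleN1r.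
rewrite (_ : (fun _ => _) = fun n => u n + (-1) *: v n); first exact: nrm_cvgD.
by apply/funext => n; rewrite scaleN1r.
Qed.

Lemma nrm_cvg_cauchy u l : nrm_cvg u l -> nrm_cauchy u.
Proof.
move=> ul e e0; have [N uN] := ul _ (divr_gt0 e0 (ltr0Sn _ 1)).
exists N => m n /uN um /uN; rewrite nrmC// => un.
by rewrite (le_trans (nrm_subD ip _ l _))// (splitr e) lerD.
Qed.

Lemma nrm_cvg_unique u l m : nrm_cvg u l -> nrm_cvg u m -> l = m.
Proof.
move=> ul um; apply/eqP; rewrite -subr_eq0; apply/eqP/(nrm_eq0 ip)/eqP.
rewrite eq_le nrm_ge0 andbT; apply: ler_eps => e e0; rewrite add0r.
have [N uN] := ul _ (divr_gt0 e0 (ltr0Sn _ 1)); have [M vM] := um _ (divr_gt0 e0 (ltr0Sn _ 1)).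
have := uN _ (leq_maxl N M); rewrite nrmC// => un.
by rewrite (le_trans (nrm_subD ip _ (u (maxn N M)) _))// (splitr e) lerD// vM// leq_maxr.
Qed.

Lemma dot_cvg_eq0 u l m : nrm_cvg u l -> (forall n, dot (u n) m = 0) -> dot l m = 0.
Proof.
move=> ul um0; apply: eq0_normc; apply/eqP.
rewrite eq_le normc_ge0 andbT; apply: ler_eps => e e0; rewrite add0r.
have m1 : 0 < nrm m + 1 by rewrite ltr_wpDl ?nrm_ge0.
have [N uN] := ul _ (divr_gt0 e0 m1); have := uN _ (leqnn N).
rewrite ler_pdivlMr// nrmC// => /(le_trans _); apply.
rewrite -[dot l m]subr0 -(um0 N) -dotBl//; apply: le_trans (CauchySchwarz ip _ _) _.
by rewrite ler_wpM2l ?nrm_ge0// lerDl.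
Qed.

Lemma dot_eq0_of_min (w m : E) : (forall a, nrm w <= nrm (w - a *: m)) -> dot w m = 0.
Proof.
move=> wmin; have [->|m0] := eqVneq m 0; first by rewrite dot0r.
have nm := nrm_gt0 ip m0; have nmn : nrm m != 0 by rewrite gt_eqF.
(* This multiple of [m] lowers the squared norm by [|<w, m>|^2 / |m|^2], the most possible. *)
have := wmin (((nrm m ^+ 2)^-1)%:C * dot w m).
rewrite -(ler_pXn2r (ltn0Sn 1)) ?nnegrE ?nrm_ge0// nrm_sqrB// -scalerA nrmZR// nrmZ//.
rewrite dotZr// dotZr// conj_RtoC ReZ.
have -> : Re (conjc (dot w m) * dot w m) = normc (dot w m) ^+ 2.
  by rewrite normc_sqr; case: (dot w m) => x y /=; ring.
rewrite ger0_norm ?invr_ge0 ?sqr_ge0//; set N := normc _; set a := nrm w.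
have -> : a ^+ 2 + ((nrm m ^+ 2)^-1 * (N * nrm m)) ^+ 2 - 2 * ((nrm m ^+ 2)^-1 * N ^+ 2)
   = a ^+ 2 - N ^+ 2 / nrm m ^+ 2 by field.
rewrite lerBrDr gerDl pmulr_lle0 ?invr_gt0 ?exprn_gt0// => N0.
by apply: eq0_normc; apply/eqP; rewrite -sqrf_eq0 eq_le N0 sqr_ge0.
Qed.

Hypothesis complete : ip_complete.

(** Near-minimizers of the distance from [x] form a Cauchy sequence by the parallelogram law. The
    sequence belongs to the conclusion because [M], in the applications the range of a relation,
    need not be closed. *)
Lemma projection_closure (M : set E) (x : E) : M 0 ->
  (forall a m m', M m -> M m' -> M (a *: m + m')) ->
  exists y u, [/\ forall n, M (u n), nrm_cvg u y & forall m, M m -> dot (x - y) m = 0].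
Proof.
move=> M0 Mlin; pose S := [set nrm (x - m) | m in M].
have infS : has_inf S.
  split; first by exists (nrm (x - 0)), 0.
  by exists 0 => _ [m _ <-]; exact: nrm_ge0.
pose D := inf S.
have Dle m : M m -> D <= nrm (x - m).
  by move=> Mm; apply: ge_inf; [exact: infS.2|exists m].
have D0 : 0 <= D by apply: lb_le_inf; [exact: infS.1|move=> _ [m _ <-]; exact: nrm_ge0].
have /choice[u uP] : forall n : nat, exists m, M m /\ nrm (x - m) <= D + n.+1%:R^-1.
  move=> n; have n0 : 0 < n.+1%:R^-1 :> R by rewrite invr_gt0.
  by have [_ [m Mm <-] /ltW lt] := inf_adherent n0 infS; exists m.
(* The midpoint of [m] and [m'] lies in [M], hence at distance at least [D] from [x]; the bound is
   [4 (D + a)^2 - 4 D^2]. *)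
have key m m' a : M m -> M m' -> nrm (x - m) <= D + a -> nrm (x - m') <= D + a ->
    nrm (m - m') ^+ 2 <= 8 * D * a + 4 * a ^+ 2.
  move=> Mm Mm' le le'; have := nrm_parallelogram ip (x - m') (x - m).
  have -> : (x - m') - (x - m) = m - m' by rewrite opprB addrC subrKA.
  have h2 : M ((2^-1)%:C *: m + (2^-1)%:C *: m').
    by apply: (Mlin) => //; rewrite -[_ *: m']addr0; exact: Mlin.
  have -> : (x - m') + (x - m) = 2%:C *: (x - ((2^-1)%:C *: m + (2^-1)%:C *: m')).
    rewrite scalerBr scalerDr !scalerA -!(rmorphM (real_complex R)) mulfV ?pnatr_eq0// !scale1r.
    rewrite (_ : 2%:C = 1 + 1); last by rewrite -[in RHS](rmorph1 (real_complex R)) -rmorphD.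
    by rewrite scalerDl scale1r opprD addrACA [- m' - m]addrC.
  rewrite nrmZR// ger0_norm//.
  move: (Dle _ h2) le le' (nrm_ge0 dot (x - m)) (nrm_ge0 dot (x - m')).
  move: (nrm (x - (_ + _))) (nrm (x - m)) (nrm (x - m')) => p q r.
  move: (nrm (m - m') ^+ 2) => X; nra.
have uc : nrm_cauchy u.
  move=> e e0; have K0 : 0 < 8 * D + 4 by rewrite ltr_wpDl// mulr_ge0.
  (* For [a <= 1] the bound of [key] is at most [(8 D + 4) a]. *)
  have e1 : 0 < Num.min 1 (e ^+ 2 / (8 * D + 4)).
    by rewrite lt_min ltr01 divr_gt0// exprn_gt0.
  have [N PN] := invSn_le e1.
  exists N => m n Nm Nn; rewrite -(ler_pXn2r (ltn0Sn 1)) ?nnegrE ?nrm_ge0 ?(ltW e0)//.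
  have le k : (N <= k)%N -> nrm (x - u k) <= D + N.+1%:R^-1.
    move=> Nk; apply: le_trans (uP k).2 _.
    by rewrite lerD2l lef_pV2 ?posrE// ler_nat.
  apply: le_trans (key _ _ _ (uP m).1 (uP n).1 (le _ Nm) (le _ Nn)) _.
  have := PN _ (leqnn N); rewrite le_min => /andP[].
  have : 0 < N.+1%:R^-1 :> R by rewrite invr_gt0.
  move: (N.+1%:R^-1) => a a0 a1; rewrite ler_pdivlMr//; nra.
have [y uy] := complete uc; exists y, u; split => //; first by move=> n; case: (uP n).
move=> m Mm; apply: dot_eq0_of_min => a; apply: (@le_trans _ _ D).
  apply: ler_eps => e e0; have e2 : 0 < e / 2 by rewrite divr_gt0.
  have [N uN] := uy _ e2; have [N' PN'] := invSn_le e2.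
  apply: le_trans (nrm_subD ip _ (u (maxn N N')) _) _.
  have := uN _ (leq_maxl N N'); have := (uP (maxn N N')).2.
  by have := PN' _ (leq_maxr N N'); move: ((maxn N N').+1%:R^-1 : R) => t; lra.
apply: ler_eps => e e0; have [N uN] := uy _ e0.
apply: le_trans (Dle (a *: m + u N) _) _; first by apply: (Mlin) => //; case: (uP N).
have -> : x - (a *: m + u N) = (x - y - a *: m) + (y - u N).
  by rewrite opprD addrA [RHS]addrAC addrA subrK addrAC.
by rewrite (le_trans (nrmD ip _ _))// lerD2l nrmC// uN.
Qed.

End convergence.

(** * Self-adjoint relations and gaps in the spectrum *)

Section relations.
Context (R : realType) (E : lmodType R[i]) (dot : E -> E -> R[i]).
Hypothesis ip : inner_product dot.
Hypothesis complete : ip_complete dot.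
Local Notation nrm := (ip_norm dot).
Implicit Types (A B V : set (E * E)) (z : R[i]).

Definition linear_rel A := A (0, 0) /\ forall a u v u' v',
  A (u, v) -> A (u', v') -> A (a *: u + u', a *: v + v').

Definition closed_rel A := forall u v l m, (forall n, A (u n, v n)) ->
  nrm_cvg dot u l -> nrm_cvg dot v m -> A (l, m).

Definition symmetric_rel A := forall u v u' v',
  A (u, v) -> A (u', v') -> dot v u' = dot u v'.

Definition selfadjoint_rel A := linear_rel A /\ forall w w',
  A (w, w') <-> forall u u', A (u, u') -> dot u' w = dot u w'.

Definition shift_rel A z : set (E * E) := [set uw | exists2 v, A (uw.1, v) & uw.2 = v - z *: uw.1].

(** Bounded below and onto: for a linear graph this says that [A - z] has a bounded, everywhere
    defined inverse, without forming it. *)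
Definition resolvent_set A z :=
  (exists C : R, forall u v, A (u, v) -> nrm u <= C * nrm (v - z *: u)) /\
  forall y, exists u v, A (u, v) /\ v - z *: u = y.

Lemma linear_relZ A a u v : linear_rel A -> A (u, v) -> A (a *: u, a *: v).
Proof. by move=> [A0 Al] Auv; have := Al a _ _ _ _ Auv A0; rewrite !addr0. Qed.

Lemma linear_relD A u v u' v' : linear_rel A ->
  A (u, v) -> A (u', v') -> A (u + u', v + v').
Proof. by move=> [A0 Al] Auv /(Al 1 _ _ _ _ Auv); rewrite !scale1r. Qed.

Lemma linear_relB A u v u' v' : linear_rel A ->
  A (u, v) -> A (u', v') -> A (u - u', v - v').
Proof.
move=> lA Auv /(linear_relZ (-1) lA); rewrite !scaleN1r; exact: linear_relD.
Qed.

Lemma linear_rel_sum A (n : nat) (u v : 'I_n -> E) : linear_rel A ->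
  (forall i, A (u i, v i)) -> A (\sum_i u i, \sum_i v i).
Proof.
move=> lA Auv; apply: (big_ind2 (fun x y => A (x, y))); first exact: lA.1.
- by move=> *; exact: linear_relD.
- by move=> i _; exact: Auv.
Qed.

Lemma shift_rel_linear A z : linear_rel A -> linear_rel (shift_rel A z).
Proof.
move=> lA; split; first by exists 0; rewrite /= ?scaler0 ?subr0//; exact: lA.1.
move=> a u _ u' _ [v /= Av ->] [v' /= Av' ->]; exists (a *: v + v'); first exact: lA.2.
by rewrite /= scalerBr scalerDr !scalerA [z * a]mulrC opprD addrACA.
Qed.

Lemma shift_rel_closed A z : closed_rel A -> closed_rel (shift_rel A z).
Proof.
move=> cA u v l m Auv ul vm; exists (m + z *: l); last by rewrite /= addrK.
apply: (cA u (fun n => v n + z *: u n)) => //.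
  by move=> n; have [w Aw /= ->] := Auv n; rewrite subrK.
by apply: nrm_cvgD => //; exact: nrm_cvgZ.
Qed.

(** The lower bound makes the range closed, since preimages of a convergent sequence are Cauchy; its
    orthogonal complement is trivial by the last hypothesis. *)
Lemma bounded_below_surjective A (C : R) : linear_rel A -> closed_rel A ->
  (forall u v, A (u, v) -> nrm u <= C * nrm v) ->
  (forall y, (forall u v, A (u, v) -> dot v y = 0) -> y = 0) ->
  forall y, exists u, A (u, y).
Proof.
move=> lA cA bA kA x.
have [||y [v [Mv vy yM]]] := projection_closure ip complete (M := [set v | exists u, A (u, v)]) x.
- by exists 0; exact: lA.1.
- by move=> a m m' [u Au] [u' Au']; exists (a *: u + u'); exact: lA.2.
have {yM}/eqP : x - y = 0.
  by apply: kA => u w Auw; rewrite -dotJ// yM ?conjc0//; exists u.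
rewrite subr_eq0 => /eqP ->; have /choice[u uP] := Mv.
have [l ul] : exists l, nrm_cvg dot u l.
  apply: complete => e e0; have C1 : 0 < `|C| + 1 by rewrite ltr_wpDl.
  have [N vN] := nrm_cvg_cauchy ip vy (divr_gt0 e0 C1).
  exists N => m n Nm Nn; apply: le_trans (bA _ _ (linear_relB lA (uP m) (uP n))) _.
  have := vN _ _ Nm Nn; rewrite ler_pdivlMr//; apply: le_trans.
  rewrite mulrC ler_wpM2l ?nrm_ge0//.
  by rewrite (le_trans (ler_norm _))// lerDl.
by exists l; exact: cA uP ul vy.
Qed.

Section selfadjoint.
Variable A : set (E * E).
Hypothesis sA : selfadjoint_rel A.

Lemma selfadjoint_linear : linear_rel A. Proof. by case: sA. Qed.

Lemma selfadjoint_symmetric : symmetric_rel A.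
Proof. by move=> u v u' v' Auv /(sA.2 u' v'); exact. Qed.

Lemma selfadjoint_closed : closed_rel A.
Proof.
move=> u v l m Auv ul vm; apply/sA.2 => w w' Aw.
rewrite -(dotJ ip w' l) -(dotJ ip w m); congr conjc; apply/eqP.
rewrite -subr_eq0; apply/eqP/eq0_normc/eqP.
rewrite eq_le normc_ge0 andbT; apply: ler_eps => e e0; rewrite add0r.
have K : 0 < nrm w + nrm w' + 1 by rewrite ltr_wpDl// addr_ge0 ?nrm_ge0.
have [N uN] := ul _ (divr_gt0 e0 K); have [M vM] := vm _ (divr_gt0 e0 K).
have {}uN := uN _ (leq_maxl N M); have {}vM := vM _ (leq_maxr N M).
have -> : dot l w' - dot m w
    = - dot (u (maxn N M) - l) w' + dot (v (maxn N M) - m) w.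
  rewrite !dotBl// (selfadjoint_symmetric (Auv (maxn N M)) Aw).
  by rewrite opprB addrA subrK.
apply: le_trans (le_normcD _ _) _; rewrite normcN.
have le1 := CauchySchwarz ip (u (maxn N M) - l) w'.
have le2 := CauchySchwarz ip (v (maxn N M) - m) w.
apply: le_trans (lerD le1 le2) _.
rewrite -[leRHS](divfK (lt0r_neq0 K)).
move: uN vM (nrm_ge0 dot w) (nrm_ge0 dot w') (nrm_ge0 dot (u (maxn N M) - l))
  (nrm_ge0 dot (v (maxn N M) - m)).
have : 0 < e / (nrm w + nrm w' + 1) by rewrite divr_gt0.
move: (e / (nrm w + nrm w' + 1)) (nrm (u _ - l)) (nrm (v _ - m)) (nrm w) (nrm w') => f a b c d; nra.
Qed.

Lemma selfadjoint_dot_real u v : A (u, v) -> dot v u = (Re (dot v u))%:C.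
Proof.
move=> Auv; have := selfadjoint_symmetric Auv Auv; rewrite -(dotJ ip u v).
by case: (dot v u) => x y /= [] yN; apply/eqP; rewrite eq_complex/= eqxx/=; apply/eqP; lra.
Qed.

(** The cross term between [(A - Re z) u] and [i Im z u] vanishes because [<A u, u>] is real. *)
Lemma nrm_shift_sqr z u v : A (u, v) ->
  nrm (v - z *: u) ^+ 2 = nrm (v - (Re z)%:C *: u) ^+ 2 + (Im z * nrm u) ^+ 2.
Proof.
move=> Auv; rewrite !nrm_sqrB// nrmZR// nrmZ// !dotZr// conj_RtoC ReZ exprMn normc_sqr.
rewrite exprMn real_normK ?num_real// (selfadjoint_dot_real Auv).
by case: z => x y /=; ring.
Qed.

(** A vector orthogonal to the range of [A - z] is an eigenvector for [conjc z]. By [nrm_shift_sqr]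
    both [A - z] and [A - conjc z] give it the same norm, namely 0, so the lower bound kills it. *)
Lemma selfadjoint_resolvent z : (exists C : R, forall u v, A (u, v) -> nrm u <= C * nrm (v - z *: u)) ->
  resolvent_set A z.
Proof.
move=> bA; split => // y; have [C CP] := bA.
have [||w||u [v /= Av ->]] := @bounded_below_surjective (shift_rel A z) C _ _ _ _ y.
- exact/shift_rel_linear/selfadjoint_linear.
- exact/shift_rel_closed/selfadjoint_closed.
- by move=> w' [v /= Av ->]; exact: CP.
- move=> {}y yP; have Ay : A (y, conjc z *: y).
    apply/sA.2 => u v Auv; apply/eqP; rewrite dotZr// conjcK -dotZl// -subr_eq0 -dotBl//.
    by apply/eqP/(yP u); exists v.
  apply: (nrm_eq0 ip); apply/eqP; rewrite eq_le nrm_ge0 andbT.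
  apply: le_trans (CP _ _ Ay) _.
  suff -> : nrm (conjc z *: y - z *: y) = 0 by rewrite mulr0.
  apply/eqP; rewrite -sqrf_eq0 (nrm_shift_sqr _ Ay).
  have := nrm_shift_sqr (conjc z) Ay; rewrite subrr nrm0//; case: z {bA CP yP Ay} => a b /=.
  by rewrite mulNr sqrrN => <-; rewrite expr0n.
by exists u, v.
Qed.

Lemma selfadjoint_resolvent_nonreal z : Im z != 0 -> resolvent_set A z.
Proof.
move=> z0; apply: selfadjoint_resolvent; exists `|Im z|^-1 => u v Auv.
rewrite mulrC ler_pdivlMr ?normr_gt0//.
rewrite -(ler_pXn2r (ltn0Sn 1)) ?nnegrE ?mulr_ge0 ?nrm_ge0//.
rewrite (nrm_shift_sqr _ Auv) exprMn real_normK ?num_real// -exprMn mulrC.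
by rewrite lerDr sqr_ge0.
Qed.

End selfadjoint.
End relations.

Section gaps.
Context (R : realType) (E : lmodType R[i]) (dot : E -> E -> R[i]).
Hypothesis ip : inner_product dot.
Hypothesis complete : ip_complete dot.
Local Notation nrm := (ip_norm dot).
Variable A : set (E * E).
Hypothesis sA : selfadjoint_rel dot A.
Implicit Types (u v w : E) (c : R).

Lemma RtoCD (a b : R) : (a + b)%:C = a%:C + b%:C. Proof. exact: rmorphD. Qed.

Lemma RtoCM (a b : R) : (a * b)%:C = a%:C * b%:C. Proof. exact: rmorphM. Qed.

Lemma RtoCN (a : R) : (- a)%:C = - a%:C. Proof. exact: rmorphN. Qed.

Lemma nrm_shiftR_sqr c u v : nrm (v - c%:C *: u) ^+ 2 =
  nrm v ^+ 2 - 2 * c * Re (dot v u) + c ^+ 2 * nrm u ^+ 2.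
Proof.
rewrite nrm_sqrB// nrmZR// dotZr// conj_RtoC ReZ exprMn real_normK ?num_real//; ring.
Qed.

(* If [s], the norm of [S = (A - c)^-1], exceeded [1 / r], then [c + 1/s] and
   [c - 1/s] would be in the resolvent set, making [(S - s)(S + s)] bounded
   below; but [|(S^2 - s^2) x|] is small when [|S x|] is close to [s |x|]. *)
Lemma resolvent_ball c (r : R) : 0 < r ->
  (forall c', `|c' - c| < r -> resolvent_set dot A c'%:C) ->
  forall u v, A (u, v) -> r * nrm u <= nrm (v - c%:C *: u).
Proof.
move=> r0 res.
have lA := selfadjoint_linear sA.
have Alin (a : R[i]) u v u' v' (z : R) : A (u, v) -> A (u', v') ->
    A (a *: u + u', a *: v + v') /\
    (a *: v + v') - z%:C *: (a *: u + u') = a *: (v - z%:C *: u) + (v' - z%:C *: u').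
  move=> Auv Auv'; split; first exact: lA.2.
  by rewrite scalerBr scalerDr !scalerA [a * _]mulrC opprD addrACA.
have AZ (a : R[i]) u v : A (u, v) -> A (a *: u, a *: v) by exact: linear_relZ.
have [[C CP] surj] : resolvent_set dot A c%:C by apply: res; rewrite subrr normr0.
pose S := [set nrm u | u in [set u | exists2 v, A (u, v) & nrm (v - c%:C *: u) <= 1]].
have S0 : S 0.
  exists 0; rewrite ?nrm0//; exists 0; first exact: lA.1.
  by rewrite scaler0 subr0 nrm0.
have supS : has_sup S.
  split; first by exists 0.
  exists `|C| => _ [u [v Auv le1] <-]; apply: le_trans (CP _ _ Auv) _.
  apply: le_trans (ler_norm _) _; rewrite normrM -[leRHS]mulr1 ler_wpM2l//.
  by rewrite ger0_norm ?nrm_ge0.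
pose s := sup S.
have s_ge0 : 0 <= s by exact: (sup_upper_bound supS).
have sP u v : A (u, v) -> nrm u <= s * nrm (v - c%:C *: u).
  move=> Auv; set w := v - _; have [w0|w0] := eqVneq w 0.
    by have := CP _ _ Auv; rewrite -/w w0 nrm0// !mulr0.
  have nw := nrm_gt0 ip w0; rewrite -ler_pdivrMr// mulrC.
  apply: (sup_upper_bound supS).
  exists ((nrm w)^-1%:C *: u); last by rewrite nrmZR// ger0_norm// invr_ge0 nrm_ge0.
  exists ((nrm w)^-1%:C *: v); first exact: AZ.
  rewrite scalerA [c%:C * _]mulrC -scalerA -scalerBr nrmZR//.
  by rewrite ger0_norm ?invr_ge0 ?nrm_ge0// mulVf// gt_eqF.
have [rs|rs] := leP s r^-1.
  move=> u v /sP le; rewrite mulrC -ler_pdivlMr// mulrC; apply: le_trans le _.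
  by rewrite ler_wpM2r ?nrm_ge0.
exfalso.
have s0 : 0 < s by apply: lt_trans rs; rewrite invr_gt0.
have sn0 : s != 0 by rewrite gt_eqF.
have sr : s^-1 < r by rewrite -[ltRHS]invrK ltf_pV2 ?posrE ?invr_gt0.
have [[K1 KP1] _] : resolvent_set dot A (c + s^-1)%:C.
  by apply: res; rewrite addrAC subrr add0r ger0_norm// invr_ge0 ltW.
have [[K2 KP2] _] : resolvent_set dot A (c - s^-1)%:C.
  by apply: res; rewrite addrAC subrr add0r normrN ger0_norm// invr_ge0 ltW.
pose K := `|K1| + `|K2| + 1.
have K0 : 0 < K by rewrite ltr_wpDl// addr_ge0.
have KpP u v : A (u, v) -> nrm u <= K * nrm (v - (c + s^-1)%:C *: u).
  move=> /KP1 /le_trans; apply; rewrite ler_wpM2r ?nrm_ge0//.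
  by have := ler_norm K1; have := normr_ge0 K2; rewrite /K; lra.
have KmP u v : A (u, v) -> nrm u <= K * nrm (v - (c - s^-1)%:C *: u).
  move=> /KP2 /le_trans; apply; rewrite ler_wpM2r ?nrm_ge0//.
  by have := ler_norm K2; have := normr_ge0 K1; rewrite /K; lra.
have shiftE (t : R) u v : v - (c + t)%:C *: u = (v - c%:C *: u) - t%:C *: u.
  by rewrite RtoCD scalerDl opprD addrA.
(* [L] composes two lower bounds: the one for [A - (c + 1/s)] gives [le_Y] and [le_y], the one for
   [A - (c - 1/s)] gives [le_u1]. *)
pose L := K / s * ((K / s + 1) / s).
have L0 : 0 < L by rewrite !mulr_gt0 ?invr_gt0// addr_gt0// divr_gt0.
(* In the end [s^2/4 <= |u1|^2 <= L^2 |rho|^2 <= 2 L^2 s^3 del], and the second term of the minimum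
   makes the last quantity at most [s^2/8]. *)
pose del := Num.min (s / 2) (16 * L ^+ 2 * s)^-1.
have L20 : 0 < 16 * L ^+ 2 * s by rewrite mulr_gt0// mulr_gt0// exprn_gt0.
have del0 : 0 < del by rewrite lt_min invr_gt0 L20 andbT divr_gt0.
have [_ [u1 [v1 Au1 x1] <-] lt1] := sup_adherent del0 supS.
have {lt1} lt1 : s - del < nrm u1 by [].
set x := v1 - c%:C *: u1 in x1.
have [u2 [v2 [Au2 eq2]]] := surj u1.
(* With T the inverse of [A - c]: [u1 = T x], [u2 = T^2 x] and [rho = (T^2 - s^2) x].
   Self-adjointness gives [<u2, x> = |u1|^2], so [rho] is small when [|u1|] is close to [s]. *)
pose rho := u2 - (s ^+ 2)%:C *: x.
have u1s : nrm u1 <= s.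
  by apply: le_trans (sP _ _ Au1) _; rewrite -[leRHS]mulr1 ler_pM2l.
have u2s : nrm u2 <= s * nrm u1 by rewrite -[in leRHS]eq2; exact: sP.
have dot21 : Re (dot u2 x) = nrm u1 ^+ 2.
  rewrite /x dotBr// dotZr// conj_RtoC -(selfadjoint_symmetric sA Au2 Au1).
  by rewrite -dotZl// -dotBl// eq2 nrm_sqr.
have rhole : nrm rho ^+ 2 <= s ^+ 4 - s ^+ 2 * nrm u1 ^+ 2.
  rewrite nrm_sqrB// nrmZR// ger0_norm ?sqr_ge0// dotZr// conj_RtoC ReZ dot21.
  have le2 : nrm u2 ^+ 2 <= s ^+ 2 * nrm u1 ^+ 2.
    by rewrite -exprMn ler_pXn2r// nnegrE ?nrm_ge0// mulr_ge0// nrm_ge0.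
  have le3 : (s ^+ 2 * nrm x) ^+ 2 <= s ^+ 4.
    rewrite exprMn -exprM -[leRHS]mulr1 ler_wpM2l ?exprn_ge0//.
    by rewrite expr_le1 ?nrm_ge0.
  lra.
(* Here [y = (T + s) x] and [Y = T y], so that [rho = (T - s) y]. *)
pose y := u1 + s%:C *: x; pose Y := u2 + s%:C *: u1.
have AY : A (Y, v2 + s%:C *: v1) by apply: linear_relD => //; exact: AZ.
have YE : (v2 + s%:C *: v1) - c%:C *: Y = y.
  have -> : y = (v2 - c%:C *: u2) + s%:C *: x by rewrite eq2.
  rewrite /Y /x scalerBr scalerDr !scalerA [s%:C * _]mulrC.
  by rewrite opprD addrACA.
have rhoE : rho = Y - s%:C *: y.
  by rewrite /rho /Y /y (scalerDr _ u1) scalerA -RtoCM -expr2 opprD addrA addrK.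
have le_Y : nrm Y <= K / s * nrm rho.
  have := KpP _ _ AY; rewrite shiftE YE rhoE.
  have -> : y - s^-1%:C *: Y = (- s^-1)%:C *: (Y - s%:C *: y).
    by rewrite scalerBr RtoCN !scaleNr opprK scalerA -RtoCM mulVf// scale1r addrC.
  by rewrite nrmZR// normrN ger0_norm ?invr_ge0 ?(ltW s0)// mulrA.
have le_y : nrm y <= (K / s + 1) / s * nrm rho.
  have : nrm (s%:C *: y) <= nrm Y + nrm rho.
    by rewrite (_ : s%:C *: y = Y - rho) ?nrmB// rhoE opprB addrC subrK.
  rewrite nrmZR// (gtr0_norm s0) mulrAC ler_pdivlMr// mulrDl mul1r [s * _]mulrC.
  by move=> /le_trans; apply; rewrite lerD2r.
have le_u1 : nrm u1 <= L * nrm rho.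
  have := KmP _ _ Au1; rewrite shiftE -/x RtoCN scaleNr opprK.
  have -> : x + s^-1%:C *: u1 = s^-1%:C *: y.
    by rewrite /y (scalerDr _ u1) scalerA -RtoCM mulVf// scale1r addrC.
  rewrite nrmZR// ger0_norm ?invr_ge0 ?(ltW s0)// mulrA => /le_trans; apply.
  by rewrite /L -[leRHS]mulrA ler_wpM2l// ltW// divr_gt0.
have dels : del <= s / 2 by rewrite ge_min lexx.
have delL : 16 * L ^+ 2 * s * del <= 1.
  rewrite mulrC -ler_pdivlMr// mul1r.
  by rewrite ge_min lexx orbT.
have {}rhole : nrm rho ^+ 2 <= 2 * s ^+ 3 * del.
  apply: le_trans rhole _.
  have : (s - del) ^+ 2 <= nrm u1 ^+ 2.
    by rewrite ler_pXn2r ?nnegrE ?nrm_ge0 ?(ltW lt1)//; lra.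
  move=> /(ler_wpM2l (sqr_ge0 s)).
  have : 0 <= s ^+ 2 * del ^+ 2 by rewrite mulr_ge0 ?sqr_ge0.
  lra.
have : (s / 2) ^+ 2 <= L ^+ 2 * nrm rho ^+ 2.
  have Lr : 0 <= L * nrm rho by rewrite mulr_ge0 ?nrm_ge0// ltW.
  have s2 : 0 <= s / 2 by rewrite divr_ge0// ltW.
  rewrite -exprMn ler_pXn2r ?nnegrE//.
  apply: le_trans le_u1; apply/ltW/(le_lt_trans _ lt1); move: dels.
  by move=> le; rewrite lerBrDr -lerBrDl (le_trans le)//; lra.
have : L ^+ 2 * nrm rho ^+ 2 <= L ^+ 2 * (2 * s ^+ 3 * del) by rewrite ler_wpM2l ?sqr_ge0.
have : s ^+ 2 * (16 * L ^+ 2 * s * del) <= s ^+ 2.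
  by rewrite -[leRHS]mulr1 ler_wpM2l ?sqr_ge0.
have : 0 < s ^+ 2 by rewrite exprn_gt0.
lra.
Qed.

(** The conclusion is [0 <= Re <(A - al) u, (A - be) u>]. It is the square of the estimate of
    [resolvent_ball] at the midpoint of the gap, with half its length as radius. *)
Lemma resolvent_gap (al be : R) : al < be ->
  (forall c, al < c < be -> resolvent_set dot A c%:C) ->
  forall u v, A (u, v) ->
    0 <= nrm v ^+ 2 - (al + be) * Re (dot v u) + al * be * nrm u ^+ 2.
Proof.
move=> ab res u v Auv.
have r0 : 0 < (be - al) / 2 by lra.
have ball c : `|c - (al + be) / 2| < (be - al) / 2 -> resolvent_set dot A c%:C.
  by rewrite ltr_norml => /andP[h1 h2]; apply: res; apply/andP; split; lra.
have := resolvent_ball r0 ball Auv.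
have rn : 0 <= (be - al) / 2 * nrm u by rewrite mulr_ge0 ?nrm_ge0// ltW.
rewrite -(ler_pXn2r (ltn0Sn 1)) ?nnegrE ?nrm_ge0//.
rewrite nrm_shiftR_sqr exprMn.
by move: (nrm v ^+ 2) (nrm u ^+ 2) (Re _) => a b d; lra.
Qed.

(** The inequality for the gap from [- N] to [- a0] is affine in [N] with slope
    [Re <v, u> + a0 |u|^2]. As [N] is arbitrarily large, the slope cannot be negative. *)
Lemma resolvent_halfline_semibounded (a0 : R) :
  (forall c, c < - a0 -> resolvent_set dot A c%:C) ->
  forall u v, A (u, v) -> - a0 * nrm u ^+ 2 <= Re (dot v u).
Proof.
move=> res u v Auv; rewrite leNgt; apply/negP => lt0.
pose t := - (Re (dot v u) + a0 * nrm u ^+ 2).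
have t0 : 0 < t by rewrite /t; lra.
pose M := nrm v ^+ 2 + a0 * Re (dot v u).
pose N := `|a0| + 1 + `|M| / t.
have N0 : a0 < N.
  have : 0 <= `|M| / t by rewrite divr_ge0// ltW.
  by have := ler_norm a0; rewrite /N; lra.
have := @resolvent_gap (- N) (- a0) _ _ u v Auv; rewrite ltrN2 => /(_ N0).
have res' c : - N < c < - a0 -> resolvent_set dot A c%:C.
  by move=> /andP[_]; exact: res.
move=> /(_ res').
have -> : nrm v ^+ 2 - (- N - a0) * Re (dot v u) + - N * - a0 * nrm u ^+ 2
    = M - N * t by rewrite /M /t; ring.
have : `|M| / t * t = `|M| by rewrite divfK// gt_eqF.
have : 0 <= (`|a0| + 1) * t - t by rewrite mulrDl mul1r addrK mulr_ge0// ltW.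
have := ler_norm M; rewrite /N mulrDl; lra.
Qed.

(** With [B = A - lam], the gaps on both sides bound the form of the inverse of [B], which after
    polarization reads [e Re <b, u'> <= |b| |b'|] on the graph of [B]. A vector [m] orthogonal to
    the kernel is a limit of elements [b] of the range; with [u' = m] and [b' = B m] the limit gives
    [e |m|^2 <= |m| |B m|]. *)
Lemma isolated_bounded_below (lam e : R) : 0 < e ->
  (forall c, 0 < `|c - lam| < e -> resolvent_set dot A c%:C) ->
  forall m w, A (m, w) -> (forall n, A (n, lam%:C *: n) -> dot m n = 0) ->
  e * nrm m <= nrm (w - lam%:C *: m).
Proof.
move=> e0 res m w Amw mN.
have lA := selfadjoint_linear sA.
pose B := shift_rel A lam%:C.
have lB : linear_rel B by exact: shift_rel_linear.
have symB u b u' b' : B (u, b) -> B (u', b') -> Re (dot b u') = Re (dot b' u).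
  move=> [v /= Av ->] [v' /= Av' ->]; rewrite !dotBl// !dotZl// !ReD !ReN !ReZ.
  rewrite (selfadjoint_symmetric sA Av Av') [Re (dot u v')]Re_dotC//.
  by rewrite [Re (dot u u')]Re_dotC.
(* The gap below [lam] gives the second inequality and the gap above it the first. *)
have q1 u b : B (u, b) -> e * Re (dot b u) <= nrm b ^+ 2 /\ - (e * Re (dot b u)) <= nrm b ^+ 2.
  move=> [v /= Auv ->].
  have g1 : 0 <= nrm v ^+ 2 - (lam - e + lam) * Re (dot v u) + (lam - e) * lam * nrm u ^+ 2.
    apply: resolvent_gap => //; first by lra.
    by move=> c /andP[c1 c2]; apply: res; rewrite ltr0_norm; lra.
  have g2 : 0 <= nrm v ^+ 2 - (lam + (lam + e)) * Re (dot v u) + lam * (lam + e) * nrm u ^+ 2.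
    apply: resolvent_gap => //; first by lra.
    by move=> c /andP[c1 c2]; apply: res; rewrite gtr0_norm; lra.
  rewrite nrm_shiftR_sqr dotBl// dotZl// ReD ReN ReZ -nrm_sqr//.
  by split; lra.
(* Polarization: the upper bound for the sum and the lower one for the difference. Normalizing [b]
   and [b'] then turns the sum of squares into the product of [q3]. *)
have q2 u b u' b' : B (u, b) -> B (u', b') ->
    2 * e * Re (dot b u') <= nrm b ^+ 2 + nrm b' ^+ 2.
  move=> Bu Bu'; have [+ _] := q1 _ _ (linear_relD lB Bu Bu').
  have [_ +] := q1 _ _ (linear_relB lB Bu Bu').
  have := nrm_parallelogram ip b b'; have := symB _ _ _ _ Bu Bu'.
  have -> : dot (b + b') (u + u') = (dot b u + dot b u') + (dot b' u + dot b' u').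
    by rewrite dotDl// !(dotDr ip).
  have -> : dot (b - b') (u - u') = (dot b u - dot b u') - (dot b' u - dot b' u').
    by rewrite dotBl// !(dotBr ip).
  rewrite !ReD !ReN !ReD !ReN => -> P1.
  move: (Re (dot b u)) (Re (dot b' u)) (Re (dot b' u')) => x1 x2 x3.
  move: P1; move: (nrm (b + b') ^+ 2) (nrm (b - b') ^+ 2) (nrm b ^+ 2) (nrm b' ^+ 2).
  clear; move=> n1 n2 n3 n4; lra.
have q3 u b u' b' : B (u, b) -> B (u', b') ->
    e * Re (dot b u') <= nrm b * nrm b'.
  move=> Bu Bu'.
  have [b0|b0] := eqVneq b 0; first by rewrite b0 dot0l// nrm0// mulr0 mul0r.
  have [b'0|b'0] := eqVneq b' 0.
    by rewrite (symB _ _ _ _ Bu Bu') b'0 dot0l// nrm0// !mulr0.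
  have nb := nrm_gt0 ip b0; have nb' := nrm_gt0 ip b'0.
  have := q2 _ _ _ _ (linear_relZ (nrm b)^-1%:C lB Bu) (linear_relZ (nrm b')^-1%:C lB Bu').
  rewrite !nrmZR// dotZl// dotZr// conj_RtoC !ReZ !ger0_norm ?invr_ge0 ?nrm_ge0//.
  rewrite !mulVf ?gt_eqF// expr1n.
  have -> : 2 * e * ((nrm b)^-1 * ((nrm b')^-1 * Re (dot b u')))
     = 2 * (e * Re (dot b u') / (nrm b * nrm b')) by rewrite invfM; ring.
  by rewrite -[X in _ <= X]mulr1 ler_pM2l// ler_pdivrMr ?mulr_gt0// mul1r.
have [||y [b [ranb by_ yM]]] :=
    projection_closure ip complete (M := [set b | exists u, B (u, b)]) m.
- by exists 0; exact: lB.1.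
- by move=> a b b' [u Bu] [u' Bu']; exists (a *: u + u'); exact: lB.2.
(* [m - y] is orthogonal to the range of [B], hence in the kernel by self-adjointness, and it is
   also orthogonal to the kernel. *)
have mE : m = y.
  have kermy : A (m - y, lam%:C *: (m - y)).
    apply/sA.2 => u u' Auu'; apply/eqP; rewrite dotZr// conj_RtoC -dotZl// -subr_eq0 -dotBl//.
    by rewrite -dotJ// yM ?conjc0//; exists u, u'.
  apply/eqP; rewrite -subr_eq0; apply/eqP/(nrm_eq0 ip)/eqP.
  rewrite -sqrf_eq0 nrm_sqr// dotBl// mN// (dot_cvg_eq0 ip by_) ?subrr// => n.
  by rewrite -dotJ// yM// conjc0.
set W := w - _; have BW : B (m, W) by exists w.
rewrite leNgt; apply/negP => lt0.
have m0 : 0 < nrm m.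
  rewrite lt_def nrm_ge0 andbT; apply: contraTneq lt0 => ->.
  by rewrite mulr0 -leNgt nrm_ge0.
(* Replacing [m] by [b N] changes the two sides by at most [(e |m| + |W|) |b N - m|] in total, which
   is kept below [gam / 2]. *)
pose gam := nrm m * (e * nrm m - nrm W).
have gam0 : 0 < gam by rewrite mulr_gt0// subr_gt0.
have k0 : 0 < e * nrm m + nrm W by rewrite ltr_wpDr ?nrm_ge0// mulr_gt0.
have eta0 : 0 < gam / (e * nrm m + nrm W) / 2 by rewrite !divr_gt0.
have [N bN] := by_ _ eta0; have {bN} bN := bN N (leqnn N); rewrite -mE in bN.
have [u Bu] := ranb N; have := q3 _ _ _ _ Bu BW.
have : nrm (b N) <= nrm m + nrm (b N - m) by rewrite addrC nrm_le_subD.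
have : Re (dot (b N) m) >= nrm m ^+ 2 - nrm (b N - m) * nrm m.
  have -> : dot (b N) m = dot m m + dot (b N - m) m by rewrite -dotDl// addrC subrK.
  rewrite ReD -nrm_sqr// lerD2l lerNl -ReN -dotNl//.
  by apply: le_trans (Re_dot_le ip _ _) _; rewrite nrmN.
move: bN; rewrite ler_pdivlMr// ler_pdivlMr//.
rewrite /gam in gam0 *.
move: (nrm_ge0 dot W) (nrm_ge0 dot (b N - m)) m0 gam0.
move: (nrm W) (nrm (b N - m)) (nrm (b N)) (nrm m) (Re _) => W' et bn M r.
move=> W0 et0 M0 gam0 h1 h2 h3 h4.
have : e * (M ^+ 2 - et * M) <= e * r by rewrite ler_pM2l.
have : bn * W' <= (M + et) * W' by rewrite ler_wpM2r.
have : 0 <= et * (e * M) by rewrite !mulr_ge0// ltW.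
lra.
Qed.

End gaps.

(** * The essential spectrum as an a priori estimate *)

Lemma exists_left_kernel (F : fieldType) (k n : nat) (M : 'M[F]_(k, n)) : (n < k)%N ->
  exists2 c : 'I_k -> F, exists j, c j != 0 & forall i, \sum_j c j * M j i = 0.
Proof.
move=> nk; have : kermx M != 0.
  rewrite kermx_eq0 /row_free; apply: contraTneq nk => rk.
  by rewrite -leqNgt -rk rank_leq_col.
move=> /rowV0Pn[v /sub_kermxP vM v0].
exists (fun j => v 0 j); last first.
  by move=> i; have := congr1 (fun A : 'rV[F]_n => A 0 i) vM; rewrite !mxE.
have /rV0Pn[j] : v != 0 by [].
by exists j.
Qed.

Section fredholm.
Context (R : realType) (E : lmodType R[i]) (dot : E -> E -> R[i]).
Hypothesis ip : inner_product dot.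
Hypothesis complete : ip_complete dot.
Local Notation nrm := (ip_norm dot).
Implicit Types (u v w : E) (c : R).

Lemma orthonormal_comb_neq0 k (f : 'I_k -> E) (c : 'I_k -> R[i]) j : orthonormal dot f ->
  c j != 0 -> \sum_j c j *: f j != 0.
Proof.
move=> of_; apply: contraNneq => s0; have := dot0l ip (f j).
rewrite -s0 dot_suml// (bigD1 j)//= dotZl// of_ eqxx mulr1 big1 ?addr0 => [-> //|i /negPf ij].
by rewrite dotZl// of_ ij mulr0.
Qed.

(** If [n < k], the [n] homogeneous equations for the [k] coefficients have a nonzero solution. *)
Lemma orthonormal_size_functionals k n (f : 'I_k -> E) (e : 'I_n -> E) : orthonormal dot f ->
  (forall c : 'I_k -> R[i], (forall i, dot (\sum_j c j *: f j) (e i) = 0) ->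
    \sum_j c j *: f j = 0) -> (k <= n)%N.
Proof.
move=> of_ inj; rewrite leqNgt; apply/negP => nk.
have [c [j cj] cM] := exists_left_kernel (\matrix_(j, i) dot (f j) (e i)) nk.
have /eqP := orthonormal_comb_neq0 of_ cj; apply; apply: inj => i.
rewrite dot_suml// -[RHS](cM i); apply: eq_bigr => l _.
by rewrite dotZl// mxE.
Qed.

Lemma orthonormal_size_span k n (f : 'I_k -> E) (e : 'I_n -> E) (C : 'I_k -> 'I_n -> R[i]) :
  orthonormal dot f -> (forall j, f j = \sum_i C j i *: e i) -> (k <= n)%N.
Proof.
move=> of_ fC; rewrite leqNgt; apply/negP => nk.
have [c [j cj] cM] := exists_left_kernel (\matrix_(j, i) C j i) nk.
have /eqP := orthonormal_comb_neq0 of_ cj; apply.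
under eq_bigr do rewrite fC scaler_sumr.
rewrite exchange_big big1//= => i _.
under eq_bigr do rewrite scalerA.
rewrite -scaler_suml; have := cM i; under eq_bigr do rewrite mxE.
by move=> ->; rewrite scale0r.
Qed.

(* The functionals are removed one at a time.  If the last one cannot be
   removed, there are [u_k] with [<u_k, e_n> = 1] along which all other terms
   of the estimate tend to [0]; they form a Cauchy sequence, whose limit lies
   in the kernel. *)
Lemma injective_remove_functionals (G : set (E * E)) n (e : 'I_n -> E) (C : R) :
  linear_rel G -> closed_rel dot G -> (forall u, G (u, 0) -> u = 0) ->
  (forall u b, G (u, b) -> nrm u <= C * (nrm b + \sum_i normc (dot u (e i)))) ->
  exists C' : R, forall u b, G (u, b) -> nrm u <= C' * nrm b.
Proof.
move=> lG cG iG; elim: n e C => [|n IH] e C bG.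
  by exists C => u b /bG; rewrite big_ord0 addr0.
pose sig u b := nrm b + \sum_(i < n) normc (dot u (e (widen_ord (leqnSn n) i))).
have sig_ge0 u b : 0 <= sig u b.
  by rewrite addr_ge0 ?nrm_ge0// sumr_ge0// => i _; exact: normc_ge0.
have [[C' C'P]|nC] := pselect (exists C' : R, forall u b, G (u, b) -> nrm u <= C' * sig u b).
  exact: IH C'P.
exfalso.
set last := e ord_max.
have bG' u b : G (u, b) -> nrm u <= `|C| * (sig u b + normc (dot u last)).
  move=> /bG; rewrite big_ord_recr/= => /le_trans; apply.
  by rewrite addrA ler_wpM2r ?ler_norm// addr_ge0 ?sig_ge0// normc_ge0.
have sigZ a u b : sig (a *: u) (a *: b) = normc a * sig u b.
  rewrite /sig nrmZ// mulrDr mulr_sumr; congr +%R; apply: eq_bigr => i _.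
  by rewrite dotZl// normcM.
have sigB u b u' b' : sig (u - u') (b - b') <= sig u b + sig u' b'.
  rewrite /sig addrACA lerD ?nrmB// -big_split/=; apply: ler_sum => i _.
  by rewrite dotBl// -[in leRHS](normcN (dot u' _)) le_normcD.
have /choice[ub ubP] : forall k : nat, exists ub : E * E,
    [/\ G ub, dot ub.1 last = 1 & sig ub.1 ub.2 <= `|C| * k.+1%:R^-1].
  move=> k; apply: contrapT => /forallNP nk; apply: nC.
  (* If [u] violates the bound with this constant, [bG'] leaves
     [(k + 1) * sig u b < |C| |<u, last>|]; dividing by [<u, last>] gives the required pair. *)
  exists (k.+1%:R + `|C|) => u b Gub; rewrite leNgt; apply/negP => lt1.
  have := bG' _ _ Gub; have [t0|t0] := eqVneq (dot u last) 0.
    rewrite t0 normc0 addr0 => le1; have : 0 <= k.+1%:R * sig u b by rewrite mulr_ge0.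
    by move: lt1 le1; rewrite mulrDl; lra.
  move=> le1; apply: (nk ((dot u last)^-1 *: u, (dot u last)^-1 *: b)); split => /=.
  - exact: linear_relZ.
  - by rewrite dotZl// mulVf.
  - have nt : 0 < normc (dot u last).
      by rewrite lt_def normc_ge0 andbT; apply: contraNneq t0 => /eq0_normc ->.
    rewrite sigZ normcV mulrC ler_pdivrMr// mulrAC ler_pdivlMr// [sig u b * _]mulrC.
    by move: lt1 le1; rewrite mulrDl mulrDr; lra.
pose u k := (ub k).1; pose b k := (ub k).2.
have Gu k : G (u k, b k) by have [] := ubP k; rewrite /u /b; case: (ub k).
have u1 k : dot (u k) last = 1 by have [] := ubP k.
have usig k : sig (u k) (b k) <= `|C| * k.+1%:R^-1 by have [] := ubP k.
have C1 : 0 < `|C| + 1 by rewrite ltr_wpDl.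
have sig0 (eps : R) : 0 < eps -> exists N, forall k, (N <= k)%N -> sig (u k) (b k) <= eps.
  move=> e0; have [N PN] := invSn_le (divr_gt0 e0 C1).
  exists N => k /PN; rewrite ler_pdivlMr// => le1; apply: le_trans (usig k) _.
  apply: le_trans le1; rewrite mulrC ler_wpM2l ?invr_ge0//.
  by rewrite lerDl.
have b0 : nrm_cvg dot b 0.
  move=> eps /sig0[N PN]; exists N => k /PN; apply: le_trans.
  by rewrite subr0 lerDl sumr_ge0// => i _; exact: normc_ge0.
have [l ul] : exists l, nrm_cvg dot u l.
  apply: complete => eps e0; have [N PN] := sig0 _ (divr_gt0 (divr_gt0 e0 C1) (ltr0Sn _ 1)).
  exists N => m k Nm Nk; apply: le_trans (bG' _ _ (linear_relB lG (Gu m) (Gu k))) _.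
  rewrite dotBl// !u1 subrr normc0 addr0.
  rewrite -[leRHS](divfK (lt0r_neq0 C1)) mulrC ler_pM//.
    apply: le_trans (sigB _ _ _ _) _; rewrite [leRHS]splitr.
    by rewrite lerD// PN.
  by rewrite lerDl.
have l0 : l = 0 by apply: iG; exact: cG Gu ul b0.
have K0 : 0 < nrm last + 1 by rewrite ltr_wpDl ?nrm_ge0.
have half0 : 0 < (2 * (nrm last + 1))^-1 by rewrite invr_gt0 mulr_gt0.
have [N PN] := ul _ half0.
have := PN N (leqnn N); rewrite l0 subr0 => le1.
have := CauchySchwarz ip (u N) last; rewrite u1 normc1.
apply/negP; rewrite -ltNge.
apply: (@le_lt_trans _ _ ((2 * (nrm last + 1))^-1 * (nrm last + 1))).
  by rewrite ler_pM ?nrm_ge0// lerDl.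
by rewrite invfM -mulrA mulVf ?gt_eqF// mulr1; lra.
Qed.

Definition eigen (A : set (E * E)) (lam : R) : set E := [set u | A (u, lam%:C *: u)].

(* For a self-adjoint [A] and a real [lam] this says that [lam] is not in the
   essential spectrum: [A - lam] is bounded below up to finitely many functionals. *)
Definition semifredholm (A : set (E * E)) (lam : R) :=
  exists (C : R) n (e : 'I_n -> E), forall u v, A (u, v) ->
    nrm u <= C * (nrm (v - lam%:C *: u) + \sum_i normc (dot u (e i))).

Section selfadjoint.
Variable A : set (E * E).
Hypothesis sA : selfadjoint_rel dot A.
Let lA := selfadjoint_linear sA.

Lemma eigen_comb lam n (e : 'I_n -> E) (c : 'I_n -> R[i]) :
  (forall i, eigen A lam (e i)) -> eigen A lam (\sum_i c i *: e i).
Proof.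
move=> eA; rewrite /eigen/= scaler_sumr; apply: linear_rel_sum => // i.
by rewrite scalerA mulrC -scalerA; exact: linear_relZ lA (eA i).
Qed.

Lemma eigen_proj lam n (e : 'I_n -> E) u :
  (forall i, eigen A lam (e i)) -> eigen A lam (proj dot e u).
Proof. exact: eigen_comb. Qed.

(** A maximal orthonormal family spans: the normalized remainder [u - proj dot e u] would be a
    further eigenvector orthogonal to it. *)
Lemma eigen_basis lam N :
  (forall n (e : 'I_n -> E), orthonormal dot e -> (forall i, eigen A lam (e i)) -> (n <= N)%N) ->
  exists n (e : 'I_n -> E), [/\ orthonormal dot e, forall i, eigen A lam (e i) &
    forall u, eigen A lam u -> u = proj dot e u].
Proof.
move=> /(orthonormal_maximal ip)[n [e [oe eA emax]]]; exists n, e; split => // u Au.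
apply/eqP; rewrite -subr_eq0; apply: contrapT => /negP w0.
have nw := nrm_gt0 ip w0; apply: (emax ((nrm (u - proj dot e u))^-1%:C *: (u - proj dot e u))).
- by rewrite nrmZR// ger0_norm ?invr_ge0 ?nrm_ge0// mulVf// gt_eqF.
- by move=> i; rewrite dotZl// dot_sub_proj// mulr0.
- rewrite /eigen/= scalerA mulrC -scalerA; apply: linear_relZ => //.
  by rewrite scalerBr; apply: linear_relB => //; exact: eigen_proj.
Qed.

(** On eigenvectors the estimate retains only its finitely many functionals, which bounds the
    dimension of the eigenspace. On the orthogonal complement of the eigenspace [A - lam] is closed
    and injective, so [injective_remove_functionals] applies. *)
Lemma semifredholm_gap lam : semifredholm A lam ->
  exists n (e : 'I_n -> E), [/\ orthonormal dot e, forall i, eigen A lam (e i),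
    forall u, eigen A lam u -> u = proj dot e u &
    exists2 del : R, 0 < del & forall u v, A (u, v) -> (forall i, dot u (e i) = 0) ->
      del * nrm u <= nrm (v - lam%:C *: u)].
Proof.
move=> [C [m [g gP]]].
have [|n [e [oe eA eb]]] := @eigen_basis lam m.
  move=> n e oe eA; apply: (orthonormal_size_functionals (e := g) oe) => c c0.
  apply: (nrm_eq0 ip); apply/eqP; rewrite eq_le nrm_ge0 andbT.
  apply: le_trans (gP _ _ (eigen_comb c eA)) _.
  by rewrite subrr nrm0// add0r big1 ?mulr0// => i _; rewrite c0 normc0.
exists n, e; split => //.
pose G := [set ub | shift_rel A lam%:C ub /\ forall i, dot ub.1 (e i) = 0] : set (E * E).
have [||||C' C'P] := @injective_remove_functionals G m g C.
- split; first by split; [exact: (shift_rel_linear _ lA).1|move=> i /=; rewrite dot0l].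
  move=> a u v u' v' [Au /= ue] [Au' /= u'e]; split; first exact: (shift_rel_linear _ lA).2.
  by move=> i /=; rewrite dotDl// dotZl// ue u'e mulr0 addr0.
- move=> u v l k Guv ul vk; split.
    apply: (shift_rel_closed ip (selfadjoint_closed ip sA)) ul vk => j.
    by have [] := Guv j.
  by move=> i /=; apply: (dot_cvg_eq0 ip ul) => j; have [_ ->] := Guv j.
- move=> u [[v /= Auv /esym/eqP]]; rewrite subr_eq0 => /eqP vE ue.
  have Au : eigen A lam u by rewrite /eigen/= -vE.
  by rewrite (eb _ Au) /proj big1// => i _; rewrite ue scale0r.
- by move=> u b [[v /= Auv ->] _]; exact: gP.
exists (`|C'| + 1)^-1; first by rewrite invr_gt0 ltr_wpDl.
move=> u v Auv ue; rewrite mulrC ler_pdivrMr ?ltr_wpDl// mulrC.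
apply: le_trans (C'P u (v - lam%:C *: u) _) _; first by split => //; exists v.
rewrite ler_wpM2r ?nrm_ge0//; apply: le_trans (ler_norm _) _; by rewrite lerDl.
Qed.

(** The eigenspace and its complement reduce [A]. On the first, [A - z] is the scalar [lam - z]; on
    the second it is bounded below by [del - |z - lam|]. Orthogonality adds the squares, whence the
    minimum [kap]. *)
Lemma semifredholm_isolated lam : semifredholm A lam ->
  exists2 del : R, 0 < del & forall z : R[i],
    z != lam%:C -> normc (z - lam%:C) < del -> resolvent_set dot A z.
Proof.
move=> /semifredholm_gap[n [e [oe eA eb [del del0 delP]]]]; exists del => // z zl zd.
set d := normc (z - lam%:C) in zd.
have d0 : 0 < d.
  rewrite lt_def normc_ge0 andbT; apply: contraNneq zl => /eq0_normc/eqP.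
  by rewrite subr_eq0.
pose kap := Num.min d (del - d).
have k0 : 0 < kap by rewrite lt_min d0 subr_gt0.
apply: selfadjoint_resolvent => //; exists kap^-1 => u v Auv.
rewrite mulrC ler_pdivlMr// mulrC -(ler_pXn2r (ltn0Sn 1)) ?nnegrE ?nrm_ge0//; last first.
  by rewrite mulr_ge0 ?nrm_ge0// ltW.
pose p := proj dot e u; have Ap : eigen A lam p by exact: eigen_proj.
have Am : A (u - p, v - lam%:C *: p) by exact: linear_relB.
set m := u - p in Am; set w := v - lam%:C *: p in Am.
have mp0 : dot m p = 0 by exact: dot_sub_proj_proj.
have pw0 : dot p (w - z *: m) = 0.
  rewrite dotBr// -(selfadjoint_symmetric sA Ap Am) dotZl// dotZr//.
  by rewrite -(dotJ ip p m) mp0 conjc0 !mulr0 subrr.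
have -> : v - z *: u = (lam%:C - z) *: p + (w - z *: m).
  rewrite /w /m scalerBl scalerBr opprB [RHS]addrA [X in _ = X + _]addrC.
  by rewrite subrKA subrKA.
have -> : nrm ((lam%:C - z) *: p + (w - z *: m)) ^+ 2
    = d ^+ 2 * nrm p ^+ 2 + nrm (w - z *: m) ^+ 2.
  rewrite (nrm_sqrD ip (_ *: p)) dotZl// pw0 mulr0 mulr0 addr0 nrmZ// exprMn.
  by rewrite /d -normcN opprB.
have uE : nrm u ^+ 2 = nrm p ^+ 2 + nrm m ^+ 2.
  have := nrm_sqrD ip m p; rewrite mp0 mulr0 addr0 subrK => ->; exact: addrC.
have le_m : (del - d) * nrm m <= nrm (w - z *: m).
  have := delP _ _ Am (fun i => dot_sub_proj ip u i oe).
  have -> : w - lam%:C *: m = (w - z *: m) + (z - lam%:C) *: m.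
    by rewrite scalerBl addrA subrK.
  by have := nrmD ip (w - z *: m) ((z - lam%:C) *: m); rewrite nrmZ// -/d mulrBl; lra.
rewrite exprMn uE mulrDr lerD//.
  by rewrite ler_wpM2r ?sqr_ge0// ler_pXn2r ?nnegrE ?(ltW k0) ?(ltW d0)// ge_min lexx.
rewrite -exprMn ler_pXn2r ?nnegrE ?nrm_ge0//; last by rewrite mulr_ge0 ?nrm_ge0// ltW.
apply: le_trans le_m; rewrite ler_wpM2r ?nrm_ge0//.
by rewrite ge_min lexx orbT.
Qed.

Lemma semifredholm_resolvent lam : semifredholm A lam ->
  (forall u, eigen A lam u -> u = 0) -> resolvent_set dot A lam%:C.
Proof.
move=> /semifredholm_gap[n [e [oe eA eb [del del0 delP]]]] inj.
apply: selfadjoint_resolvent => //; exists del^-1 => u v Auv.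
rewrite mulrC ler_pdivlMr// mulrC; apply: delP => // i.
by rewrite (inj _ (eA i)) dot0r.
Qed.

Lemma semifredholm_finite_eigen lam : semifredholm A lam ->
  exists n (e : 'I_n -> E), forall u, eigen A lam u -> exists c : 'I_n -> R[i], u = \sum_i c i *: e i.
Proof.
move=> /semifredholm_gap[n [e [oe eA eb _]]]; exists n, e => u /eb ->.
by exists (fun i => dot u (e i)).
Qed.

Lemma resolvent_semifredholm lam : resolvent_set dot A lam%:C -> semifredholm A lam.
Proof.
move=> [[C CP] _]; exists C, 0%N, (fun=> 0) => u v /CP.
by rewrite big_ord0 addr0.
Qed.

(** An orthonormal basis of the eigenspace supplies the functionals, which control the projection of
    [u]; the rest of [u] is controlled by [isolated_bounded_below]. *)
Lemma isolated_semifredholm lam (eps : R) n (g : 'I_n -> E) : 0 < eps ->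
  (forall c, 0 < `|c - lam| < eps -> resolvent_set dot A c%:C) ->
  (forall u, eigen A lam u -> exists c : 'I_n -> R[i], u = \sum_i c i *: g i) ->
  semifredholm A lam.
Proof.
move=> e0 res fin.
have [|m [f [of_ fA fb]]] := @eigen_basis lam n.
  move=> k f of_ fA; have /choice[C CP] := fun j => fin _ (fA j).
  exact: (orthonormal_size_span of_ CP).
exists (eps^-1 + 1), m, f => u v Auv.
pose p := proj dot f u; have Ap : eigen A lam p by exact: eigen_proj.
have Am : A (u - p, v - lam%:C *: p) by exact: linear_relB.
have orth h : A (h, lam%:C *: h) -> dot (u - p) h = 0.
  move=> Ah; rewrite [h]fb// /proj dot_sumr// big1// => i _.
  by rewrite dotZr// dot_sub_proj// mulr0.
have := isolated_bounded_below ip complete sA e0 res Am orth.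
have -> : v - lam%:C *: p - lam%:C *: (u - p) = v - lam%:C *: u.
  by rewrite scalerBr opprB addrA subrK.
move=> le1; apply: le_trans (nrm_le_subD ip u p) _.
have le2 : nrm p <= \sum_i normc (dot u (f i)).
  apply: le_trans (nrm_sum ip _ _ _) _; apply: ler_sum => i _.
  by rewrite nrmZ// orthonormal_nrm// mulr1.
have le3 : nrm (u - p) <= eps^-1 * nrm (v - lam%:C *: u).
  by rewrite mulrC ler_pdivlMr// mulrC.
have S0 : 0 <= \sum_i normc (dot u (f i)) by rewrite sumr_ge0// => i _; exact: normc_ge0.
have : 0 <= eps^-1 * \sum_i normc (dot u (f i)) by rewrite mulr_ge0// invr_ge0 ltW.
have := nrm_ge0 dot (v - lam%:C *: u).
by rewrite mulrDl !mulrDr; move: le2 le3; lra.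
Qed.

End selfadjoint.
End fredholm.

(** * Relatively compact perturbations *)

Section relative_compactness.
Context (R : realType) (E : lmodType R[i]) (dot : E -> E -> R[i]).
Hypothesis ip : inner_product dot.
Hypothesis complete : ip_complete dot.
Local Notation nrm := (ip_norm dot).
Implicit Types (A V : set (E * E)).

Definition rel_sum A V : set (E * E) :=
  [set uw | exists v x, [/\ A (uw.1, v), V (uw.1, x) & uw.2 = v + x]].

Definition rel_opp V : set (E * E) := [set ux | V (ux.1, - ux.2)].

(* [V] is compact relatively to [A]: as an operator on the domain of [A] with
   the graph norm it is a norm limit of finite rank operators. *)
Definition rel_compact A V := forall eps : R, 0 < eps ->
  exists n (e g : 'I_n -> E), forall u v x, A (u, v) -> V (u, x) ->
    nrm (x - \sum_i dot u (e i) *: g i) <= eps * (nrm u + nrm v).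

(** The finite rank part sees [u] only through inner products and is bounded by [|u|] alone; [|v|]
    enters only with the factor [eps]. *)
Lemma rel_compact_bound A V (eps : R) : rel_compact A V -> 0 < eps ->
  exists2 C : R, 0 <= C & forall u v x, A (u, v) -> V (u, x) -> nrm x <= eps * nrm v + C * nrm u.
Proof.
move=> cV e0; have [n [e [g P]]] := cV _ e0.
exists (eps + \sum_i nrm (e i) * nrm (g i)).
  by rewrite addr_ge0 ?(ltW e0)// sumr_ge0// => i _; rewrite mulr_ge0 ?nrm_ge0.
move=> u v x Au Vu; apply: le_trans (nrm_le_subD ip x (\sum_i dot u (e i) *: g i)) _.
have le1 := P _ _ _ Au Vu.
have : nrm (\sum_i dot u (e i) *: g i) <= (\sum_i nrm (e i) * nrm (g i)) * nrm u.
  apply: le_trans (nrm_sum ip _ _ _) _; rewrite mulr_suml; apply: ler_sum => i _.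
  rewrite nrmZ// mulrAC ler_wpM2r ?nrm_ge0// mulrC; exact: CauchySchwarz.
by move: le1; rewrite mulrDr mulrDl; lra.
Qed.

(** The functionals approximating [V] join those of [A]. Relative bound 1/2 allows [|v|] to be
    estimated by [|b|] and [|u|], and the error of the approximation is then absorbed in [|u|]. *)
Lemma semifredholm_sum A V lam : rel_compact A V ->
  semifredholm dot A lam -> semifredholm dot (rel_sum A V) lam.
Proof.
move=> cV [C [n [e P]]].
have [C1 C10 C1P] := rel_compact_bound cV (divr_gt0 ltr01 (ltr0Sn R 1)).
pose C2 : R := 2 * (C1 + `|lam|).
pose K : R := `|C| + 1.
have K0 : 0 < K by rewrite ltr_wpDl.
have C20 : 0 <= C2 by rewrite mulr_ge0// addr_ge0.
(* Chosen so that the term [K eps (1 + C2) |u|] equals half of [|u|]. *)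
pose eps : R := (2 * K * (1 + C2))^-1.
have KC : 0 < 2 * K * (1 + C2) by rewrite !mulr_gt0// ltr_wpDr.
have e0 : 0 < eps by rewrite invr_gt0.
have [m [e' [g gP]]] := cV _ e0.
pose G : R := \sum_i nrm (g i).
have G0 : 0 <= G by rewrite sumr_ge0// => i _; exact: nrm_ge0.
pose D : R := 2 * K * (1 + 2 * eps + G).
exists D, (n + m)%N, (fun i : 'I_(n + m) => match fintype.split i with inl j => e j | inr j => e' j end).
move=> u w [v [x [/= Au Vu ->]]].
rewrite big_split_ord/=.
under eq_bigr do rewrite (unsplitK (inl _)).
under [X in _ + (_ + X)]eq_bigr do rewrite (unsplitK (inr _)).
set S := \sum_i normc (dot u (e i)); set S' := \sum_i normc (dot u (e' i)).
have S0 : 0 <= S by rewrite sumr_ge0// => i _; exact: normc_ge0.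
have S'0 : 0 <= S' by rewrite sumr_ge0// => i _; exact: normc_ge0.
set b := v + x - lam%:C *: u.
have le_v : nrm v <= 2 * nrm b + C2 * nrm u.
  have := nrmB ip (b + lam%:C *: u) x; have := nrmD ip b (lam%:C *: u).
  rewrite nrmZR// => h1 h2; have h3 := C1P _ _ _ Au Vu; rewrite /C2.
  have h4 : nrm v <= nrm b + `|lam| * nrm u + nrm x.
    have -> : v = (b + lam%:C *: u) - x by rewrite subrK addrK.
    by apply: le_trans h2 _; rewrite lerD2r.
  by move: h1 h3 h4; clear; lra.
have le_x : nrm x <= eps * (nrm u + nrm v) + G * S'.
  apply: le_trans (nrm_le_subD ip x (\sum_i dot u (e' i) *: g i)) _.
  apply: lerD; first exact: gP.
  apply: le_trans (nrm_sum ip _ _ _) _; rewrite /G /S' mulr_sumr; apply: ler_sum => i _.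
  rewrite nrmZ// mulrC ler_wpM2r ?normc_ge0//.
  by rewrite (bigD1 i)//= lerDl sumr_ge0// => j _; exact: nrm_ge0.
have le_u : nrm u <= K * (nrm b + nrm x + S).
  have h0 : nrm (v - lam%:C *: u) <= nrm b + nrm x.
    by have := nrmB ip b x; rewrite /b addrAC addrK.
  have CK : C <= K by rewrite /K; have := ler_norm C; lra.
  apply: le_trans (P _ _ Au) _.
  apply: le_trans (ler_wpM2r (addr_ge0 (nrm_ge0 _ _) S0) CK) _.
  by apply: ler_wpM2l; [exact: ltW|rewrite lerD2r].
have epsK : K * (eps * ((1 + C2) * nrm u)) = nrm u / 2.
  by rewrite /eps; field; rewrite !gt_eqF// ltr_wpDr.
have le_w : K * nrm x <= nrm u / 2 + K * (2 * eps * nrm b + G * S').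
  rewrite -epsK -mulrDr; apply: ler_wpM2l; first exact: ltW.
  apply: le_trans le_x _.
  have : eps * (nrm u + nrm v) <= eps * (nrm u + (2 * nrm b + C2 * nrm u)).
    by rewrite ler_pM2l// lerD2l.
  by rewrite !mulrDl !mulrDr mulrA; move: (eps * (2 * nrm b)) => *; lra.
have : 0 <= K * G * S by rewrite !mulr_ge0// ltW.
have : 0 <= K * G * nrm b by rewrite !mulr_ge0 ?nrm_ge0// ltW.
have : 0 <= K * eps * S by rewrite !mulr_ge0// ltW.
have : 0 <= K * eps * S' by rewrite !mulr_ge0// ltW.
have : 0 <= K * S' by rewrite !mulr_ge0// ltW.
move: le_u le_w; rewrite /D; move: (nrm x) (nrm u) (nrm b) => x' u' b'; clear; lra.
Qed.

(** By relative bound 1/2 the graph norm of [A] is at most [K] times that of [A + V], so compactness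
    relative to one is compactness relative to the other. *)
Lemma rel_compact_opp A V : rel_compact A V -> rel_compact (rel_sum A V) (rel_opp V).
Proof.
move=> cV eps e0; have [C C0 CP] := rel_compact_bound cV (divr_gt0 ltr01 (ltr0Sn R 1)).
pose K : R := 2 + 2 * C + 1.
have K0 : 0 < K by rewrite /K; lra.
have [n [e [g P]]] := cV _ (divr_gt0 e0 K0).
exists n, e, (fun i => - g i) => u w y [v [x [/= Au Vu ->]]] Vy.
have le1 := P _ _ _ Au Vy; have le2 := CP _ _ _ Au Vu.
have -> : y - \sum_i dot u (e i) *: - g i = - (- y - \sum_i dot u (e i) *: g i).
  rewrite opprB opprK addrC; congr (_ + _).
  by rewrite -sumrN; apply: eq_bigr => i _; rewrite scalerN opprK.
rewrite nrmN//; apply: le_trans le1 _; rewrite -mulrA ler_pM2l// mulrC ler_pdivrMr//.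
have : nrm v <= nrm (v + x) + nrm x by rewrite -[X in nrm X <= _](addrK x) nrmB.
have := nrm_ge0 dot (v + x); have := nrm_ge0 dot u.
have : 0 <= C * nrm (v + x) by rewrite mulr_ge0 ?nrm_ge0.
by rewrite /K; move: le2; clear; lra.
Qed.

Lemma rel_sum_opp A V : (forall u x x', V (u, x) -> V (u, x') -> x = x') ->
  (forall u v, A (u, v) -> exists x, V (u, x)) ->
  rel_sum (rel_sum A V) (rel_opp V) = A.
Proof.
move=> fV dV; apply/seteqP; split => [[u w] [_ [y [/= [v [x [/= Au Vu ->]]] Vy ->]]]|[u v] Au].
  by rewrite /rel_opp/= in Vy; rewrite (fV _ _ _ Vu Vy) subrK.
have [x Vu] := dV _ _ Au; exists (v + x), (- x); split => /=.
- by exists v, x.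
- by rewrite /rel_opp/= opprK.
- by rewrite addrK.
Qed.

Section kato_rellich.
Variables A V : set (E * E).
Hypothesis sA : selfadjoint_rel dot A.
Hypothesis A_ge0 : forall u v, A (u, v) -> 0 <= Re (dot v u).
Hypothesis lV : linear_rel V.
Hypothesis fV : forall u x x', V (u, x) -> V (u, x') -> x = x'.
Hypothesis symV : symmetric_rel dot V.
Hypothesis domV : forall u v, A (u, v) -> exists x, V (u, x).
Hypothesis cV : rel_compact A V.
Let B := rel_sum A V.

Lemma rel_sum_linear : linear_rel B.
Proof.
have lA := selfadjoint_linear sA; split.
  by exists 0, 0; split; [exact: lA.1|exact: lV.1|rewrite addr0].
move=> a u _ u' _ [v [x [/= Av Vx ->]]] [v' [x' [/= Av' Vx' ->]]].
exists (a *: v + v'), (a *: x + x'); split => /=; [exact: lA.2|exact: lV.2|].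
by rewrite scalerDr addrACA.
Qed.

Lemma rel_sum_symmetric : symmetric_rel dot B.
Proof.
move=> u _ u' _ [v [x [/= Av Vx ->]]] [v' [x' [/= Av' Vx' ->]]].
by rewrite dotDl// dotDr// (selfadjoint_symmetric sA Av Av') (symV Vx Vx').
Qed.

Lemma nonneg_shift_le (t : R) u v : 0 <= t -> A (u, v) ->
  nrm v <= nrm (v + t%:C *: u) /\ t * nrm u <= nrm (v + t%:C *: u).
Proof.
move=> t0 Au; have := A_ge0 Au => vu0.
have eq1 : nrm (v + t%:C *: u) ^+ 2 = nrm v ^+ 2 + (t * nrm u) ^+ 2 + 2 * (t * Re (dot v u)).
  by rewrite nrm_sqrD// nrmZR// (ger0_norm t0) dotZr// conj_RtoC ReZ.
have p0 : 0 <= 2 * (t * Re (dot v u)) by rewrite mulr_ge0// mulr_ge0.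
split; rewrite -(ler_pXn2r (ltn0Sn 1)) ?nnegrE ?nrm_ge0 ?mulr_ge0 ?nrm_ge0// eq1.
  by have := sqr_ge0 (t * nrm u); lra.
by have := sqr_ge0 (nrm v); lra.
Qed.

Lemma rel_sum_shift_bound : exists2 a0 : R, 0 < a0 & forall t : R, a0 <= t ->
  forall u v x, A (u, v) -> V (u, x) -> nrm x <= 2^-1 * nrm (v + t%:C *: u).
Proof.
have q0 : 0 < 4^-1 :> R by rewrite invr_gt0.
have [C C0 CP] := rel_compact_bound cV q0.
(* With [4 C <= t], each of [|v| / 4] and [C |u|] is at most a quarter of [|(A + t) u|]. *)
exists (4 * C + 1); first by lra.
move=> t tC u v x Au Vu; have t0 : 0 < t by lra.
have [h1 h2] := nonneg_shift_le (ltW t0) Au; have h3 := CP _ _ _ Au Vu.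
have h4 : (4 * C) * nrm u <= t * nrm u by rewrite ler_wpM2r ?nrm_ge0//; lra.
by move: h1 h2 h3 h4; move: (nrm v) (nrm u) (nrm (v + _)) (nrm x); move=> *; lra.
Qed.

(** By [rel_sum_shift_bound], [V (A + t)^-1] has norm at most 1/2. In place of a Neumann series, a
    vector [y] orthogonal to the range of [B + t] is tested against [u = (A + t)^-1 y]: this gives
    [|y|^2 = - Re <V u, y> <= |y|^2 / 2]. *)
Lemma rel_sum_resolvent_bound : exists2 a0 : R, 0 < a0 &
  forall t : R, a0 <= t -> resolvent_set dot B (- t%:C).
Proof.
have [a0 a00 aP] := rel_sum_shift_bound; exists a0 => // t at_.
have t0 : 0 < t by exact: lt_le_trans at_.
have lA := selfadjoint_linear sA.
have low u v x : A (u, v) -> V (u, x) -> 2^-1 * nrm (v + t%:C *: u) <= nrm (v + x + t%:C *: u).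
  move=> Au Vu; have := aP _ at_ _ _ _ Au Vu.
  have := nrmB ip (v + x + t%:C *: u) x; rewrite addrAC addrK; lra.
have bd u w : B (u, w) -> nrm u <= 2 / t * nrm (w + t%:C *: u).
  move=> [v [x [/= Au Vu ->]]]; have [_ h] := nonneg_shift_le (ltW t0) Au.
  have := low _ _ _ Au Vu; rewrite mulrAC ler_pdivlMr// [nrm u * t]mulrC; move: h; lra.
split; first by exists (2 / t) => u w /bd; rewrite scaleNr opprK.
have shE (u w : E) : w - (- t%:C) *: u = w + t%:C *: u by rewrite scaleNr opprK.
have lS : linear_rel (shift_rel B (- t%:C)) by exact/shift_rel_linear/rel_sum_linear.
suff surj y : exists u, shift_rel B (- t%:C) (u, y).
  by move=> y; have [u [w /= Bw ->]] := surj y; exists u, w.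
apply: (bounded_below_surjective ip complete (C := 2 / t)) => //.
- move=> u v l m Sn ul vm.
  have /choice[vx vxP] : forall n, exists vx : E * E,
      [/\ A (u n, vx.1), V (u n, vx.2) & v n = vx.1 + vx.2 + t%:C *: u n].
    move=> n; have [w /= [v' [x' /= [Au Vu ->]]] ->] := Sn n.
    by exists (v', x'); split => //=; rewrite shE.
  (* By [low], convergence of [(B + t) u_n] makes [(A + t) u_n] Cauchy; closedness of [B] is thus
     inherited from [A]. *)
  have [k vk] : exists k, nrm_cvg dot (fun n => (vx n).1 + t%:C *: u n) k.
    apply: complete => e e0; have [N vN] := nrm_cvg_cauchy ip vm (divr_gt0 e0 (ltr0Sn _ 1)).
    exists N => i j Ni Nj; have [Ai Vi vi] := vxP i; have [Aj Vj vj] := vxP j.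
    have := low _ _ _ (linear_relB lA Ai Aj) (linear_relB lV Vi Vj).
    have -> : (vx i).1 - (vx j).1 + ((vx i).2 - (vx j).2) + t%:C *: (u i - u j) = v i - v j.
      by rewrite vi vj addrACA -opprD scalerBr addrACA -opprD.
    have := vN _ _ Ni Nj.
    have -> : (vx i).1 - (vx j).1 + t%:C *: (u i - u j)
        = (vx i).1 + t%:C *: u i - ((vx j).1 + t%:C *: u j).
      by rewrite scalerBr addrACA -opprD.
    by rewrite ler_pdivlMr//; lra.
  have vk' : nrm_cvg dot (fun n => (vx n).1) (k - t%:C *: l).
    rewrite (_ : (fun _ => _) = fun n => ((vx n).1 + t%:C *: u n) - t%:C *: u n).
      by apply: nrm_cvgB => //; exact: nrm_cvgZ.
    by apply/funext => n; rewrite addrK.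
  have Al : A (l, k - t%:C *: l).
    apply: (selfadjoint_closed ip sA) ul vk' => n; by have [] := vxP n.
  have [x Vl] := domV Al.
  have xk : nrm_cvg dot (fun n => (vx n).2) x.
    move=> e e0; have [N vN] := vk _ e0; exists N => n Nn; have [An Vn vn] := vxP n.
    have := aP _ at_ _ _ _ (linear_relB lA An Al) (linear_relB lV Vn Vl).
    have -> : (vx n).1 - (k - t%:C *: l) + t%:C *: (u n - l) = (vx n).1 + t%:C *: u n - k.
      by rewrite opprB scalerBr addrACA [X in _ + X = _]addrAC subrr add0r.
    by have := vN _ Nn; have := nrm_ge0 dot ((vx n).1 + t%:C *: u n - k); lra.
  have mE : m = k + x.
    apply: (nrm_cvg_unique ip vm).
    rewrite (_ : v = fun n => ((vx n).1 + t%:C *: u n) + (vx n).2); first exact: nrm_cvgD.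
    by apply/funext => n; have [_ _ ->] := vxP n; rewrite addrAC.
  exists (k - t%:C *: l + x); first by exists (k - t%:C *: l), x.
  by rewrite /= shE mE addrAC subrK.
- by move=> u _ [w /= Bw ->]; rewrite shE; exact: bd.
- move=> {}y yP.
  have bA : exists C : R, forall u v, A (u, v) -> nrm u <= C * nrm (v - (- t%:C) *: u).
    exists t^-1 => u v Au; rewrite shE mulrC ler_pdivlMr// mulrC.
    by have [] := nonneg_shift_le (ltW t0) Au.
  have [_ /(_ y)[u [v [Au yE]]]] := selfadjoint_resolvent ip complete sA bA.
  have [x Vu] := domV Au; rewrite shE in yE.
  have := yP u (y + x); rewrite dotDl//.
  have Sux : shift_rel B (- t%:C) (u, y + x).
    exists (v + x); first by exists v, x.
    by rewrite /= shE -yE addrAC.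
  move=> /(_ Sux) /(congr1 (@Re R)); rewrite ReD -nrm_sqr//= => eq0.
  have h1 := aP _ at_ _ _ _ Au Vu; rewrite yE in h1.
  have h2 := Re_dot_le ip (- x) y; rewrite dotNl// ReN nrmN// in h2.
  have h3 : nrm x * nrm y <= 2^-1 * nrm y * nrm y by rewrite ler_wpM2r ?nrm_ge0.
  apply: (nrm_eq0 ip); apply/eqP; rewrite -sqrf_eq0 eq_le sqr_ge0 andbT.
  by move: eq0 h2 h3; lra.
Qed.

(** A symmetric relation with [B + t] onto for one real [t] is self-adjoint: if [(z, z')] is in the
    adjoint and [(B + t) u0 = z' + t z], then [z - u0] is orthogonal to the whole range of
    [B + t]. *)
Lemma rel_sum_selfadjoint : selfadjoint_rel dot B.
Proof.
split; first exact: rel_sum_linear.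
move=> z z'; split; first by move=> Bz u w Bw; exact: rel_sum_symmetric Bw Bz.
move=> zP; have [t t0 /(_ _ (lexx t))[_ surj]] := rel_sum_resolvent_bound.
have [u0 [w0 [B0 e0]]] := surj (z' + t%:C *: z).
rewrite scaleNr opprK in e0.
have [u [w [Bw e]]] := surj (z - u0); rewrite scaleNr opprK in e.
have zu : z = u0.
  apply/eqP; rewrite -subr_eq0; apply/eqP/(nrm_eq0 ip)/eqP; rewrite -sqrf_eq0 nrm_sqr//.
  rewrite -{1}e; have -> : dot (w + t%:C *: u) (z - u0) = dot u (z' - w0 + t%:C *: (z - u0)).
    rewrite dotDl// dotZl// (dotDr ip u (z' - w0)) dotZr// conj_RtoC (dotBr ip w) (dotBr ip u z').
    by rewrite (zP _ _ Bw) (rel_sum_symmetric Bw B0).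
  by rewrite scalerBr addrACA -opprD e0 subrr dot0r.
by move: B0; rewrite -zu; have := e0; rewrite zu => /addIr <-.
Qed.

Lemma rel_sum_semibounded : exists c : R, forall u w, B (u, w) ->
  - c * nrm u ^+ 2 <= Re (dot w u).
Proof.
have [a0 a00 aP] := rel_sum_resolvent_bound; exists a0.
have res (c : R) : c < - a0 -> resolvent_set dot B c%:C.
  by move=> ca; have := aP (- c); rewrite RtoCN opprK; apply; lra.
exact: (resolvent_halfline_semibounded ip rel_sum_selfadjoint res).
Qed.

(** The converse undoes the perturbation by adding [- V], which is compact relative to [B]. *)
Lemma semifredholm_rel_sumE lam : semifredholm dot B lam <-> semifredholm dot A lam.
Proof.
split=> [fB|]; last exact: semifredholm_sum.
by rewrite -(rel_sum_opp fV domV); apply: semifredholm_sum fB; exact: rel_compact_opp.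
Qed.

End kato_rellich.
End relative_compactness.

(** * The Hilbert space of square-integrable functions *)

Section cintegral.
Context d (T : measurableType d) (R : realType) (mu : {measure set T -> \bar R}).
Implicit Types f g : T -> R[i].

Lemma cmeasurableN f : cmeasurable f -> cmeasurable (fun x => - f x).
Proof.
move=> /(cmeasurableZ (-1)); rewrite (_ : (fun _ => _) = fun x => - f x)//.
by apply/funext => x; rewrite mulN1r.
Qed.

Lemma cmeasurableB f g : cmeasurable f -> cmeasurable g -> cmeasurable (fun x => f x - g x).
Proof. by move=> mf mg; apply: cmeasurableD => //; exact: cmeasurableN. Qed.

Lemma cmeasurableM f g : cmeasurable f -> cmeasurable g -> cmeasurable (fun x => f x * g x).
Proof.
move=> [f1 f2] [g1 g2]; split.
- rewrite (_ : _ \o _ = (fun x => Re (f x) * Re (g x)) \- (fun x => Im (f x) * Im (g x))).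
    by apply: measurable_funB; apply: measurable_funM.
  by apply/funext => x /=; case: (f x) => a b; case: (g x).
- rewrite (_ : _ \o _ = (fun x => Re (f x) * Im (g x)) \+ (fun x => Im (f x) * Re (g x))).
    by apply: measurable_funD; apply: measurable_funM.
  by apply/funext => x /=; case: (f x) => a b; case: (g x).
Qed.

Lemma cmeasurableC (h : T -> R) : measurable_fun [set: T] h -> cmeasurable (fun x => (h x)%:C).
Proof. by move=> mh; split => //; exact: measurable_cst. Qed.

Lemma cmeasurableJ f : cmeasurable f -> cmeasurable (fun x => conjc (f x)).
Proof.
move=> [f1 f2]; split.
- by rewrite (_ : _ \o _ = @Re R \o f)//; apply/funext => x /=; case: (f x).
- rewrite (_ : _ \o _ = (fun x => - Im (f x))); last by apply/funext => x /=; case: (f x).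
  exact: measurableT_comp.
Qed.

Definition cintegrable f := mu.-integrable [set: T] (EFin \o (@Re R \o f)) /\
  mu.-integrable [set: T] (EFin \o (@Im R \o f)).

Lemma cintegralD f g : cintegrable f -> cintegrable g ->
  cintegral mu (fun x => f x + g x) = cintegral mu f + cintegral mu g.
Proof.
move=> [f1 f2] [g1 g2]; rewrite /cintegral.
transitivity ((\int[mu]_x (Re (f x) + Re (g x))) +i* (\int[mu]_x (Im (f x) + Im (g x)))).
  by congr (_ +i* _); apply: eq_Rintegral => x _; rewrite ?ReD ?ImD.
by rewrite !RintegralD.
Qed.

Lemma cintegralZ (a : R[i]) f : cintegrable f ->
  cintegral mu (fun x => a * f x) = a * cintegral mu f.
Proof.
move=> [f1 f2]; rewrite /cintegral; case: a => a b.
transitivity ((\int[mu]_x (a * Re (f x) - b * Im (f x))) +i*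
    (\int[mu]_x (a * Im (f x) + b * Re (f x)))).
  by congr (_ +i* _); apply: eq_Rintegral => x _; case: (f x).
have i1 (c : R) : mu.-integrable [set: T] (EFin \o (fun x => c * Re (f x))).
  by apply: (integrableZl measurableT c f1).
have i2 (c : R) : mu.-integrable [set: T] (EFin \o (fun x => c * Im (f x))).
  by apply: (integrableZl measurableT c f2).
rewrite RintegralB// RintegralD// !RintegralZl//.
Qed.

Lemma cintegralJ f : cintegrable f -> cintegral mu (fun x => conjc (f x)) = conjc (cintegral mu f).
Proof.
move=> [f1 f2]; rewrite /cintegral /=; congr (_ +i* _).
  by apply: eq_Rintegral => x _; case: (f x).
rewrite -mulN1r -RintegralZl//; apply: eq_Rintegral => x _; rewrite mulN1r; by case: (f x).
Qed.

Lemma ae_eq_Rintegral (f g : T -> R) : measurable_fun [set: T] f -> measurable_fun [set: T] g ->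
  f = g %[ae mu] -> \int[mu]_x f x = \int[mu]_x g x.
Proof.
move=> mf mg fg; rewrite /Rintegral; congr fine; apply: ae_eq_integral => //.
- exact/measurable_EFinP.
- exact/measurable_EFinP.
- by apply: filterS fg => x fgx xT; rewrite /= fgx.
Qed.

Lemma ae_eq_cintegral f g : cmeasurable f -> cmeasurable g -> f = g %[ae mu] ->
  cintegral mu f = cintegral mu g.
Proof.
move=> [f1 f2] [g1 g2] fg; rewrite /cintegral; congr (_ +i* _);
  by apply: ae_eq_Rintegral => //; apply: filterS fg => x fgx xT /=; rewrite fgx.
Qed.

End cintegral.

Section L2_functions.
Context d (T : measurableType d) (R : realType) (mu : {measure set T -> \bar R}).
Implicit Types f g : T -> R[i].

(** The squared L^2 norm, free of the exponent 1/2, so that comparison of integrals applies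
    directly; it may be infinite. *)
Definition sqint f : \bar R := (\int[mu]_x ((normc (f x)) ^+ 2)%:E)%E.

Lemma measurable_normc2 f : cmeasurable f ->
  measurable_fun [set: T] (fun x => ((normc (f x)) ^+ 2)%:E).
Proof. by move=> mf; apply/measurable_EFinP/measurable_funX; exact: measurable_normc. Qed.

Lemma sqint_ge0 f : (0 <= sqint f)%E.
Proof. by apply: integral_ge0 => x _; rewrite lee_fin sqr_ge0. Qed.

Lemma sqintE f : sqint f = (L2_enorm mu f `^ 2)%E.
Proof.
rewrite /L2_enorm powR_Lnorm ?pnatr_eq0//; apply: eq_integral => x _.
by rewrite /= powR_mulrn// real_normK ?num_real.
Qed.

Lemma Lp2P f : Lp mu 2%:E f <-> cmeasurable f /\ (sqint f < +oo)%E.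
Proof.
have E : (finite_norm mu 2%:E (@normc R \o f)) <-> (sqint f < +oo)%E.
  have -> : finite_norm mu 2%:E (@normc R \o f) = (L2_enorm mu f < +oo)%E by [].
  rewrite sqintE; split; first exact: poweR_lty.
  by apply: lty_poweRy; rewrite pnatr_eq0.
by split=> -[mf /E].
Qed.

Lemma le_sqint f g : cmeasurable f -> cmeasurable g ->
  {ae mu, forall x, normc (f x) <= normc (g x)} -> (sqint f <= sqint g)%E.
Proof.
move=> mf mg fg; apply: ae_ge0_le_integral => //.
- by move=> x _; rewrite lee_fin sqr_ge0.
- exact: measurable_normc2.
- by move=> x _; rewrite lee_fin sqr_ge0.
- exact: measurable_normc2.
- by apply: filterS fg => x fgx _; rewrite lee_fin ler_pXn2r// nnegrE normc_ge0.
Qed.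

Lemma ae_eq_sqint f g : cmeasurable f -> cmeasurable g -> f = g %[ae mu] -> sqint f = sqint g.
Proof.
move=> mf mg fg; apply/eqP; rewrite eq_le !le_sqint//;
  by apply: filterS fg => x fgx; rewrite fgx.
Qed.

Lemma sqintZ (a : R[i]) f : cmeasurable f ->
  sqint (fun x => a * f x) = ((normc a ^+ 2)%:E * sqint f)%E.
Proof.
move=> mf; rewrite /sqint -ge0_integralZl//.
- by apply: eq_integral => x _; rewrite normcM exprMn EFinM.
- exact: measurable_normc2.
- by move=> x _; rewrite lee_fin sqr_ge0.
- by rewrite lee_fin sqr_ge0.
Qed.

Lemma L2_cintegrable f g : Lp mu 2%:E f -> Lp mu 2%:E g ->
  cintegrable mu (fun x => f x * conjc (g x)).
Proof.
move=> /Lp2P[mf f2] /Lp2P[mg g2]; have [m1 m2] := cmeasurableM mf (cmeasurableJ mg).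
have fg : mu.-integrable [set: T] (fun x => (normc (f x) ^+ 2 + normc (g x) ^+ 2)%:E).
  have i1 h : cmeasurable h -> (sqint h < +oo)%E ->
      mu.-integrable [set: T] (fun x => (normc (h x) ^+ 2)%:E).
    move=> mh h2; apply/integrableP; split; first exact: measurable_normc2.
    apply: le_lt_trans h2; rewrite le_eqVlt; apply/orP; left; apply/eqP/eq_integral => x _.
    by rewrite /= ger0_norm ?sqr_ge0.
  exact: (integrableD measurableT (i1 _ mf f2) (i1 _ mg g2)).
have le x : normc (f x * conjc (g x)) <= `|normc (f x) ^+ 2 + normc (g x) ^+ 2|.
  rewrite ger0_norm ?addr_ge0 ?sqr_ge0// normcM normc_conj.
  by have := sqr_ge0 (normc (f x) - normc (g x)); nra.
split; apply: le_integrable fg => //.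
- exact/measurable_EFinP.
- by move=> x _ /=; rewrite lee_fin (le_trans (ler_Re_normc _)).
- exact/measurable_EFinP.
- by move=> x _ /=; rewrite lee_fin (le_trans (ler_Im_normc _)).
Qed.

Lemma Lp2_dominated f g : cmeasurable f -> Lp mu 2%:E g ->
  {ae mu, forall x, normc (f x) <= normc (g x)} -> Lp mu 2%:E f.
Proof.
move=> mf /Lp2P[mg g2] fg; apply/Lp2P; split => //.
exact: le_lt_trans (le_sqint mf mg fg) g2.
Qed.

Lemma Lp2D f g : Lp mu 2%:E f -> Lp mu 2%:E g -> Lp mu 2%:E (fun x => f x + g x).
Proof. by move=> /L2_predP pf /L2_predP pg; apply/L2_predP; exact: rpredD. Qed.

Lemma Lp2Z (a : R[i]) f : Lp mu 2%:E f -> Lp mu 2%:E (fun x => a * f x).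
Proof. by move=> /L2_predP pf; apply/L2_predP; exact: rpredZ. Qed.

(* The class of [f], or the junk value 0 when [f] is not in [L^2]. *)
Definition L2_of f : L2 mu :=
  if pselect ((f : T -> R[i]^o) \in L2_pred mu) is left h
  then (\pi_(L2 mu) (exist _ (f : T -> R[i]^o) h : L2_fun mu))%qT else 0.

Lemma L2_ofE f : Lp mu 2%:E f -> L2_repr (L2_of f) = f %[ae mu].
Proof.
move=> fL; rewrite /L2_of; case: pselect => [h|nh].
  exact: (L2_reprP (exist _ (f : T -> R[i]^o) h : L2_fun mu)).
by exfalso; apply: nh; exact/L2_predP.
Qed.

Lemma L2_eq (u v : L2 mu) : L2_repr u = L2_repr v %[ae mu] -> u = v.
Proof. by move=> uv; rewrite -(reprK u) -(reprK v); apply/eqP/L2_eqP. Qed.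

Lemma L2_reprB (u v : L2 mu) :
  L2_repr (u - v) = (fun x => L2_repr u x - L2_repr v x) %[ae mu].
Proof.
rewrite -scaleN1r; apply: filterS2 (L2_reprD u (-1 *: v)) (L2_reprZ (-1) v) => x uv vx _.
by rewrite uv// vx// mulN1r.
Qed.

Lemma L2_repr0 : L2_repr (0 : L2 mu) = (fun=> 0) %[ae mu].
Proof.
rewrite -(scale0r 0); apply: filterS (L2_reprZ 0 0) => x xE _.
by rewrite xE// mul0r.
Qed.

Lemma L2_repr_meas (u : L2 mu) : cmeasurable (L2_repr u).
Proof. by have [] := L2_reprLp u. Qed.
Hint Resolve L2_repr_meas : core.

Lemma L2_dotE (u v : L2 mu) :
  L2_dot u v = cintegral mu (fun x => L2_repr u x * conjc (L2_repr v x)).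
Proof. by []. Qed.

Lemma L2_repr_cintegrable (u v : L2 mu) :
  cintegrable mu (fun x => L2_repr u x * conjc (L2_repr v x)).
Proof. by apply: L2_cintegrable; exact: L2_reprLp. Qed.

Lemma L2_repr_dot_meas (u v : L2 mu) : cmeasurable (fun x => L2_repr u x * conjc (L2_repr v x)).
Proof. by apply: cmeasurableM => //; exact: cmeasurableJ. Qed.
Hint Resolve L2_repr_dot_meas : core.

Lemma sqint_L2_fin (u : L2 mu) : sqint (L2_repr u) \is a fin_num.
Proof. by rewrite ge0_fin_numE ?sqint_ge0//; have /Lp2P[] := L2_reprLp u. Qed.

Lemma Re_L2_dot (u : L2 mu) : Re (L2_dot u u) = fine (sqint (L2_repr u)).
Proof.
rewrite L2_dotE /=; congr fine; apply: eq_integral => x _.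
rewrite normc_sqr; case: (L2_repr u x) => a b /=; congr (_%:E); ring.
Qed.

Lemma L2_inner_product : inner_product (@L2_dot d T R mu).
Proof.
split.
- move=> u v w; rewrite !L2_dotE -cintegralD; try exact: L2_repr_cintegrable.
  apply: ae_eq_cintegral => //; first exact: cmeasurableD.
  by apply: filterS (L2_reprD u v) => x xE _; rewrite xE// mulrDl.
- move=> a u v; rewrite !L2_dotE -cintegralZ; last exact: L2_repr_cintegrable.
  apply: ae_eq_cintegral => //; first exact: cmeasurableZ.
  by apply: filterS (L2_reprZ a u) => x xE _; rewrite xE// mulrA.
- move=> u v; rewrite !L2_dotE -cintegralJ; last exact: L2_repr_cintegrable.
  congr cintegral; apply/funext => x.
  by rewrite rmorphM/= conjcK mulrC.
- by move=> u; rewrite Re_L2_dot fine_ge0// sqint_ge0.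
- move=> u /eqP; rewrite Re_L2_dot fine_eq0 ?sqint_L2_fin// sqintE.
  move=> /eqP /(poweR_eq0_eq0 (L2_enorm_ge0 mu _)) u0.
  apply: L2_norm_eq0.
  by rewrite /L2_norm u0.
Qed.

Local Notation nrm := (ip_norm (@L2_dot d T R mu)).

Lemma sqint_nrm (u : L2 mu) : sqint (L2_repr u) = (nrm u ^+ 2)%:E.
Proof. by rewrite (nrm_sqr L2_inner_product) Re_L2_dot fineK// sqint_L2_fin. Qed.

Lemma sqint_L2_of f : Lp mu 2%:E f -> (nrm (L2_of f) ^+ 2)%:E = sqint f.
Proof.
move=> fL; rewrite -sqint_nrm; apply: ae_eq_sqint => //; last exact: L2_ofE.
by have [] := fL.
Qed.

Lemma L2_normE (u : L2 mu) : `|u| = (nrm u)%:C.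
Proof.
congr (_%:C); apply/eqP; rewrite -(eqrXn2 (ltn0Sn 1)) ?fine_ge0 ?L2_enorm_ge0 ?nrm_ge0//.
apply/eqP/EFin_inj; rewrite -sqint_nrm sqintE -[in RHS]L2_norm_fineK poweR_EFin.
by rewrite powR_mulrn// fine_ge0// L2_enorm_ge0.
Qed.

Lemma nrm_le_ae (u : L2 mu) f (M : R) : 0 <= M -> L2_repr u = f %[ae mu] ->
  (sqint f <= (M ^+ 2)%:E)%E -> cmeasurable f -> nrm u <= M.
Proof.
move=> M0 uf fM mf; rewrite -(ler_pXn2r (ltn0Sn 1)) ?nnegrE ?nrm_ge0// -lee_fin -sqint_nrm.
by rewrite (ae_eq_sqint _ mf uf).
Qed.

Lemma nrm_le_pointwise (u v : L2 mu) (c : R) : 0 <= c ->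
  {ae mu, forall x, normc (L2_repr u x) <= c * normc (L2_repr v x)} -> nrm u <= c * nrm v.
Proof.
move=> c0 uv; rewrite -(ler_pXn2r (ltn0Sn 1)) ?nnegrE ?mulr_ge0 ?nrm_ge0//.
rewrite -lee_fin -sqint_nrm exprMn [leRHS]EFinM -sqint_nrm.
have := @sqintZ c%:C _ (L2_repr_meas v).
rewrite normcR real_normK ?num_real// => <-.
apply: le_sqint => //; first exact: cmeasurableZ.
by apply: filterS uv => x; rewrite normcM normcR ger0_norm.
Qed.

Lemma L2_dot_ae (u v : L2 mu) f g : Lp mu 2%:E f -> Lp mu 2%:E g ->
  L2_repr u = f %[ae mu] -> L2_repr v = g %[ae mu] ->
  L2_dot u v = cintegral mu (fun x => f x * conjc (g x)).
Proof.
move=> [mf _] [mg _] uf vg; rewrite L2_dotE; apply: ae_eq_cintegral => //.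
  by apply: cmeasurableM => //; exact: cmeasurableJ.
by apply: filterS2 uf vg => x uE vE _; rewrite uE// vE.
Qed.

End L2_functions.
#[global] Hint Resolve L2_repr_meas : core.

(** * Completeness of L^2 (Riesz-Fischer) *)

Lemma geometric_half_le2 (R : realType) n : \sum_(0 <= k < n) (2 ^- k : R) <= 2.
Proof.
suff -> : \sum_(0 <= k < n) (2 ^- k : R) = 2 - 2 * 2 ^- n.
  by rewrite gerBl mulr_ge0// invr_ge0 exprn_ge0.
elim: n => [|n IH]; first by rewrite big_nil expr0 invr1; ring.
by rewrite big_nat_recr//= IH exprS; field; rewrite expf_neq0.
Qed.

Lemma half_pow_le (R : realType) (eps : R) : 0 < eps -> exists k : nat, 2 ^- k <= eps.
Proof.
move=> e0; have [N PN] := invSn_le e0; exists N.+1; apply: le_trans (PN _ (leqnn N)).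
rewrite lef_pV2 ?posrE ?exprn_gt0// -natrX ler_nat.
by apply: ltnW; exact: ltn_expl.
Qed.

Lemma nneseries_le (R : realType) (u : nat -> \bar R) (M : \bar R) : (forall n, (0 <= u n)%E) ->
  (forall n, (\sum_(0 <= k < n) u k <= M)%E) -> (\sum_(0 <= k <oo) u k <= M)%E.
Proof.
by move=> u0 uM; apply: lime_le; [exact: is_cvg_nneseries|exact: nearW].
Qed.

(* Increments bounded by [s / 2^k] give nested intervals [x_k +- 2 s / 2^k]. *)
Lemma fast_cauchy_limit (R : realType) (x : nat -> R) (s : R) : 0 <= s ->
  (forall k, `|x k.+1 - x k| <= s * 2 ^- k) ->
  exists l, forall k, `|x k - l| <= 2 * s * 2 ^- k.
Proof.
move=> s0 xs.
have stepL k : x k - 2 * s * 2 ^- k <= x k.+1 - 2 * s * 2 ^- k.+1.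
  have := xs k; rewrite ler_norml => /andP[h _]; rewrite exprS invfM.
  by move: h; move: (2 ^- k) => q; lra.
have stepR k : x k.+1 + 2 * s * 2 ^- k.+1 <= x k + 2 * s * 2 ^- k.
  have := xs k; rewrite ler_norml => /andP[_ h]; rewrite exprS invfM.
  by move: h; move: (2 ^- k) => q; lra.
have monoL m n : x m - 2 * s * 2 ^- m <= x (m + n)%N - 2 * s * 2 ^- (m + n).
  elim: n => [|n IH]; first by rewrite addn0.
  by rewrite addnS (le_trans IH).
have monoR m n : x (m + n)%N + 2 * s * 2 ^- (m + n) <= x m + 2 * s * 2 ^- m.
  elim: n => [|n IH]; first by rewrite addn0.
  by rewrite addnS (le_trans (stepR _)).
have q0 k : 0 <= 2 * s * 2 ^- k by rewrite mulr_ge0 ?invr_ge0 ?exprn_ge0// mulr_ge0.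
have LR m n : x m - 2 * s * 2 ^- m <= x n + 2 * s * 2 ^- n.
  have h1 := monoL m n; have := monoR n m; rewrite addnC => h2.
  by have := q0 (m + n)%N; lra.
pose S := range (fun k => x k - 2 * s * 2 ^- k).
have supS : has_sup S.
  split; first by exists (x 0%N - 2 * s * 2 ^- 0), 0%N.
  by exists (x 0%N + 2 * s * 2 ^- 0) => _ [k _ <-].
exists (sup S) => k; rewrite ler_norml; apply/andP; split.
  suff : sup S <= x k + 2 * s * 2 ^- k by lra.
  by apply: ge_sup; [exact: supS.1|move=> _ [j _ <-]].
suff : x k - 2 * s * 2 ^- k <= sup S by lra.
by apply: (sup_upper_bound supS); exists k.
Qed.

Lemma fast_cauchy_cvg (R : realType) (x : nat -> R) (l s : R) :
  (forall k, `|x k - l| <= s * 2 ^- k) -> x @ \oo --> l.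
Proof.
move=> xl; apply/cvgrPdist_le => e e0.
have s1 : 0 < `|s| + 1 by rewrite ltr_wpDl.
have [N PN] := half_pow_le (divr_gt0 e0 s1).
near=> n; rewrite distrC; apply: le_trans (xl n) _.
have le1 : 2 ^- n <= e / (`|s| + 1).
  apply: le_trans PN; rewrite lef_pV2 ?posrE ?exprn_gt0//.
  by apply: ler_weXn2l; [rewrite ler1n|near: n; exact: nbhs_infty_ge].
move: le1; rewrite ler_pdivlMr//; apply: le_trans; rewrite mulrC ler_wpM2l//.
by rewrite (le_trans (ler_norm _))// lerDl.
Unshelve. all: end_near. Qed.

Section riesz_fischer.
Context d (T : measurableType d) (R : realType) (mu : {measure set T -> \bar R}).
Implicit Types f g : T -> R[i].

(** The series [S] of [4^k |f_(k+1) - f_k|^2] has integral at most the sum of [4^k 8^-k], which is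
    2. Where [S] is finite the increments are at most [sqrt S 2^-k], so both coordinates stay within
    [2 sqrt S 2^-k] of their limits; hence [|F - f_k|^2 <= 8 S 4^-k], with integral at most
    [16 4^-k]. *)
Lemma fast_cauchy_sqint_limit (f : nat -> T -> R[i]) : (forall k, cmeasurable (f k)) ->
  (forall k, (sqint mu (fun x => (f k.+1 x - f k x)%R) <= ((8 ^- k)%R)%:E)%E) ->
  exists2 F, cmeasurable F &
    forall k, (sqint mu (fun x => (F x - f k x)%R) <= ((16 * 4 ^- k)%R)%:E)%E.
Proof.
move=> mf f8.
pose g k x : R := 4 ^+ k * normc (f k.+1 x - f k x) ^+ 2.
have g0 k x : 0 <= g k x by rewrite mulr_ge0 ?sqr_ge0// exprn_ge0.
have mB k : cmeasurable (fun x => f k.+1 x - f k x) by exact: cmeasurableB.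
have mg k : measurable_fun [set: T] (EFin \o g k).
  by apply/measurable_EFinP/measurable_funM => //; exact/measurable_funX/measurable_normc.
pose S x : \bar R := (\sum_(0 <= k <oo) (g k x)%:E)%E.
have S0 x : (0 <= S x)%E by apply: nneseries_ge0 => k *; rewrite lee_fin g0.
have mS : measurable_fun [set: T] S.
  apply: (@ge0_emeasurable_sum _ _ _ _ (fun k x => (g k x)%:E) xpredT) => [k x _ _|k _].
    by rewrite lee_fin.
  exact: mg.
have intS : (\int[mu]_x S x <= 2%:E)%E.
  rewrite integral_nneseries//; last by move=> n x _; rewrite lee_fin.
  apply: nneseries_le => n.
    by apply: integral_ge0 => x _; rewrite lee_fin.
  apply: (@le_trans _ _ (\sum_(0 <= k < n) (2 ^- k)%:E)%E); last first.
    by rewrite sumEFin lee_fin geometric_half_le2.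
  apply: lee_sum => k _; under eq_integral do rewrite /g EFinM.
  rewrite ge0_integralZl//; [|exact: measurable_normc2|by move=> x _; rewrite lee_fin sqr_ge0].
  apply: le_trans (lee_wpmul2l _ (f8 k)) _; first by rewrite lee_fin exprn_ge0.
  rewrite -EFinM lee_fin (_ : 8 = 4 * 2 :> R); last by ring.
  by rewrite exprMn invfM mulrA mulfV ?mul1r// expf_neq0.
pose E := [set x | (S x < +oo)%E].
have mE : measurable E by rewrite -[X in measurable X]setTI; exact: emeasurable_fun_infty_o.
have aeE : {ae mu, forall x, E x}.
  have iS : mu.-integrable [set: T] S.
    apply/integrableP; split => //; apply: (@le_lt_trans _ _ 2%:E); last exact: ltry.
    by apply: le_trans intS; rewrite le_eqVlt; apply/orP; left; apply/eqP/eq_integral => x _;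
      rewrite gee0_abs.
  apply: filterS (integrable_ae measurableT iS) => x /(_ Logic.I).
  by rewrite fin_numElt => /andP[_].
(* Setting the functions to 0 off [E] makes the increments summable at every point, so the limit
   exists everywhere and is measurable. *)
pose h k x : R[i] := (\1_E x)%:C * f k x.
have mh k : cmeasurable (h k).
  by apply: cmeasurableM => //; apply: cmeasurableC; exact: measurable_indic.
pose s x : R := if pselect (E x) then Num.sqrt (fine (S x)) else 0.
have s0 x : 0 <= s x by rewrite /s; case: pselect => [Ex|nEx]//; exact: sqrtr_ge0.
have hs k x : normc (h k.+1 x - h k x) <= s x * 2 ^- k.
  rewrite /h -mulrBr normcM normcR indicE /s.
  case: pselect => [Ex|nEx]; last by rewrite memNset// normr0 !mul0r.
  have q0 : 0 <= Num.sqrt (fine (S x)) * 2 ^- k.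
    by rewrite mulr_ge0 ?sqrtr_ge0// invr_ge0 exprn_ge0.
  rewrite mem_set// normr1 mul1r -(ler_pXn2r (ltn0Sn 1)) ?nnegrE ?normc_ge0//.
  have SE : S x = (fine (S x))%:E by rewrite fineK// ge0_fin_numE.
  rewrite exprMn sqr_sqrtr; last exact: fine_ge0.
  rewrite -exprVn -exprM mulnC exprM exprVn.
  rewrite (_ : (2 ^+ 2)^-1 ^+ k = (4 ^+ k)^-1 :> R); last by rewrite exprVn; congr (_ ^+ _)^-1; ring.
  rewrite ler_pdivlMr ?exprn_gt0// mulrC -[leLHS]/(g k x) -lee_fin -SE.
  apply: le_trans (nneseries_lim_ge (m := 0) k.+1 _); last by move=> n _ _; rewrite lee_fin.
  by rewrite big_nat_recr//= leeDr// sume_ge0// => j _; rewrite lee_fin.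
have /choice[F FP] : forall x, exists l : R[i], forall k,
    `|Re (h k x) - Re l| <= 2 * s x * 2 ^- k /\ `|Im (h k x) - Im l| <= 2 * s x * 2 ^- k.
  move=> x; have [|a aP] := @fast_cauchy_limit _ (fun k => Re (h k x)) (s x) (s0 x).
    by move=> k; rewrite -ReN -ReD (le_trans (ler_Re_normc _)).
  have [|b bP] := @fast_cauchy_limit _ (fun k => Im (h k x)) (s x) (s0 x).
    move=> k; apply: le_trans (hs k x); apply: le_trans (ler_Im_normc _).
    by case: (h k.+1 x) (h k x) => ? ? [].
  by exists (a +i* b) => k.
have mF : cmeasurable F.
  split.
  - apply: (@measurable_fun_cvg _ _ _ _ (fun k x => Re (h k x))) => [k|x _]; first by have [] := mh k.
    by apply: (@fast_cauchy_cvg _ _ _ (2 * s x)) => k; have [] := FP x k.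
  - apply: (@measurable_fun_cvg _ _ _ _ (fun k x => Im (h k x))) => [k|x _]; first by have [] := mh k.
    by apply: (@fast_cauchy_cvg _ _ _ (2 * s x)) => k; have [] := FP x k.
exists F => // k.
have c0 : 0 <= 8 * 4 ^- k :> R by rewrite mulr_ge0// invr_ge0 exprn_ge0.
apply: (@le_trans _ _ (\int[mu]_x ((8 * 4 ^- k)%:E * S x)%E)%E); last first.
  rewrite ge0_integralZl//.
  rewrite (_ : 16 * 4 ^- k = 8 * 4 ^- k * 2 :> R); last by ring.
  by rewrite [leRHS]EFinM lee_wpmul2l.
apply: ae_ge0_le_integral => //.
- by move=> x _; rewrite lee_fin sqr_ge0.
- by apply: measurable_normc2; exact: cmeasurableB.
- by move=> x _; rewrite mule_ge0.
- exact: emeasurable_funM.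
apply: filterS aeE => x Ex _.
have SE : S x = (fine (S x))%:E by rewrite fineK// ge0_fin_numE.
rewrite SE -EFinM lee_fin.
have sE : s x ^+ 2 = fine (S x).
  by rewrite /s; case: pselect => [Ex'|/(_ Ex)//]; rewrite sqr_sqrtr// fine_ge0.
have hE : h k x = f k x by rewrite /h indicE mem_set// mul1r.
rewrite normc_sqr; have [] := FP x k; rewrite hE => h1 h2.
have q0 : 0 <= 2 * s x * 2 ^- k by rewrite mulr_ge0 ?invr_ge0 ?exprn_ge0// mulr_ge0.
have qE : (2 * s x * 2 ^- k) ^+ 2 = 4 * 4 ^- k * fine (S x).
  rewrite !exprMn sE -exprVn -exprM mulnC exprM -exprVn.
  rewrite (_ : (2^-1) ^+ 2 = 4^-1 :> R); last by field.
  by ring.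
have sqle (y : R) : `|y| <= 2 * s x * 2 ^- k -> y ^+ 2 <= 4 * 4 ^- k * fine (S x).
  by move=> hy; rewrite -qE -real_normK ?num_real// ler_pXn2r// nnegrE.
have := sqle _ h1; have := sqle _ h2.
have -> : (Re (f k x) - Re (F x)) ^+ 2 = Re (F x - f k x) ^+ 2.
  by rewrite ReD ReN -sqrrN opprB.
have -> : (Im (f k x) - Im (F x)) ^+ 2 = Im (F x - f k x) ^+ 2.
  by case: (f k x) => a b; case: (F x) => a' b' /=; ring.
by move: (4 ^- k) => q; lra.
Qed.

Local Notation nrm := (ip_norm (@L2_dot d T R mu)).

Lemma L2_complete : ip_complete (@L2_dot d T R mu).
Proof.
have ip := L2_inner_product mu.
move=> u uC.
have p0 k : 0 < 4 ^- k :> R by rewrite invr_gt0 exprn_gt0.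
(* Increments of norm [4^-k] have squares [16^-k], below the required [8^-k]. *)
have /choice[N NP] : forall k, exists N, forall m n, (N <= m)%N -> (N <= n)%N ->
   nrm (u m - u n) <= 4 ^- k by move=> k; exact: uC.
pose M k := (\max_(j < k.+1) N j)%N.
have NM j k : (j <= k)%N -> (N j <= M k)%N.
  by rewrite -ltnS => jk; exact: (@leq_bigmax _ (fun j : 'I_k.+1 => N j) (Ordinal jk)).
pose v k := u (M k).
have vP k : nrm (v k.+1 - v k) <= 4 ^- k by apply: NP; exact: NM.
have sqB (a b : L2 mu) : sqint mu (fun x => L2_repr a x - L2_repr b x) = (nrm (a - b) ^+ 2)%:E.
  rewrite -sqint_nrm; apply: ae_eq_sqint => //; first exact: cmeasurableB.
  by apply: filterS (L2_reprB a b) => x xE _; rewrite xE.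
have [||F mF FP] := @fast_cauchy_sqint_limit (fun k => L2_repr (v k)).
- by [].
- move=> k; rewrite sqB lee_fin.
  apply: (@le_trans _ _ ((4 ^- k) ^+ 2)); first by rewrite ler_pXn2r ?nnegrE ?nrm_ge0 ?(ltW (p0 k))//.
  have -> : (4 ^- k) ^+ 2 = 16 ^- k :> R.
    by rewrite -!exprVn -exprM mulnC exprM; congr (_ ^+ _); field.
  by rewrite lef_pV2 ?posrE ?exprn_gt0// lerXn2r// ?nnegrE// ler_nat.
have FL : Lp mu 2%:E F.
  have L1 : Lp mu 2%:E (fun x => F x - L2_repr (v 0%N) x).
    by apply/Lp2P; split; [exact: cmeasurableB|exact: le_lt_trans (FP 0%N) (ltry _)].
  have := Lp2D L1 (L2_reprLp (v 0%N)); rewrite (_ : (fun _ => _) = F)//.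
  by apply/funext => x; rewrite subrK.
pose l := L2_of mu F; exists l => eps e0.
have lv k : nrm (v k - l) <= 4 * 2 ^- k.
  have q0 : 0 <= 4 * 2 ^- k :> R by rewrite mulr_ge0// invr_ge0 exprn_ge0.
  rewrite nrmC//; apply: (@nrm_le_ae _ _ _ _ _ (fun x => F x - L2_repr (v k) x)) => //.
  - by apply: filterS2 (L2_reprB l (v k)) (L2_ofE FL) => x xE lE _; rewrite xE// lE.
  - have E2 : (2 ^- k) ^+ 2 = 4 ^- k :> R.
      by rewrite -!exprVn -exprM mulnC exprM; congr (_ ^+ _); field.
    by apply: le_trans (FP k) _; rewrite lee_fin exprMn E2; lra.
  - exact: cmeasurableB.
have e5 : 0 < eps / 5 by rewrite divr_gt0.
have [k kP] := half_pow_le e5.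
exists (M k) => n nM; apply: le_trans (nrm_subD ip _ (v k) _) _.
have h1 : nrm (u n - v k) <= 4 ^- k.
  by apply: NP; [exact: leq_trans (NM k k (leqnn k)) nM|exact: NM].
have h2 := lv k.
have h3 : 4 ^- k <= 2 ^- k :> R.
  by rewrite lef_pV2 ?posrE ?exprn_gt0// lerXn2r// ?nnegrE// ler_nat.
by move: h1 h2 h3 kP; move: (4 ^- k : R) (2 ^- k : R) => a b; lra.
Qed.

End riesz_fischer.

(** * Finite nets and precompactness in L^2 *)

Lemma interval_net (R : realType) (M del : R) : 0 < del ->
  exists N (c : 'I_N.+1 -> R), forall x, `|x| <= M -> exists j, `|x - c j| <= del.
Proof.
move=> d0; pose N := Num.truncn (2 * M / del).
exists N, (fun j => - M + j%:R * del) => x; rewrite ler_norml => /andP[x1 x2].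
have q0 : 0 <= (x + M) / del by rewrite divr_ge0 ?(ltW d0)//; lra.
have jN : (Num.truncn ((x + M) / del) < N.+1)%N.
  by rewrite ltnS; apply: le_truncn; rewrite ler_pM2r ?invr_gt0//; lra.
exists (Ordinal jN) => /=; have /andP[] := truncn_itv q0.
rewrite ler_pdivlMr// ltr_pdivrMr// -natr1 => h1 h2.
by rewrite ler_norml; apply/andP; split; lra.
Qed.

Lemma disc_net (R : realType) (M del : R) : 0 < del ->
  exists (J : finType) (c : J -> R[i]), forall z, normc z <= M -> exists j, normc (z - c j) <= del.
Proof.
move=> d0; have [N [c cP]] := interval_net M (divr_gt0 d0 (ltr0Sn R 1)).
exists ('I_N.+1 * 'I_N.+1)%type, (fun j => c j.1 +i* c j.2) => z zM.
have [j jP] := cP _ (le_trans (ler_Re_normc z) zM).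
have [k kP] := cP _ (le_trans (ler_Im_normc z) zM).
exists (j, k); rewrite -(ler_pXn2r (ltn0Sn 1)) ?nnegrE ?normc_ge0 ?(ltW d0)// normc_sqr.
have -> : Re (z - (c j +i* c k)) = Re z - c j by case: (z).
have -> : Im (z - (c j +i* c k)) = Im z - c k by case: (z).
have sq (y : R) : `|y| <= del / 2 -> y ^+ 2 <= (del / 2) ^+ 2.
  move=> hy; rewrite -real_normK ?num_real// ler_pXn2r// nnegrE//.
  by rewrite (le_trans _ hy).
have := sq _ jP; have := sq _ kP; have := sqr_ge0 del; lra.
Qed.

Section precompactness.
Context d (T : measurableType d) (R : realType) (mu : {measure set T -> \bar R}).
Local Notation nrm := (ip_norm (@L2_dot d T R mu)).
Let ip := L2_inner_product mu.

Lemma nbhs_L2 (l : L2 mu) (B : set (L2 mu)) : nbhs l B ->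
  exists2 e : R, 0 < e & forall v, nrm (v - l) < e -> B v.
Proof.
move=> /nbhs_ballP[e /= e0 eB]; exists (Re e).
  by move: e0; rewrite ltcE/= => /andP[].
move=> v vl; apply: eB; rewrite -ball_normE /= L2_normE nrmC//.
move: e0; rewrite !ltcE/= => /andP[/eqP <- _]; by rewrite eqxx.
Qed.

Lemma L2_nbhs (l : L2 mu) (e : R) : 0 < e -> nbhs l [set v | nrm (v - l) < e].
Proof.
move=> e0; apply/nbhs_ballP; exists e%:C; first by rewrite /= ltcR.
by move=> v; rewrite -ball_normE /= L2_normE nrmC// ltcR.
Qed.

Lemma ultra_finite_cover (S : Type) (F : set_system S) (J : finType) (B : J -> set S) :
  UltraFilter F -> F [set v | exists j, B j v] -> exists j, F (B j).
Proof.
move=> UF FB; have PF : ProperFilter F by exact: ultra_proper.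
apply: contrapT => /forallNP nF.
have Fn : F [set v | forall j, ~ B j v].
  apply: (@filter_forall _ _ (fun j v => ~ B j v) F) => j; by have [/nF|] := in_ultra_setVsetC (B j) UF.
have [v [[j Bj] nB]] := @filter_ex _ F _ _ (@filterI _ F _ _ _ FB Fn).
exact: (nB j Bj).
Qed.

(** An ultrafilter containing the closure contains, for every [k], a ball about one of finitely many
    centres; the chosen centres are Cauchy and their limit is that of the ultrafilter. The radius is
    doubled because points of the closure are only close to [S]. *)
Lemma totally_bounded_precompact (S : set (L2 mu)) :
  (forall eps : R, 0 < eps -> exists (J : finType) (y : J -> L2 mu),
    forall v, S v -> exists j, nrm (v - y j) <= eps) -> precompact S.
Proof.
move=> tb; rewrite precompactE compact_ultra => F UF FS.
have PF : ProperFilter F by exact: ultra_proper.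
have p0 k : 0 < 2 ^- k :> R by rewrite invr_gt0 exprn_gt0.
have /choice[y yP] : forall k : nat, exists y, F [set v | nrm (v - y) <= 2 * 2 ^- k].
  move=> k; have [J [y yJ]] := tb _ (p0 k).
  suff /ultra_finite_cover[j Fj] : F [set v | exists j, nrm (v - y j) <= 2 * 2 ^- k].
    by exists (y j).
  apply: filterS FS => v Sv; have [s [Ss vs]] := Sv _ (L2_nbhs v (p0 k)).
  have [j jP] := yJ _ Ss; exists j => /=; apply: le_trans (nrm_subD ip _ s _) _.
  by rewrite mulr_natl mulr2n lerD// nrmC// ltW.
have yB j k : nrm (y j - y k) <= 2 * 2 ^- j + 2 * 2 ^- k.
  have [v [vj vk]] := @filter_ex _ F _ _ (@filterI _ F _ _ _ (yP j) (yP k)).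
  by apply: le_trans (nrm_subD ip _ v _) _; rewrite lerD// nrmC.
have [l yl] : exists l, nrm_cvg (@L2_dot d T R mu) y l.
  apply: L2_complete => e e0; have [N NP] := half_pow_le (divr_gt0 e0 (ltr0Sn R 3)).
  have Nle m : (N <= m)%N -> 2 ^- m <= e / 4.
    move=> Nm; apply: le_trans NP; rewrite lef_pV2 ?posrE ?exprn_gt0//.
    by apply: ler_weXn2l => //; rewrite ler1n.
  exists N => m n /Nle h1 /Nle h2; apply: le_trans (yB m n) _; lra.
have Fl : F --> l.
  move=> B /nbhs_L2[e e0 eB].
  have [N NP] := half_pow_le (divr_gt0 e0 (ltr0Sn R 4)).
  have [M MP] := yl _ (divr_gt0 e0 (ltr0Sn R 4)).
  pose k := maxn N M.
  apply: filterS (yP k) => v /= vy; apply: eB.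
  have h1 : 2 ^- k <= 2 ^- N :> R.
    rewrite lef_pV2 ?posrE ?exprn_gt0//; apply: ler_weXn2l; first by rewrite ler1n.
    exact: leq_maxl.
  have h2 := MP k (leq_maxr _ _).
  apply: le_lt_trans (nrm_subD ip _ (y k) _) _; lra.
exists l; split => //.
rewrite ((closure_id (closure S)).1 (@closed_closure _ S)).
by move=> B /Fl FB; exact: @filter_ex _ F _ _ (@filterI _ F _ _ _ FS FB).
Qed.

End precompactness.

(** * Perturbation by a multiplication operator *)

Section operators.
Context d (T : measurableType d) (R : realType) (mu : {measure set T -> \bar R}).
Local Notation nrm := (ip_norm (@L2_dot d T R mu)).
Let ip := L2_inner_product mu.
Let complete := @L2_complete _ _ _ mu.
Implicit Types A B : op mu.

Lemma selfadjointP A : selfadjoint A -> selfadjoint_rel (@L2_dot d T R mu) A.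
Proof.
move=> [[A0 Alin _] _ Aadj]; split; first by split.
by move=> w w'; rewrite {1}Aadj.
Qed.

Lemma nonnegative_op_Re A : nonnegative_op A -> forall u v, A (u, v) -> 0 <= Re (L2_dot v u).
Proof. by move=> A0 u v /A0; rewrite lecE => /andP[]. Qed.

Lemma bounded_op_resolventP A z : linear_rel A ->
  bounded_op (op_inv (op_add A (op_scalar mu (- z)))) <-> resolvent_set (@L2_dot d T R mu) A z.
Proof.
move=> lA; split.
  move=> [_ domA [c cP]]; split.
    exists c => u v Auv.
    have := cP (v - z *: u) u; rewrite !L2_normE -(rmorphM (real_complex R)) lecR; apply.
    by exists v, (- (z *: u)); split => //=; rewrite /op_scalar/= scaleNr.
  move=> y; have : dom (op_inv (op_add A (op_scalar mu (- z)))) y by rewrite domA.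
  move=> [u [v [w /= [Au wE yE]]]]; exists u, v; split => //.
  have {}wE : w = - z *: u := wE; by rewrite yE wE scaleNr.
move=> [[C CP] surj].
have inv y u : op_inv (op_add A (op_scalar mu (- z))) (y, u) <-> exists2 v, A (u, v) & y = v - z *: u.
  split=> [[v [w /= [Au wE yE]]]|[v Au ->]].
    have {}wE : w = - z *: u := wE; by exists v => //; rewrite yE wE scaleNr.
  by exists v, (- (z *: u)); split => //=; rewrite /op_scalar/= scaleNr.
split.
- split.
  + by apply/inv; exists 0; [exact: lA.1|rewrite scaler0 subr0].
  + move=> a u v u' v' /inv[w Aw ->] /inv[w' Aw' ->]; apply/inv.
    exists (a *: w + w'); first exact: lA.2.
    by rewrite scalerBr scalerDr !scalerA [a * _]mulrC opprD addrACA.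
  + move=> v /inv[w Aw w0]; apply: (nrm_eq0 ip); apply/eqP; rewrite eq_le nrm_ge0 andbT.
    by have := CP _ _ Aw; rewrite -w0 nrm0// mulr0.
- apply/seteqP; split => // y _; have [u [v [Au yE]]] := surj y.
  by exists u; apply/inv; exists v.
- exists C => y u /inv[v Au ->]; rewrite !L2_normE -(rmorphM (real_complex R)) lecR; exact: CP.
Qed.

Lemma spectrumP A z : linear_rel A ->
  spectrum A z <-> ~ resolvent_set (@L2_dot d T R mu) A z.
Proof. by move=> lA; split => /= nb /(bounded_op_resolventP _ lA). Qed.

Lemma ReImE (z : R[i]) : Im z = 0 -> z = (Re z)%:C.
Proof. by case: z => a b /= ->. Qed.

Lemma normr_normc (z : R[i]) : `|z| = (normc z)%:C.
Proof. by case: z. Qed.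

(** Nonreal points are in the resolvent set. At a real point of the spectrum, [semifredholm] gives
    isolation, a finite-dimensional eigenspace, and an eigenvector, since without one the point
    would be in the resolvent set. The converse is [isolated_semifredholm]. *)
Lemma ess_spectrumP A z : selfadjoint_rel (@L2_dot d T R mu) A ->
  ess_spectrum A z <-> Im z = 0 /\ ~ semifredholm (@L2_dot d T R mu) A (Re z).
Proof.
move=> sA; have lA := selfadjoint_linear sA; split.
  move=> [/(spectrumP _ lA) nres ndisc].
  have z0 : Im z = 0.
    by apply/eqP/negPn/negP => /(selfadjoint_resolvent_nonreal ip complete sA).
  split => // fz; apply: ndisc.
  have zE := ReImE z0; rewrite zE in nres *.
  have [del del0 delP] := semifredholm_isolated ip complete sA fz.
  have [n [e eP]] := semifredholm_finite_eigen ip complete sA fz.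
  split.
  - exact/spectrumP.
  - exists del => // w /(spectrumP _ lA) nw wd; apply: contrapT => /eqP wz.
    by apply/nw/delP => //; move: wd; rewrite normr_normc ltcR.
  - apply: contrapT => nex; apply: nres; apply: semifredholm_resolvent => // u Au.
    by apply: contrapT => /eqP u0; apply: nex; exists u.
  - by exists n, e => u /eP.
move=> [z0 nf]; have zE := ReImE z0; split.
  by apply/spectrumP => // rz; apply: nf; apply: resolvent_semifredholm; rewrite -zE.
move=> [_ [eps e0 eP] _ [n [e nP]]]; apply: nf.
apply: (@isolated_semifredholm _ _ _ ip complete A sA (Re z) eps n e) => //.
  move=> c /andP[cz ce]; apply: contrapT => nres.
  have cE : c%:C = z.
    apply: eP; first exact/spectrumP.
    by rewrite zE -(rmorphB (real_complex R)) normr_normc normcR ltcR.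
  by move: cz; rewrite -cE/= subrr normr0 ltxx.
by move=> u Au; apply: nP; rewrite /op_eigenspace/= zE.
Qed.

End operators.

Section perturbation.
Context d (T : measurableType d) (R : realType) (mu : {measure set T -> \bar R}).
Local Notation nrm := (ip_norm (@L2_dot d T R mu)).
Let ip := L2_inner_product mu.
Let complete := @L2_complete _ _ _ mu.
Variables (H : op mu) (V : T -> R).
Hypothesis mV : measurable_fun [set: T] V.
Hypothesis sH : selfadjoint H.
Hypothesis H0 : nonnegative_op H.

Lemma mul_op_linear : linear_rel (mul_op mu V).
Proof.
split.
  by apply: filterS (L2_repr0 mu) => x xE _ /=; rewrite xE// mulr0.
move=> a u v u' v' uv uv'; rewrite /mul_op/=.
have ZD (w w' : L2 mu) :
    {ae mu, forall x, L2_repr (a *: w + w') x = a * L2_repr w x + L2_repr w' x}.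
  by apply: filterS2 (L2_reprD (a *: w) w') (L2_reprZ a w) => x e1 e2; rewrite e1// e2.
have h : {ae mu, forall x, L2_repr v x = (V x)%:C * L2_repr u x /\
    L2_repr v' x = (V x)%:C * L2_repr u' x}.
  by apply: filterS2 uv uv' => x e1 e2; rewrite e1// e2.
apply: filterS3 (ZD u u') (ZD v v') h => x e1 e2 [e3 e4] xT.
by rewrite e2 e1 e3 e4 mulrDr mulrCA.
Qed.

Lemma mul_op_functional u x x' : mul_op mu V (u, x) -> mul_op mu V (u, x') -> x = x'.
Proof.
by move=> ux ux'; apply: L2_eq; apply: filterS2 ux ux' => y xE x'E yT; rewrite xE// x'E.
Qed.

Lemma mul_op_symmetric : symmetric_rel (@L2_dot d T R mu) (mul_op mu V).
Proof.
move=> u x u' x' ux ux'; rewrite !L2_dotE; apply: ae_eq_cintegral.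
- by apply: cmeasurableM => //; exact: cmeasurableJ.
- by apply: cmeasurableM => //; exact: cmeasurableJ.
- apply: filterS2 ux ux' => y xE x'E yT; rewrite xE// x'E//.
  by rewrite (rmorphM (@conjc R)) [X in _ = _ * (X * _)]conj_RtoC mulrCA mulrA.
Qed.

Hypothesis domV : forall u v, H (u, v) -> exists x, mul_op mu V (u, x).
Hypothesis cV : rel_compact (@L2_dot d T R mu) H (mul_op mu V).

Let sH' := selfadjointP sH.
Let H0' := nonnegative_op_Re H0.
Let lH := selfadjoint_linear sH'.
Let lV := mul_op_linear.
Let fV := mul_op_functional.

(** If [f] is in the unit ball and [u = (H + a)^-1 f], then [|u| <= 1/a] and [|H u| <= 1]. So [V u]
    is close to a combination of the [g i] with bounded coefficients, and a grid of coefficients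
    gives a finite net. *)
Lemma compact_mul_resolvent (a : R) : 0 < a ->
  compact_op (op_comp (mul_op mu V) (op_inv (op_add H (op_scalar mu a%:C)))).
Proof.
move=> a0.
have compE f x : op_comp (mul_op mu V) (op_inv (op_add H (op_scalar mu a%:C))) (f, x) <->
    exists u v, [/\ H (u, v), f = v + a%:C *: u & mul_op mu V (u, x)].
  split=> [[u [[v [w /= [Hu wE fE]]] ux]]|[u [v [Hu -> ux]]]].
    have {}wE : w = a%:C *: u := wE; by exists u, v; split => //; rewrite fE wE.
  by exists u; split => //; exists v, (a%:C *: u).
have le u v := @nonneg_shift_le _ _ _ ip H H0' a u v (ltW a0).
split.
- split.
  + by apply/compE; exists 0, 0; rewrite scaler0 addr0; split => //; [exact: lH.1|exact: lV.1].
  + move=> b f x f' x' /compE[u [v [Hu -> ux]]] /compE[u' [v' [Hu' -> ux']]].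
    apply/compE; exists (b *: u + u'), (b *: v + v'); split; [exact: lH.2| |exact: lV.2].
    by rewrite !scalerDr !scalerA [a%:C * b]mulrC addrACA.
  + move=> x /compE[u [v [Hu f0 ux]]]; have [_] := le _ _ Hu.
    rewrite -f0 nrm0// pmulr_rle0// => u0.
    have uE : u = 0 by apply: (nrm_eq0 ip); apply/eqP; rewrite eq_le u0 nrm_ge0.
    by rewrite uE in ux; exact: fV ux lV.1.
- apply/seteqP; split => // f _.
  have bd : exists C : R, forall u v, H (u, v) -> nrm u <= C * nrm (v - (- a%:C) *: u).
    exists a^-1 => u v Hu; rewrite scaleNr opprK mulrC ler_pdivlMr// mulrC.
    by have [] := le _ _ Hu.
  have [_ /(_ f)[u [v [Hu fE]]]] := selfadjoint_resolvent ip complete sH' bd.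
  have [x ux] := domV Hu; exists x; apply/compE; exists u, v; split => //.
  by rewrite -fE scaleNr opprK.
- apply: totally_bounded_precompact => eps e0.
  have K0 : 0 < a^-1 + 1 by rewrite addr_gt0// invr_gt0.
  have [n [e [g gP]]] := cV (divr_gt0 (divr_gt0 e0 (ltr0Sn R 1)) K0).
  (* [M] bounds every coefficient [<u, e_i>]; moving each by [eps / (2 G)] moves the combination by
     at most [eps / 2]. *)
  pose G : R := 1 + \sum_i nrm (g i); pose M : R := a^-1 * \sum_i nrm (e i).
  have G0 : 0 < G by rewrite ltr_wpDr// sumr_ge0// => i _; exact: nrm_ge0.
  have [J [c cP]] := disc_net M (divr_gt0 (divr_gt0 e0 (ltr0Sn R 1)) G0).
  exists {ffun 'I_n -> J}, (fun phi : {ffun 'I_n -> J} => \sum_i c (phi i) *: g i).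
  move=> x [f f1 /compE[u [v [Hu fE ux]]]].
  have f1' : nrm f <= 1 by move: f1; rewrite L2_normE lecR.
  have [vf uf] := le _ _ Hu; rewrite -fE in vf uf.
  have u1 : nrm u <= a^-1 by rewrite -[a^-1]mul1r ler_pdivlMr// mulrC (le_trans uf).
  have v1 : nrm v <= 1 by exact: le_trans vf f1'.
  have zM i : normc (L2_dot u (e i)) <= M.
    apply: le_trans (CauchySchwarz ip _ _) _; apply: ler_pM; rewrite ?nrm_ge0//.
    by rewrite (bigD1 i)//= lerDl sumr_ge0// => j _; exact: nrm_ge0.
  have /choice[phi phiP] := fun i => cP _ (zM i).
  exists [ffun i => phi i].
  apply: le_trans (nrm_subD ip _ (\sum_i L2_dot u (e i) *: g i) _) _.
  rewrite (splitr eps); apply: lerD.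
    apply: le_trans (gP _ _ _ Hu ux) _.
    by rewrite -[leRHS](divfK (lt0r_neq0 K0)) ler_wpM2l ?lerD// ltW// divr_gt0// divr_gt0.
  rewrite -sumrB; apply: le_trans (nrm_sum ip _ _ _) _.
  apply: (@le_trans _ _ (\sum_i eps / 2 / G * nrm (g i))).
    apply: ler_sum => i _; rewrite ffunE -scalerBl nrmZ// ler_wpM2r ?nrm_ge0//.
  rewrite -mulr_sumr -[leRHS](divfK (lt0r_neq0 G0)) ler_wpM2l//.
    by rewrite ltW// divr_gt0// divr_gt0.
  by rewrite /G lerDr.
Qed.

Let sB := rel_sum_selfadjoint ip complete sH' H0' lV mul_op_symmetric domV cV.

Lemma dom_add_mul : dom (op_add H (mul_op mu V)) = dom H.
Proof.
apply/seteqP; split => [u [w [v [x [/= Hu _ _]]]]|u [v Hu]]; first by exists v.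
by have [x ux] := domV Hu; exists (v + x), v, x.
Qed.

Lemma selfadjoint_add_mul : selfadjoint (op_add H (mul_op mu V)).
Proof.
have [[_ _ H00] dH _] := sH; split.
- split; [exact: (selfadjoint_linear sB).1|exact: (selfadjoint_linear sB).2|].
  move=> w [v [x [/= /H00 -> Vx ->]]]; rewrite add0r; exact: fV Vx lV.1.
- by rewrite dom_add_mul.
- apply/seteqP; split => -[w w'] /=; first by move=> /sB.2.
  by move=> h; apply/sB.2.
Qed.

Lemma semibounded_add_mul : semibounded (op_add H (mul_op mu V)).
Proof.
have [c cP] := rel_sum_semibounded ip complete sH' H0' lV mul_op_symmetric domV cV.
exists (- c) => u w Bu.
rewrite (selfadjoint_dot_real ip sB Bu) (dot_nrm ip) -(rmorphM (real_complex R)) lecR.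
exact: cP.
Qed.

Lemma ess_spectrum_add_mul : ess_spectrum (op_add H (mul_op mu V)) = ess_spectrum H.
Proof.
apply/seteqP; split => z /ess_spectrumP -/(_ _)[//|z0 nf]; apply/ess_spectrumP => //; split => //.
  by move=> /(semifredholm_rel_sumE ip fV domV cV).
by move=> /(semifredholm_rel_sumE ip fV domV cV).
Qed.

End perturbation.

(** * The heat semigroup *)

Section exponential_semigroup.
Context d (T : measurableType d) (R : realType) (mu : {measure set T -> \bar R}).
Context d' (Y : measurableType d') (nu : {measure set Y -> \bar R}).
Local Notation nrm := (ip_norm (@L2_dot d T R mu)).
Local Notation nrm' := (ip_norm (@L2_dot d' Y R nu)).
Variables (A : op mu) (h : Y -> R) (U : {linear L2 mu -> L2 nu}).
Hypothesis A0 : nonnegative_op A.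
Hypothesis sr : spectral_representation A h U.
Let ip := L2_inner_product mu.

Lemma spectral_isometry u : nrm' (U u) = nrm u.
Proof. by case: sr => _ _ Udot _; rewrite /ip_norm Udot. Qed.

Lemma spectral_measurable : measurable_fun [set: Y] h. Proof. by case: sr. Qed.
Let mh := spectral_measurable.

Lemma measurable_mul_fun (k : Y -> R) (w : L2 nu) : measurable_fun [set: Y] k ->
  cmeasurable (fun y => (k y)%:C * L2_repr w y).
Proof. by move=> mk; apply: cmeasurableM => //; exact: cmeasurableC. Qed.

(** The bound is asked only where [w] does not vanish, as that is what [spectral_nonneg] provides:
    [nu] is arbitrary, and a set of positive measure may be invisible to all square-integrable
    functions. *)
Lemma mul_L2 (k : Y -> R) (w : L2 nu) (c : R) : measurable_fun [set: Y] k ->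
  {ae nu, forall y, L2_repr w y != 0 -> `|k y| <= c} ->
  Lp nu 2%:E (fun y => (k y)%:C * L2_repr w y).
Proof.
move=> mk kc; apply: (@Lp2_dominated _ _ _ _ _ (fun y => c%:C * L2_repr w y)).
- exact: measurable_mul_fun.
- by apply: Lp2Z; exact: L2_reprLp.
- apply: filterS kc => y; have [->|w0 /(_ isT) kc] := eqVneq (L2_repr w y) 0.
    by rewrite !mulr0.
  by rewrite !normcM !normcR ler_wpM2r ?normc_ge0// (le_trans kc)// ler_norm.
Qed.

(* Nonnegativity of [A] is tested on the part of [w] living on [h < 0], damped
   by [exp (- |h|)] so that it belongs to the domain. *)
Lemma spectral_nonneg (w : L2 nu) : {ae nu, forall y, L2_repr w y != 0 -> 0 <= h y}.
Proof.
have [_ Usurj Udot AU] := sr.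
pose N := h @^-1` `]-oo, 0[.
have mN : measurable N by rewrite -[N]setTI; exact: mh.
pose phi y : R := \1_N y * expR (- `|h y|).
have mphi : measurable_fun [set: Y] phi.
  apply: measurable_funM; first exact: measurable_indic.
  by apply: measurableT_comp => //; apply: measurableT_comp => //; exact: measurableT_comp.
have phi0 y : 0 <= phi y by rewrite mulr_ge0 ?expR_ge0// indicE.
have phiN y : h y < 0 -> phi y = expR (- `|h y|).
  by move=> hy; rewrite /phi indicE mem_set ?mul1r// /N/= in_itv.
have phi_out y : 0 <= h y -> phi y = 0.
  by move=> hy; rewrite /phi indicE memNset ?mul0r// /N/= in_itv/= => hN; move: hy; rewrite leNgt hN.
have e1 (x : R) : 0 <= x -> expR (- x) <= 1 by move=> x0; rewrite -expR0 ler_expR oppr_le0.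
have e2 (x : R) : 0 <= x -> x * expR (- x) <= 1.
  move=> x0; rewrite expRN ler_pdivrMr ?expR_gt0// mul1r.
  by apply: le_trans (expR_ge1Dx x); rewrite lerDr.
have phi1 y : `|phi y| <= 1.
  rewrite ger0_norm//; case: (ltP (h y) 0) => [/phiN ->|/phi_out ->//]; exact: e1.
have hphi1 y : `|h y * phi y| <= 1.
  rewrite normrM (ger0_norm (phi0 y)).
  case: (ltP (h y) 0) => [/phiN ->|/phi_out ->]; [exact: e2|by rewrite mulr0].
have L1 : Lp nu 2%:E (fun y => (phi y)%:C * L2_repr w y).
  by apply: (@mul_L2 phi w 1) => //; exact: nearW.
have L2 : Lp nu 2%:E (fun y => (h y * phi y)%:C * L2_repr w y).
  by apply: (@mul_L2 (fun y => h y * phi y) w 1); [exact: measurable_funM|exact: nearW].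
have [u Uu] := Usurj (L2_of nu (fun y => (phi y)%:C * L2_repr w y)).
have [v Uv] := Usurj (L2_of nu (fun y => (h y * phi y)%:C * L2_repr w y)).
have Auv : A (u, v).
  apply/AU; rewrite Uu Uv /mul_op/=; apply: filterS2 (L2_ofE L1) (L2_ofE L2) => y e3 e4 yT.
  by rewrite e4// e3// mulrA -(rmorphM (real_complex R)).
have := nonnegative_op_Re A0 Auv.
rewrite -Udot Uu Uv (L2_dot_ae L2 L1 (L2_ofE L2) (L2_ofE L1)) /cintegral /=.
have [+ _] := L2_cintegrable L2 L1.
(* [k] is minus the integrand of [<v, u>]. It is nonnegative because [phi] lives on [h < 0], yet its
   integral is at most 0, so it vanishes almost everywhere. *)
pose k y : R := - h y * phi y ^+ 2 * normc (L2_repr w y) ^+ 2.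
have -> : (@Re R \o (fun y => (h y * phi y)%:C * L2_repr w y * conjc ((phi y)%:C * L2_repr w y)))
    = (fun y => - 1 * k y).
  apply/funext => y /=; rewrite /k normc_sqr; case: (L2_repr w y) => a b /=; ring.
move=> ik; have -> : (\int[nu]_y Re ((h y * phi y)%:C * L2_repr w y * conjc ((phi y)%:C * L2_repr w y)))
    = \int[nu]_y (- 1 * k y).
  by apply: eq_Rintegral => y _; rewrite /k normc_sqr; case: (L2_repr w y) => a b /=; ring.
move=> int_ge0.
have k0 y : 0 <= k y.
  rewrite /k mulr_ge0 ?sqr_ge0//; case: (ltP (h y) 0) => hy.
    by rewrite mulr_ge0 ?sqr_ge0// oppr_ge0 ltW.
  by rewrite phi_out// expr0n mulr0.
have {}ik : nu.-integrable [set: Y] (EFin \o k).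
  rewrite (_ : EFin \o k = fun y => ((-1)%:E * (-1 * k y)%:E)%E).
    exact: integrableZl.
  by apply/funext => y /=; rewrite -EFinM; congr (_%:E); ring.
have int0 : (\int[nu]_y (k y)%:E = 0)%E.
  have fin := integrable_fin_num measurableT ik.
  have kge : (0 <= \int[nu]_y (k y)%:E)%E by apply: integral_ge0 => y _; rewrite lee_fin.
  move: int_ge0; rewrite RintegralZl// mulN1r oppr_ge0 => kle.
  apply/eqP; rewrite eq_le kge andbT -(fineK fin) lee_fin; exact: kle.
have /ae_eq_integral_abs : measurable_fun [set: Y] (EFin \o k) by have /integrableP[] := ik.
move=> /(_ nu measurableT)[+ _]; rewrite (_ : (\int[nu]_y `|_|)%E = 0%E); last first.
  by rewrite -int0; apply: eq_integral => y _; rewrite /= ger0_norm.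
move=> /(_ erefl); apply: filterS => y /(_ Logic.I)/= [ky0] w0.
rewrite leNgt; apply/negP => hy.
suff : 0 < k y by rewrite ky0 ltxx.
rewrite /k mulr_gt0//; last first.
  by rewrite exprn_gt0// lt_def normc_ge0 andbT; apply: contraNneq w0 => /eq0_normc ->.
by rewrite mulr_gt0 ?oppr_gt0// exprn_gt0// phiN// expR_gt0.
Qed.

Variable P : R -> op mu.
Hypothesis expP : forall t : R, 0 <= t -> forall u v,
  P t (u, v) <-> mul_op nu (fun y => expR (- t * h y)) (U u, U v).

Lemma measurable_expR_mul (t : R) : measurable_fun [set: Y] (fun y => expR (- t * h y)).
Proof. by apply: measurableT_comp => //; exact: measurable_funM. Qed.

Lemma exp_total (t : R) u : 0 <= t -> exists v, P t (u, v).
Proof.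
move=> t0; have [_ Usurj Udot AU] := sr.
have L1 : Lp nu 2%:E (fun y => (expR (- t * h y))%:C * L2_repr (U u) y).
  apply: (mul_L2 (c := 1)); first exact: measurable_expR_mul.
  apply: filterS (spectral_nonneg (U u)) => y /[apply] hy.
  by rewrite ger0_norm ?expR_ge0// -expR0 ler_expR mulNr oppr_le0 mulr_ge0.
have [v Uv] := Usurj (L2_of nu (fun y => (expR (- t * h y))%:C * L2_repr (U u) y)).
by exists v; apply/expP => //; rewrite Uv; exact: L2_ofE.
Qed.

Lemma exp_functional (t : R) u v v' : 0 <= t -> P t (u, v) -> P t (u, v') -> v = v'.
Proof.
move=> t0 /expP -/(_ t0) uv /expP -/(_ t0) uv'.
apply/eqP; rewrite -subr_eq0; apply/eqP/(nrm_eq0 ip); rewrite -spectral_isometry linearB/=.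
by rewrite (mul_op_functional uv uv') subrr (nrm0 (L2_inner_product nu)).
Qed.

Lemma exp_linear (t : R) : 0 <= t -> linear_rel (P t).
Proof.
move=> t0; have lin := mul_op_linear nu (fun y => expR (- t * h y)).
split; first by apply/expP => //; rewrite !linear0; exact: lin.1.
move=> a u v u' v' /expP -/(_ t0) uv /expP -/(_ t0) uv'.
by apply/expP => //; rewrite !linearP; exact: lin.2.
Qed.

Lemma exp_contraction (t : R) u v : 0 <= t -> P t (u, v) -> nrm v <= nrm u.
Proof.
move=> t0 /expP -/(_ t0) uv; rewrite -(spectral_isometry v) -(spectral_isometry u) -[leRHS]mul1r.
apply: nrm_le_pointwise => //; apply: filterS2 (spectral_nonneg (U u)) uv => y hy /(_ Logic.I) /= ->.
have [->|w0] := eqVneq (L2_repr (U u) y) 0; first by rewrite mulr0 normc0 mulr0.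
rewrite normcM normcR ger0_norm ?expR_ge0// ler_wpM2r ?normc_ge0//.
by rewrite -expR0 ler_expR mulNr oppr_le0 mulr_ge0// hy.
Qed.

Lemma exp_semigroup (s t : R) u v w : 0 <= s -> 0 <= t -> P s (u, v) -> P t (v, w) -> P (s + t) (u, w).
Proof.
move=> s0 t0 /expP -/(_ s0) uv /expP -/(_ t0) vw; apply/expP; first exact: addr_ge0.
apply: filterS2 uv vw => y e1 e2 yT /=; rewrite e2//= e1//= mulrA.
by rewrite -(rmorphM (real_complex R)) -expRD; congr ((expR _)%:C * _); ring.
Qed.

(** In the spectral representation this is [0 <= 1 - exp (- t h) <= t h] for [h >= 0]. *)
Lemma exp_lipschitz (t : R) u v u' : 0 <= t -> A (u, v) -> P t (u, u') -> nrm (u - u') <= t * nrm v.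
Proof.
move=> t0; have [_ _ _ AU] := sr.
move=> /AU uv /expP -/(_ t0) uu'; rewrite -(spectral_isometry (u - u')) -(spectral_isometry v) linearB/=.
apply: nrm_le_pointwise => //.
have hh : {ae nu, forall y, L2_repr (U v) y = (h y)%:C * L2_repr (U u) y /\
    L2_repr (U u') y = (expR (- t * h y))%:C * L2_repr (U u) y}.
  by apply: filterS2 uv uu' => y e1 e2; split; [exact: e1|exact: e2].
apply: filterS3 (spectral_nonneg (U u)) hh (L2_reprB (U u) (U u')) => y hy [e1 e2] /(_ Logic.I) ->.
rewrite e1 e2; have [->|w0] := eqVneq (L2_repr (U u) y) 0.
  by rewrite !mulr0 subrr normc0 mulr0.
have {}hy := hy w0.
rewrite -[X in X - _]mul1r -mulrBl !normcM mulrA ler_wpM2r ?normc_ge0//.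
rewrite -(rmorph1 (real_complex R)) -(rmorphB (real_complex R)) !normcR [`|h y|]ger0_norm//.
have th : 0 <= t * h y by rewrite mulr_ge0.
rewrite ger0_norm.
  by have := expR_ge1Dx (- t * h y); lra.
by rewrite subr_ge0 -expR0 ler_expR mulNr oppr_le0.
Qed.

End exponential_semigroup.

Section heat_semigroup.
Context d (T : measurableType d) (R : realType) (mu : {measure set T -> \bar R}).
Local Notation nrm := (ip_norm (@L2_dot d T R mu)).

(** Collects all that is used of the functional calculus of [H]. The graphs of the semigroup are
    turned into functions by choice, with arbitrary values for [t <= 0]. *)
Lemma heat_semigroup (p : R -> T -> T -> R) (H : op mu) : heat_generator p H ->
  exists P : R -> L2 mu -> L2 mu,
  [/\ forall (t : R) u, 0 < t -> L2_repr (P t u) = heat_fun mu p t (L2_repr u) %[ae mu],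
      forall t a u v, 0 < t -> P t (a *: u + v) = a *: P t u + P t v,
      forall t u, 0 < t -> nrm (P t u) <= nrm u,
      forall s t u, 0 < s -> 0 < t -> P t (P s u) = P (s + t) u &
      forall t u v, 0 < t -> H (u, v) -> nrm (u - P t u) <= t * nrm v].
Proof.
move=> [_ H0 [d' [Y [nu [h [U [sr expP]]]]]]].
have /choice[P PP] : forall tu : R * L2 mu, exists v, 0 < tu.1 -> heat_op p tu.1 (tu.2, v).
  move=> [t u]; have [t0|t0] := ltP 0 t; last by exists 0.
  by have [v Pv] := exp_total H0 sr expP u (ltW t0); exists v.
have Pt t u (t0 : 0 < t) : heat_op p t (u, P (t, u)) := PP (t, u) t0.
exists (fun t u => P (t, u)); split.
- move=> t u t0; have := Pt t u t0; rewrite /heat_op gt_eqF//.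
- move=> t a u v t0; apply: (exp_functional sr expP (ltW t0) (Pt _ _ t0)).
  by apply: (exp_linear expP (ltW t0)).2; exact: Pt.
- move=> t u t0; exact: (exp_contraction H0 sr expP (ltW t0) (Pt _ _ t0)).
- move=> s t u s0 t0; have st0 : 0 < s + t by rewrite addr_gt0.
  apply: (exp_functional sr expP (ltW st0) _ (Pt _ _ st0)).
  exact: (exp_semigroup expP (ltW s0) (ltW t0) (Pt _ _ s0) (Pt _ _ t0)).
- move=> t u v t0 Hu; exact: (exp_lipschitz H0 sr expP (ltW t0) Hu (Pt _ _ t0)).
Qed.

End heat_semigroup.

(** * Pointwise and Hilbert-Schmidt bounds from the heat kernel *)

Section heat_kernel_bounds.
Context d (T : measurableType d) (R : realType) (mu : {measure set T -> \bar R}).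
Local Notation nrm := (ip_norm (@L2_dot d T R mu)).
Let ip := L2_inner_product mu.
Variables (p : R -> T -> T -> R) (hp : heat_kernel mu p).

Lemma measurable_heat_kernel (t : R) x : 0 < t -> measurable_fun [set: T] (p t x).
Proof.
move=> t0; rewrite (_ : p t x =
    (fun z : R * (T * T) => p z.1 z.2.1 z.2.2) \o (fun y => (t, (x, y))))//.
apply: measurable_comp (heat_kernel_measurable hp) _.
- apply: measurableX => //; rewrite (_ : [set t | 0 < t] = `]0, +oo[%classic)//.
  by apply/seteqP; split => z /=; rewrite in_itv/= andbT.
- by move=> _ [y _ <-].
- by apply: measurable_fun_pair => //; exact: measurable_fun_pair.
Qed.

(** The Riesz representer of the evaluation of [P_t u] at [x], see [heat_funE]. *)
Definition heat_vec (t : R) (x : T) : L2 mu := L2_of mu (fun y => (p t x y)%:C).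

(** The semigroup identity on the diagonal together with symmetry. Both hold at every point, so no
    exceptional null set of [x] appears. *)
Lemma heat_section_sqint (t : R) x : 0 < t -> sqint mu (fun y => (p t x y)%:C) = (p (t + t) x x)%:E.
Proof.
move=> t0; rewrite (heat_kernel_semigroup hp)//; apply: eq_integral => y _.
by rewrite normcR real_normK ?num_real// expr2 (heat_kernel_sym hp y x t0).
Qed.

Lemma heat_section_L2 (t : R) x : 0 < t -> Lp mu 2%:E (fun y => (p t x y)%:C).
Proof.
move=> t0; apply/Lp2P; split; first exact/cmeasurableC/measurable_heat_kernel.
by rewrite heat_section_sqint// ltry.
Qed.

Lemma nrm_heat_vec (t : R) x : 0 < t -> nrm (heat_vec t x) ^+ 2 = p (t + t) x x.
Proof.
by move=> t0; apply: EFin_inj; rewrite sqint_L2_of ?heat_section_sqint//; exact: heat_section_L2.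
Qed.

Lemma heat_funE (t : R) (u : L2 mu) x : 0 < t -> heat_fun mu p t (L2_repr u) x = L2_dot u (heat_vec t x).
Proof.
move=> t0; have := heat_section_L2 x t0 => pL.
rewrite (L2_dot_ae (L2_reprLp u) pL (ae_eq_refl _ _ _) (L2_ofE pL)).
by congr cintegral; apply/funext => y; rewrite conj_RtoC mulrC.
Qed.

Lemma heat_fun_le (t : R) (u : L2 mu) x : 0 < t ->
  normc (heat_fun mu p t (L2_repr u) x) ^+ 2 <= p (t + t) x x * nrm u ^+ 2.
Proof.
move=> t0; rewrite heat_funE// -nrm_heat_vec// mulrC -exprMn ler_pXn2r ?nnegrE ?normc_ge0//.
  exact: CauchySchwarz.
by rewrite mulr_ge0 ?nrm_ge0.
Qed.

(** Bessel's inequality for the representer [heat_vec t x]; integrated against [W^2] it bounds the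
    Hilbert-Schmidt norm of [W P_t]. *)
Lemma heat_fun_bessel (t : R) n (e : 'I_n -> L2 mu) x : 0 < t -> orthonormal (@L2_dot d T R mu) e ->
  \sum_i normc (heat_fun mu p t (L2_repr (e i)) x) ^+ 2 <= p (t + t) x x.
Proof.
move=> t0 oe; rewrite -nrm_heat_vec//; apply: le_trans (Bessel ip _ oe).
by apply: ler_sum => i _; rewrite heat_funE// -(dotJ ip) normc_conj.
Qed.

Variables (F1 : T -> R) (mF1 : measurable_fun [set: T] F1) (F1_gt0 : forall x, 0 < F1 x).

(** Total through the default value of [L2_of]; it is the true product whenever [W] is bounded. *)
Definition wmul (W : T -> R) (u : L2 mu) : L2 mu := L2_of mu (fun x => (W x)%:C * L2_repr u x).

Section bounded_multiplier.
Variables (W : T -> R) (mW : measurable_fun [set: T] W) (K : R).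
Hypothesis (K0 : 0 <= K) (WK : forall x, `|W x| <= K).

Lemma wmul_L2 (u : L2 mu) : Lp mu 2%:E (fun x => (W x)%:C * L2_repr u x).
Proof. by apply: (mul_L2 (c := K)) => //; exact: nearW. Qed.

Lemma wmulE u : L2_repr (wmul W u) = (fun x => (W x)%:C * L2_repr u x) %[ae mu].
Proof. exact: L2_ofE (wmul_L2 u). Qed.

Lemma nrm_wmul u : (nrm (wmul W u) ^+ 2)%:E = sqint mu (fun x => (W x)%:C * L2_repr u x).
Proof. exact: sqint_L2_of (wmul_L2 u). Qed.

Lemma wmul_linear (a : R[i]) u v : wmul W (a *: u + v) = a *: wmul W u + wmul W v.
Proof.
apply: (@mul_op_functional _ _ _ mu W (a *: u + v)); first exact: wmulE.
by apply: (mul_op_linear mu W).2; exact: wmulE.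
Qed.

Lemma wmulB u v : wmul W (u - v) = wmul W u - wmul W v.
Proof. by rewrite addrC -scaleN1r wmul_linear scaleN1r addrC. Qed.

Lemma nrm_wmul_le u : nrm (wmul W u) <= K * nrm u.
Proof.
apply: nrm_le_pointwise => //; apply: filterS (wmulE u) => x -> //.
by rewrite normcM normcR ler_wpM2r ?normc_ge0.
Qed.

(** For orthonormal [e_i], exchanging sum and integral bounds the sum of [|W P_t e_i|^2] by [c]
    times the integral of [W^2 F1], uniformly in the family. *)
Lemma heat_wmul_finite_rank (Pt : L2 mu -> L2 mu) (t c eps : R) : 0 < t -> 0 < eps -> 0 <= c ->
  (forall u, L2_repr (Pt u) = heat_fun mu p t (L2_repr u) %[ae mu]) ->
  (forall a u v, Pt (a *: u + v) = a *: Pt u + Pt v) ->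
  (forall x, p (t + t) x x <= F1 x * c) ->
  (\int[mu]_x (W x ^+ 2 * F1 x)%:E < +oo)%E ->
  exists n (e g : 'I_n -> L2 mu), forall u,
    nrm (wmul W (Pt u) - \sum_i L2_dot u (e i) *: g i) <= eps * nrm u.
Proof.
move=> t0 e0 c0 PtE Ptlin pF WF.
pose I := (\int[mu]_x (W x ^+ 2 * F1 x)%:E)%E.
have I0 : (0 <= I)%E by apply: integral_ge0 => x _; rewrite lee_fin mulr_ge0 ?sqr_ge0// ltW.
have Ifin : I \is a fin_num by rewrite ge0_fin_numE.
apply: (hilbert_schmidt_finite_rank ip (T := fun u => wmul W (Pt u)) (M := c * fine I)) => //.
  by move=> a u v; rewrite Ptlin wmul_linear.
move=> n e oe; rewrite -lee_fin -sumEFin EFinM fineK//.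
under eq_bigr do rewrite nrm_wmul.
rewrite /sqint -ge0_integral_sum//; last 2 first.
- by move=> i; apply: measurable_normc2; exact: measurable_mul_fun.
- by move=> i x _; rewrite lee_fin sqr_ge0.
have mWF : measurable_fun [set: T] (fun x => (W x ^+ 2 * F1 x)%:E).
  by apply/measurable_EFinP/measurable_funM => //; exact: measurable_funX.
rewrite -ge0_integralZl//; last by move=> x _; rewrite lee_fin mulr_ge0 ?sqr_ge0// ltW.
apply: ae_ge0_le_integral => //.
- by move=> x _; apply: sume_ge0 => i _; rewrite lee_fin sqr_ge0.
- apply: emeasurable_sum => i; apply: measurable_normc2; exact: measurable_mul_fun.
- by move=> x _; rewrite mule_ge0// lee_fin mulr_ge0 ?sqr_ge0// ltW.
- exact: emeasurable_funM.
have h : {ae mu, forall x, forall i, L2_repr (Pt (e i)) x = heat_fun mu p t (L2_repr (e i)) x}.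
  by apply: filter_forall => i; apply: filterS (PtE (e i)) => x; apply.
apply: filterS h => x hx _; rewrite sumEFin -EFinM lee_fin.
under eq_bigr do rewrite hx normcM normcR exprMn real_normK ?num_real//.
rewrite -mulr_sumr mulrCA ler_wpM2l ?sqr_ge0// mulrC.
exact: le_trans (heat_fun_bessel x t0 oe) (pF x).
Qed.

End bounded_multiplier.
End heat_kernel_bounds.

(** * The relative bound *)

(** If [lam < w^2], then [w^2 = w^(2q) (w^2)^(1-q)] and the exponent [1 - q] is not positive. With
    [lam] free, this serves in place of the Hoelder inequality. *)
Lemma sqr_le_powR (R : realType) (w lam q : R) : 0 <= w -> 0 < lam -> 1 <= q ->
  w ^+ 2 <= lam + w `^ (2 * q) * lam `^ (1 - q).
Proof.
move=> w0 lam0 q1; have [le1|lt1] := leP (w ^+ 2) lam.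
  by rewrite (le_trans le1)// lerDl mulr_ge0 ?powR_ge0.
apply: (@le_trans _ _ (w `^ (2 * q) * lam `^ (1 - q))); last by rewrite lerDr ltW.
have w2 : 0 < w ^+ 2 by exact: lt_trans lt1.
have -> : w `^ (2 * q) = w ^+ 2 * (w ^+ 2) `^ (q - 1).
  by rewrite mulr_powRB1 ?ltW// ?(lt_le_trans _ q1)// powRrM powR_mulrn.
rewrite -[leLHS]mulr1 -mulrA ler_pM2l// -(opprB q) powRN ler_pdivlMr ?powR_gt0// mul1r.
by apply: ge0_ler_powR; rewrite ?nnegrE ?(ltW lam0) ?(ltW w2) ?(ltW lt1) ?subr_ge0.
Qed.

(* [s_k <= c / 2^{k+1} * G] on the dyadic interval ]2^{-k-1}, 2^-k], of length
   2^{-k-1}: integrating gives [s_k <= c * integral of G] over it. *)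
Lemma dyadic_sum_le (R : realType) (G : R -> R) (D s : nat -> R) (c : R) : 0 <= c ->
  measurable_fun [set t : R | 0 < t] G -> (forall t, 0 < t -> 0 <= G t) ->
  D 0%N <= 0 -> (forall k, D k.+1 <= D k + s k) ->
  (forall k sig, 2 ^- k.+1 < sig <= 2 ^- k -> s k <= c * 2 ^- k.+1 * G sig) ->
  forall k, ((D k)%:E <= c%:E * \int[lebesgue_measure]_(t in `]2 ^- k, 1%R]%classic) (G t)%:E)%E.
Proof.
move=> c0 mG G0 D0 Ds sG.
have p0 k : 0 < 2 ^- k :> R by rewrite invr_gt0 exprn_gt0.
have pos k t : `]2 ^- k, 1%R]%classic t -> 0 < t :> R.
  by rewrite /= in_itv/= => /andP[h _]; exact: lt_trans (p0 k) h.
have mpos : measurable [set t : R | 0 < t].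
  rewrite (_ : [set t | 0 < t] = `]0, +oo[%classic)//.
  by apply/seteqP; split => z /=; rewrite in_itv/= andbT.
have mGE (A : set R) : A `<=` [set t | 0 < t] -> measurable A ->
    measurable_fun A (fun t => (G t)%:E).
  by move=> A0 mA; apply/measurable_EFinP; exact: measurable_funS mG.
have h k : 2 ^- k.+1 * 2 = 2 ^- k :> R.
  by rewrite exprS invfM mulrAC mulVf ?mul1r// pnatr_eq0.
elim=> [|k IH].
  rewrite expr0 invr1 set_itv_ge ?bnd_simp ?ltxx// integral_set0 mule0 lee_fin.
  exact: D0.
have le12 : 2 ^- k.+1 <= 2 ^- k :> R by rewrite -(h k); have := p0 k.+1; lra.
have le1 : 2 ^- k <= 1 :> R by rewrite invf_le1 ?exprn_gt0// exprn_ege1// ler1n.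
have -> : `]2 ^- k.+1, 1%R]%classic = `]2 ^- k.+1, 2 ^- k]%classic `|` `]2 ^- k, 1%R]%classic :> set R.
  by rewrite -itv_bndbnd_setU// bnd_simp.
rewrite ge0_integral_setU//=; last 3 first.
- apply: mGE; last exact: measurableU.
  move=> t [|]; last exact: pos.
  by rewrite /= in_itv/= => /andP[h1 _]; exact: lt_trans (p0 _) h1.
- move=> t [|/pos/G0]; rewrite ?lee_fin//.
  by rewrite /= in_itv/= => /andP[h1 _]; rewrite G0// (lt_trans (p0 k.+1)).
- apply/disj_setPS => t [/=]; rewrite !in_itv/= => /andP[_ h1] /andP[h2 _].
  by move: h2; rewrite ltNge h1.
rewrite ge0_muleDr; last 2 first.
- apply: integral_ge0 => t /=; rewrite in_itv/= => /andP[h1 _].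
  by rewrite lee_fin G0// (lt_trans (p0 k.+1)).
- by apply: integral_ge0 => t /pos/G0; rewrite lee_fin.
rewrite addeC; apply: (@le_trans _ _ ((D k)%:E + (s k)%:E)%E).
  by rewrite -EFinD lee_fin.
apply: leeD => //.
set I := `]_, _]%classic.
have mI : measurable I by exact: measurable_itv.
have I0 t : I t -> 0 < t by rewrite /I/= in_itv/= => /andP[h1 _]; exact: lt_trans (p0 _) h1.
have muI : lebesgue_measure I = (2 ^- k.+1)%:E.
  rewrite lebesgue_measure_itv/= lte_fin ifT; last by rewrite -(h k); have := p0 k.+1; lra.
  by rewrite -EFinB; congr (_%:E); rewrite -(h k); ring.
have [s0|s0] := leP (s k) 0.
  apply: (@le_trans _ _ 0%E); first by rewrite lee_fin.
  by rewrite mule_ge0 ?lee_fin//; apply: integral_ge0 => t /I0/G0; rewrite lee_fin.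
have le2 : ((s k * 2 ^- k.+1)%:E <= (c * 2 ^- k.+1)%:E * \int[lebesgue_measure]_(t in I) (G t)%:E)%E.
  rewrite -ge0_integralZl//; last 3 first.
  - by apply: mGE => // t /I0.
  - by move=> t /I0/G0; rewrite lee_fin.
  - by rewrite lee_fin mulr_ge0// ltW.
  rewrite EFinM -muI -integral_cst//; apply: ge0_le_integral => //.
  - by move=> t _; rewrite /= lee_fin ltW.
  - by apply: emeasurable_funM => //; apply: mGE => // t /I0.
  - by move=> t It; rewrite /= -EFinM lee_fin; apply: sG; move: It; rewrite /I/= in_itv.
rewrite -(@lee_pmul2r _ (2 ^- k.+1)%:E) ?lte_fin// -EFinM.
by rewrite muleAC -EFinM.
Qed.

Section relative_bound.
Context d (T : measurableType d) (R : realType) (mu : {measure set T -> \bar R}).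
Local Notation nrm := (ip_norm (@L2_dot d T R mu)).
Let ip := L2_inner_product mu.
Variables (p : R -> T -> T -> R) (hp : heat_kernel mu p) (H : op mu).
Variable P : R -> L2 mu -> L2 mu.
Hypothesis PE : forall (t : R) u, 0 < t -> L2_repr (P t u) = heat_fun mu p t (L2_repr u) %[ae mu].
Hypothesis Plin : forall (t : R) a u v, 0 < t -> P t (a *: u + v) = a *: P t u + P t v.
Hypothesis Pcontr : forall (t : R) u, 0 < t -> nrm (P t u) <= nrm u.
Hypothesis Psg : forall (s t : R) u, 0 < s -> 0 < t -> P t (P s u) = P (s + t) u.
Hypothesis Plip : forall (t : R) u v, 0 < t -> H (u, v) -> nrm (u - P t u) <= t * nrm v.
Variables (q : R) (q1 : 1 <= q).
Variables (F1 : T -> R) (mF1 : measurable_fun [set: T] F1) (F1_gt0 : forall x, 0 < F1 x).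
Variables (F2 : R -> R) (mF2 : measurable_fun [set t : R | 0 < t] F2).
Hypothesis F2_gt0 : forall t : R, 0 < t -> 0 < F2 t.
Hypothesis control : forall (t : R) x, 0 < t -> p t x x <= F1 x * F2 t.
Hypothesis F2_int : (\int[lebesgue_measure]_(t in [set t : R | (0 < t)%R])
           (expR (- t) * (F2 t `^ (2 * q)^-1))%:E < +oo)%E.

Lemma PB (t : R) u v : 0 < t -> P t (u - v) = P t u - P t v.
Proof. by move=> t0; rewrite addrC -scaleN1r Plin// scaleN1r addrC. Qed.

(** [P tau] is [P (sig / 2)] after a contraction, so only the time [sig / 2] is paid for. No
    monotonicity of [F2] is assumed: the freedom in [sig] is what allows averaging over a dyadic
    interval later. *)
Lemma heat_pointwise (tau sig : R) u : 0 < sig -> sig <= 2 * tau ->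
  {ae mu, forall x, normc (L2_repr (P tau u) x) ^+ 2 <= F1 x * F2 sig * nrm u ^+ 2}.
Proof.
move=> sig0 st.
have base (s : R) w : 0 < s -> {ae mu, forall x,
    normc (L2_repr (P s w) x) ^+ 2 <= F1 x * F2 (s + s) * nrm w ^+ 2}.
  move=> s0; apply: filterS (PE w s0) => x -> //.
  apply: le_trans (heat_fun_le hp w x s0) _; rewrite ler_wpM2r ?sqr_ge0//.
  by apply: control; rewrite addr_gt0.
have s0 : 0 < sig / 2 by lra.
have [lt1|ge1] := ltP (sig / 2) tau.
  have ts : 0 < tau - sig / 2 by lra.
  have e1 : P (sig / 2) (P (tau - sig / 2) u) = P tau u by rewrite Psg// subrK.
  have := base _ (P (tau - sig / 2) u) s0.
  rewrite e1 -(splitr sig); apply: filterS => x /le_trans; apply.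
  rewrite ler_wpM2l//; first by rewrite mulr_ge0// ltW// F2_gt0.
  by rewrite ler_pXn2r ?nnegrE ?nrm_ge0// Pcontr.
have eq1 : sig / 2 = tau by apply/eqP; rewrite eq_le ge1 andbT; lra.
by have := base _ u s0; rewrite -(splitr sig) eq1.
Qed.

Let G (t : R) := F2 t `^ (2 * q)^-1.

Let q0 : 0 < q. Proof. exact: lt_le_trans q1. Qed.

Section bounded.
Variables (W : T -> R) (mW : measurable_fun [set: T] W) (K : R).
Hypothesis (K0 : 0 <= K) (WK : forall x, `|W x| <= K).
Variables (M : R) (M0 : 0 < M).
Hypothesis WM : (\int[mu]_x (`|W x| `^ (2 * q) * F1 x)%:E <= M%:E)%E.

Lemma wmul_heat_le (tau sig : R) u : 0 < sig -> sig <= 2 * tau ->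
  nrm (wmul W (P tau u)) <= Num.sqrt 2 * M `^ (2 * q)^-1 * G sig * nrm u.
Proof.
move=> sig0 st; have F20 := F2_gt0 sig0; have tau0 : 0 < tau by lra.
(* This value balances the two terms of [sqr_le_powR]: [lam^(1-q) F2(sig) M = lam]. The sum is
   [2 lam |u|^2], whence the factor [sqrt 2]. *)
pose lam := (F2 sig * M) `^ q^-1.
have FM : 0 < F2 sig * M by rewrite mulr_gt0.
have lam0 : 0 < lam by rewrite powR_gt0.
have G_ge0 : 0 <= G sig by exact: powR_ge0.
have hq : (2 * q)^-1 = q^-1 * 2^-1 by rewrite invfM mulrC.
have rhs0 : 0 <= Num.sqrt 2 * M `^ (2 * q)^-1 * G sig * nrm u.
  by rewrite !mulr_ge0 ?sqrtr_ge0 ?powR_ge0 ?nrm_ge0.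
rewrite -(ler_pXn2r (ltn0Sn 1)) ?nnegrE ?nrm_ge0//.
have -> : (Num.sqrt 2 * M `^ (2 * q)^-1 * G sig * nrm u) ^+ 2 = 2 * lam * nrm u ^+ 2.
  move: (nrm u) => N; rewrite !exprMn sqr_sqrtr// /G hq !powRrM !powR12_sqrt ?powR_ge0//.
  rewrite !sqr_sqrtr ?powR_ge0//.
  by rewrite /lam powRM ?ltW//; ring.
rewrite -lee_fin (nrm_wmul mW WK).
pose n2 := nrm u ^+ 2; have n20 : 0 <= n2 by exact: sqr_ge0.
pose c1 := lam `^ (1 - q) * F2 sig * n2.
have c10 : 0 <= c1 by rewrite mulr_ge0// mulr_ge0 ?powR_ge0// ltW.
have mWq : measurable_fun [set: T] (fun x => (`|W x| `^ (2 * q) * F1 x)%:E).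
  apply/measurable_EFinP/measurable_funM => //.
  apply: (@measurableT_comp _ _ _ _ _ _ (@powR R ^~ (2 * q))); first exact: measurable_powR.
  exact: measurableT_comp.
have W0 x : 0 <= `|W x| `^ (2 * q) * F1 x by rewrite mulr_ge0 ?powR_ge0// ltW.
have mP : cmeasurable (L2_repr (P tau u)) by [].
apply: (@le_trans _ _ (\int[mu]_x (lam%:E * (normc (L2_repr (P tau u) x) ^+ 2)%:E +
    c1%:E * (`|W x| `^ (2 * q) * F1 x)%:E))%E).
  apply: ae_ge0_le_integral => //.
  - by move=> x _; rewrite lee_fin sqr_ge0.
  - by apply: measurable_normc2; exact: measurable_mul_fun.
  - by move=> x _; rewrite adde_ge0 ?mule_ge0 ?lee_fin ?sqr_ge0// ltW.
  - by apply: emeasurable_funD; apply: emeasurable_funM => //; exact: measurable_normc2.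
  apply: filterS (heat_pointwise u sig0 st) => x hx _.
  rewrite -!EFinM -EFinD lee_fin normcM normcR exprMn.
  have := sqr_le_powR (normr_ge0 (W x)) lam0 q1.
  move=> /(ler_wpM2r (sqr_ge0 (normc (L2_repr (P tau u) x)))) /le_trans; apply.
  rewrite mulrDl lerD2l /c1.
  have := ler_wpM2l (mulr_ge0 (powR_ge0 `|W x| (2 * q)) (powR_ge0 lam (1 - q))) hx.
  by move=> /le_trans; apply; rewrite -/n2 le_eqVlt; apply/orP; left; apply/eqP; ring.
have lam0' : (0 <= lam%:E)%E by rewrite lee_fin ltW.
have c10' : (0 <= c1%:E)%E by rewrite lee_fin.
have g0 x : (0 <= (normc (L2_repr (P tau u) x) ^+ 2)%:E)%E by rewrite lee_fin sqr_ge0.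
have W0' x : (0 <= (`|W x| `^ (2 * q) * F1 x)%:E)%E by rewrite lee_fin.
have mg := measurable_normc2 mP.
rewrite ge0_integralD//; [|by move=> x _; exact: mule_ge0|exact: emeasurable_funM|
  by move=> x _; exact: mule_ge0|exact: emeasurable_funM].
rewrite !ge0_integralZl//.
apply: (@le_trans _ _ (lam%:E * n2%:E + c1%:E * M%:E)%E).
  apply: leeD; last by rewrite lee_wpmul2l.
  rewrite lee_wpmul2l ?lee_fin ?(ltW lam0)// -[X in (X <= _)%E]/(sqint mu _) sqint_nrm lee_fin.
  by rewrite ler_pXn2r ?nnegrE ?nrm_ge0// Pcontr.
rewrite -!EFinM -EFinD lee_fin /c1 -/n2.
have -> : lam `^ (1 - q) * F2 sig * n2 * M = lam * n2; last by lra.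
have -> : lam `^ (1 - q) * F2 sig * n2 * M = lam `^ (1 - q) * (F2 sig * M) * n2 by ring.
have -> : F2 sig * M = lam `^ q by rewrite /lam -powRrM mulVf ?gt_eqF// powRr1// ltW.
by rewrite -powRD ?subrK ?powRr1 ?ltW// gt_eqF//= implybT.
Qed.

Lemma wmulD (u v : L2 mu) : wmul W (u + v) = wmul W u + wmul W v.
Proof. by have := wmul_linear mW WK 1 u v; rewrite !scale1r. Qed.

End bounded.

Lemma measurable_pos : measurable [set t : R | 0 < t].
Proof.
rewrite (_ : [set t | 0 < t] = `]0, +oo[%classic)//.
by apply/seteqP; split => z /=; rewrite in_itv/= andbT.
Qed.

Lemma measurable_G : measurable_fun [set t : R | 0 < t] G.
Proof.
apply: (@measurable_comp _ _ _ _ _ _ [set: R] (@powR R ^~ (2 * q)^-1)) => //.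
Qed.

Definition dyadic_constant : R :=
  fine (\int[lebesgue_measure]_(t in `]0%R, 1%R]%classic) (G t)%:E)%E.

(** On []0, 1]] one has [1 <= exp (1 - t)], so the integrability of the control function makes the
    integral defining [dyadic_constant] finite and [fine] loses nothing. *)
Lemma dyadic_constantP (k : nat) :
  (\int[lebesgue_measure]_(t in `](2 ^- k)%R, 1%R]%classic) (G t)%:E <= dyadic_constant%:E)%E.
Proof.
have sub (a : R) : 0 <= a -> `]a, 1%R]%classic `<=` [set t : R | 0 < t].
  by move=> a0 t /=; rewrite in_itv/= => /andP[at_ _]; exact: le_lt_trans at_.
have mGE (A : set R) : A `<=` [set t | 0 < t] -> measurable A ->
    measurable_fun A (fun t => (G t)%:E).
  move=> A0 mA; apply/measurable_EFinP; apply: measurable_funS measurable_G => //.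
  exact: measurable_pos.
have fin : (\int[lebesgue_measure]_(t in `]0%R, 1%R]%classic) (G t)%:E < +oo)%E.
  apply: (@le_lt_trans _ _ ((expR 1)%:E * \int[lebesgue_measure]_(t in [set t : R | (0 < t)%R])
           (expR (- t) * (F2 t `^ (2 * q)^-1))%:E)%E); last first.
    by rewrite lte_mul_pinfty ?lee_fin ?expR_ge0.
  have mE : measurable_fun [set t : R | 0 < t] (fun t => (expR (- t) * (F2 t `^ (2 * q)^-1))%:E).
    apply/measurable_EFinP/measurable_funM; last exact: measurable_G.
    by apply: measurable_funTS; apply: measurableT_comp => //; exact: measurableT_comp.
  rewrite -ge0_integralZl//; first last.
  - by move=> t _; rewrite lee_fin mulr_ge0 ?expR_ge0 ?powR_ge0.
  - exact: measurable_pos.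
  apply: (@le_trans _ _ (\int[lebesgue_measure]_(t in `]0%R, 1%R]%classic)
      ((expR 1)%:E * (expR (- t) * (F2 t `^ (2 * q)^-1))%:E))%E).
    apply: ge0_le_integral => //.
    - by move=> t _; rewrite lee_fin powR_ge0.
    - by apply: mGE => //; exact: sub.
    - apply: emeasurable_funM => //; apply: measurable_funS mE; first exact: measurable_pos.
      exact: sub.
    move=> t /=; rewrite in_itv/= => /andP[_ t1].
    rewrite -EFinM lee_fin mulrA -expRD -[leLHS]mul1r ler_wpM2r ?powR_ge0//.
    by rewrite -[leLHS]expR0 ler_expR subr_ge0.
  apply: ge0_subset_integral => //.
  - exact: measurable_pos.
  - exact: emeasurable_funM.
  - by move=> t _; rewrite mule_ge0 ?lee_fin ?expR_ge0// mulr_ge0 ?expR_ge0 ?powR_ge0.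
  - exact: sub.
rewrite /dyadic_constant fineK; last first.
  by rewrite ge0_fin_numE//; apply: integral_ge0 => t _; rewrite lee_fin powR_ge0.
apply: ge0_subset_integral => //.
- by apply: mGE => //; exact: sub.
- by move=> t _; rewrite lee_fin powR_ge0.
- move=> t /=; rewrite !in_itv/= => /andP[t0 ->]; rewrite andbT.
  by apply: lt_trans t0; rewrite invr_gt0 exprn_gt0.
Qed.

(** [sqrt 2] comes from [wmul_heat_le], [G 1] from [P 1 u], and [dyadic_constant] from the dyadic
    increments. *)
Definition graph_constant : R := Num.sqrt 2 * (G 1 + dyadic_constant).

Lemma graph_constant_ge0 : 0 <= graph_constant.
Proof.
rewrite mulr_ge0 ?sqrtr_ge0// addr_ge0 ?powR_ge0// fine_ge0//.
by apply: integral_ge0 => t _; rewrite lee_fin powR_ge0.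
Qed.

(* [u] is written as [P_1 u] plus the sum of [P_s (u - P_s u)], [s = 2^{-k-1}],
   plus a remainder; the lengths of the dyadic intervals come from
   [|u - P_s u| <= s |H u|]. *)
Lemma wmul_graph_bound (W : T -> R) (K M : R) u v : measurable_fun [set: T] W ->
  0 <= K -> (forall x, `|W x| <= K) -> 0 < M ->
  (\int[mu]_x (`|W x| `^ (2 * q) * F1 x)%:E <= M%:E)%E -> H (u, v) ->
  nrm (wmul W u) <= graph_constant * M `^ (2 * q)^-1 * (nrm u + nrm v).
Proof.
move=> mW K0 WK M0 WM Huv.
pose a : R := Num.sqrt 2 * M `^ (2 * q)^-1.
have a0 : 0 <= a by rewrite mulr_ge0 ?sqrtr_ge0 ?powR_ge0.
have heat_le := wmul_heat_le mW WK M0 WM.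
have p0 k : 0 < 2 ^- k :> R by rewrite invr_gt0 exprn_gt0.
have dbl k : 2 ^- k.+1 + 2 ^- k.+1 = 2 ^- k :> R.
  have h : 2 ^- k.+1 * 2 = 2 ^- k :> R by rewrite exprS invfM mulrAC mulVf ?mul1r// pnatr_eq0.
  by rewrite -h; ring.
pose D k : R := nrm (wmul W (P (2 ^- k) u - P 1 u)).
pose s k : R := nrm (wmul W (P (2 ^- k.+1) (u - P (2 ^- k.+1) u))).
have c0 : 0 <= a * nrm v by rewrite mulr_ge0 ?nrm_ge0.
have D0 : D 0%N <= 0.
  rewrite /D expr0 invr1 subrr; apply: le_trans (nrm_wmul_le mW K0 WK _) _.
  by rewrite nrm0// mulr0.
have Ds k : D k.+1 <= D k + s k.
  rewrite /D /s; have -> : P (2 ^- k.+1) u - P 1 u =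
      (P (2 ^- k) u - P 1 u) + P (2 ^- k.+1) (u - P (2 ^- k.+1) u).
    by rewrite PB// Psg// dbl [RHS]addrC subrKA.
  by rewrite (wmulD mW WK) nrmD.
have sG k sig : 2 ^- k.+1 < sig <= 2 ^- k -> s k <= a * nrm v * 2 ^- k.+1 * G sig.
  move=> /andP[s1 s2]; apply: le_trans (heat_le _ sig _ _ _) _.
  - exact: lt_trans (p0 _) s1.
  - by rewrite mulr_natl mulr2n dbl.
  have h := Plip (p0 k.+1) Huv.
  have : a * G sig * nrm (u - P (2 ^- k.+1) u) <= a * G sig * (2 ^- k.+1 * nrm v).
    by rewrite ler_wpM2l// mulr_ge0// powR_ge0.
  rewrite -/a => /le_trans; apply.
  by rewrite le_eqVlt; apply/orP; left; apply/eqP; ring.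
have Dle k : D k <= a * nrm v * dyadic_constant.
  rewrite -lee_fin; apply: le_trans (dyadic_sum_le c0 measurable_G _ D0 Ds sG k) _.
    by move=> t _; exact: powR_ge0.
  rewrite [leRHS]EFinM; apply: lee_wpmul2l; [by rewrite lee_fin|exact: dyadic_constantP].
(* Only the remainder involves the sup bound [K], and it tends to 0 as [k] grows; this is why [K] is
   absent from the conclusion. *)
have main k : nrm (wmul W u) <=
    K * (2 ^- k * nrm v) + (a * nrm v * dyadic_constant + a * G 1 * nrm u).
  have -> : wmul W u = wmul W (u - P (2 ^- k) u) +
      (wmul W (P (2 ^- k) u - P 1 u) + wmul W (P 1 u)).
    by rewrite -!(wmulD mW WK) !subrK.
  have h1 : nrm (wmul W (P 1 u)) <= a * G 1 * nrm u by apply: heat_le; lra.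
  have h2 : nrm (wmul W (u - P (2 ^- k) u)) <= K * (2 ^- k * nrm v).
    by apply: le_trans (nrm_wmul_le mW K0 WK _) _; rewrite ler_wpM2l// Plip.
  apply: le_trans (nrmD ip _ _) (lerD h2 _).
  exact: le_trans (nrmD ip _ _) (lerD (Dle k) h1).
have main' : nrm (wmul W u) <= a * nrm v * dyadic_constant + a * G 1 * nrm u.
  apply: ler_eps => e e0.
  have c1 : 0 < K * nrm v + 1 by rewrite ltr_wpDl// mulr_ge0 ?nrm_ge0.
  have [k kP] := half_pow_le (divr_gt0 e0 c1).
  apply: le_trans (main k) _; rewrite addrC lerD2l mulrCA.
  move: kP; rewrite ler_pdivlMr// => /(le_trans _); apply.
  by rewrite ler_pM2l// lerDl.
apply: le_trans main' _; rewrite /graph_constant.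
have -> : Num.sqrt 2 * (G 1 + dyadic_constant) * M `^ (2 * q)^-1 * (nrm u + nrm v) =
   a * (G 1 + dyadic_constant) * (nrm u + nrm v) by rewrite /a; ring.
have J0 : 0 <= dyadic_constant.
  by rewrite fine_ge0//; apply: integral_ge0 => t _; rewrite lee_fin powR_ge0.
have : 0 <= a * G 1 * nrm v by rewrite mulr_ge0 ?nrm_ge0// mulr_ge0// powR_ge0.
have : 0 <= a * dyadic_constant * nrm u by rewrite mulr_ge0 ?nrm_ge0// mulr_ge0.
lra.
Qed.

(** [W] is truncated to [|W| <= k]; the bound for the truncations is uniform in [k], so monotone
    convergence applies. Stated with [sqint] because it is what shows that [W u] is in L^2. *)
Lemma mul_graph_bound (W : T -> R) (M : R) u v : measurable_fun [set: T] W -> 0 < M ->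
  (\int[mu]_x (`|W x| `^ (2 * q) * F1 x)%:E <= M%:E)%E -> H (u, v) ->
  (sqint mu (fun x => ((W x)%:C * L2_repr u x)%R) <=
    ((graph_constant * M `^ (2 * q)^-1 * (nrm u + nrm v)) ^+ 2)%:E)%E.
Proof.
move=> mW M0 WM Huv.
set B := graph_constant * _ * _.
pose A k := [set x | `|W x| <= k%:R].
have mA k : measurable (A k).
  have mnW : measurable_fun [set: T] (fun x => `|W x|) by exact: measurableT_comp.
  rewrite -[A k]setTI (_ : A k = (fun x => `|W x|) @^-1` `]-oo, k%:R]%classic); first exact: mnW.
  by apply/seteqP; split => x; rewrite /A/= in_itv.
pose Wk k x : R := W x * \1_(A k) x.
have mWk k : measurable_fun [set: T] (Wk k).
  by apply: measurable_funM => //; exact: measurable_indic.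
have WkE k x : A k x -> Wk k x = W x by move=> Ax; rewrite /Wk indicE mem_set// mulr1.
have Wk0 k x : ~ A k x -> Wk k x = 0 by move=> Ax; rewrite /Wk indicE memNset// mulr0.
have WkK k x : `|Wk k x| <= k%:R.
  by have [Ax|nAx] := pselect (A k x); [rewrite WkE|rewrite Wk0// normr0].
have WkW k x : `|Wk k x| <= `|W x|.
  by have [Ax|nAx] := pselect (A k x); [rewrite WkE|rewrite Wk0// normr0].
have mq (V : T -> R) : measurable_fun [set: T] V ->
    measurable_fun [set: T] (fun x => (`|V x| `^ (2 * q) * F1 x)%:E).
  move=> mV; apply/measurable_EFinP/measurable_funM => //.
  apply: (@measurableT_comp _ _ _ _ _ _ (@powR R ^~ (2 * q))); first exact: measurable_powR.
  exact: measurableT_comp.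
have le_k k : (sqint mu (fun x => ((Wk k x)%:C * L2_repr u x)%R) <= (B ^+ 2)%:E)%E.
  rewrite -(nrm_wmul (mWk k) (WkK k)) lee_fin ler_pXn2r ?nnegrE ?nrm_ge0//; last first.
    rewrite /B mulr_ge0 ?addr_ge0 ?nrm_ge0// mulr_ge0 ?powR_ge0//; exact: graph_constant_ge0.
  have k0 : 0 <= k%:R :> R by rewrite ler0n.
  suff WkM : (\int[mu]_x (`|Wk k x| `^ (2 * q) * F1 x)%:E <= M%:E)%E.
    exact: (wmul_graph_bound (mWk k) k0 (WkK k) M0 WkM Huv).
  apply: le_trans WM; apply: ge0_le_integral => //.
  - by move=> x _; rewrite lee_fin mulr_ge0 ?powR_ge0// ltW.
  - exact: mq.
  - exact: mq.
  - move=> x _; rewrite lee_fin ler_wpM2r ?(ltW (F1_gt0 x))//.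
    apply: ge0_ler_powR; rewrite ?nnegrE ?normr_ge0//.
    by rewrite mulr_ge0// ltW.
pose f k x := (normc ((Wk k x)%:C * L2_repr u x) ^+ 2)%:E.
have mf k : measurable_fun [set: T] (f k) by apply: measurable_normc2; exact: measurable_mul_fun.
have f0 k x : (0 <= f k x)%E by rewrite lee_fin sqr_ge0.
have ndf x : nondecreasing_seq (f^~ x).
  move=> k l kl; rewrite lee_fin !normcM !normcR ler_pXn2r ?nnegrE ?mulr_ge0 ?normc_ge0//.
  rewrite ler_wpM2r ?normc_ge0//; have [Ax|nAx] := pselect (A k x); last by rewrite Wk0// normr0.
  by rewrite WkE// WkE//; apply: le_trans Ax _; rewrite ler_nat.
have limf x : limn (f^~ x) = (normc ((W x)%:C * L2_repr u x) ^+ 2)%:E.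
  apply/cvg_lim => //; apply: cvg_near_cst.
  exists (Num.truncn `|W x|).+1 => // k /= kN; rewrite /f WkE//.
  by apply/ltW/(lt_le_trans (truncnS_gt _)); rewrite ler_nat.
rewrite /sqint; under eq_integral do rewrite -limf.
rewrite (@monotone_convergence _ _ _ mu _ measurableT f) //.
apply: lime_le; last by apply: nearW => k; exact: le_k.
apply: ereal_nondecreasing_is_cvgn => k l kl; apply: ge0_le_integral => //.
by move=> x _; exact: ndf.
Qed.

End relative_bound.

(** * Integration against a measure with density *)

Section density.
Import HBNNSimple.
Context d (T : measurableType d) (R : realType) (mu : {measure set T -> \bar R}).
Variables (F : T -> R) (mF : measurable_fun [set: T] F) (F0 : forall x, 0 < F x).
Local Open Scope ereal_scope.

(** For indicators this is the definition of [mdensity]; simple functions and monotone convergence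
    do the rest. *)
Lemma integral_mdensity (f : T -> \bar R) : (forall x, 0 <= f x) ->
  measurable_fun [set: T] f ->
  \int[mdensity mu mF F0]_x f x = \int[mu]_x (f x * (F x)%:E).
Proof.
move=> f0 mf; set nu := mdensity mu mF F0.
have F0' x : 0 <= (F x)%:E by rewrite lee_fin ltW.
have mF' : measurable_fun [set: T] (EFin \o F) by exact/measurable_EFinP.
pose h := nnsfun_approx measurableT mf.
have mh n : measurable_fun [set: T] (fun x => (h n x)%:E) by exact/measurable_EFinP.
have ndh x : nondecreasing_seq (fun n => (h n x)%:E).
  by move=> a b ab; rewrite lee_fin; exact/lefP/nd_nnsfun_approx.
have hf x : (h n x)%:E @[n --> \oo] --> f x by exact: cvg_nnsfun_approx.
have -> : \int[nu]_x f x = lim (\int[nu]_x (h n x)%:E @[n --> \oo]).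
  under eq_integral do rewrite -(cvg_lim _ (hf _))//.
  by apply: monotone_convergence => // n x _; rewrite lee_fin.
have -> : \int[mu]_x (f x * (F x)%:E) = lim (\int[mu]_x ((h n x)%:E * (F x)%:E) @[n --> \oo]).
  have hfF x : (h n x)%:E * (F x)%:E @[n --> \oo] --> f x * (F x)%:E by exact: cvgeZr.
  under eq_integral do rewrite -(cvg_lim _ (hfF _))//.
  apply: monotone_convergence => //.
  - by move=> n; exact: emeasurable_funM.
  - by move=> n x _; rewrite mule_ge0// lee_fin.
  - by move=> x _ a b ab; rewrite lee_wpmul2r//; exact: ndh.
congr (lim _); congr (_ @ \oo); apply/funext => n.
have mi y : measurable (h n @^-1` [set y]) by [].
have indich y : measurable_fun [set: T] (fun x => (y * \1_(h n @^-1` [set y]) x)%:E).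
  by apply/measurable_EFinP/measurable_funM => //; exact: measurable_indic.
transitivity (\int[nu]_x (\sum_(y \in range (h n)) (y * \1_(h n @^-1` [set y]) x)%:E)).
  by apply: eq_integral => t _; rewrite fimfunE -fsumEFin.
rewrite ge0_integral_fsum//; last by move=> m y Ey; exact: nnfun_muleindic_ge0.
transitivity (\int[mu]_x
    (\sum_(y \in range (h n)) (y * \1_(h n @^-1` [set y]) x)%:E * (F x)%:E)); last first.
  apply: eq_integral => x _.
  rewrite -ge0_mule_fsuml => [|y]; last exact: nnfun_muleindic_ge0.
  by rewrite fsumEFin// -(fimfunE _ x).
rewrite ge0_integral_fsum//; last 2 first.
- by move=> y; exact: emeasurable_funM.
- by move=> m y Ey; rewrite mule_ge0// nnfun_muleindic_ge0.
apply: eq_fsbigr => y yh.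
have y0 : (0 <= y)%R by move: yh => /set_mem[x _ <-].
have y0e : 0 <= y%:E by rewrite lee_fin.
have im : measurable_fun [set: T] (fun x => (\1_(h n @^-1` [set y]) x : R)%:E).
  by apply/measurable_EFinP; exact: measurable_indic.
have imF : measurable_fun [set: T] (fun x => (\1_(h n @^-1` [set y]) x : R)%:E * (F x)%:E).
  exact: emeasurable_funM.
have i0 x : 0 <= (\1_(h n @^-1` [set y]) x : R)%:E by rewrite lee_fin.
have iF0 x : 0 <= (\1_(h n @^-1` [set y]) x : R)%:E * (F x)%:E by rewrite mule_ge0.
under eq_integral do rewrite EFinM.
under [RHS]eq_integral do rewrite EFinM -muleA.
rewrite !ge0_integralZl//.
congr (_ * _); rewrite integral_indic// setIT /nu.
rewrite /= /mdensity integral_mkcond; apply: eq_integral => x _.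
rewrite patchE indicE; case: ifPn => _; first by rewrite mul1e.
by rewrite mul0e.
Qed.

End density.

(** * Splitting the potential *)

Section cut.
Context d (T : measurableType d) (R : realType).
Implicit Types (I : set R) (w : T -> R).

(** [I] restricts the size [|w x|], not the point: a partition of the sizes splits the function. *)
Definition cut I w (x : T) : R := w x * \1_I `|w x|.

Lemma measurable_cut I w : measurable I -> measurable_fun [set: T] w ->
  measurable_fun [set: T] (cut I w).
Proof.
move=> mI mw; apply: measurable_funM => //.
apply: (@measurableT_comp _ _ _ _ _ _ (\1_I : R -> R)); first exact: measurable_indic.
exact: measurableT_comp.
Qed.

Lemma cut_in I w x : I `|w x| -> cut I w x = w x.
Proof. by move=> Iw; rewrite /cut indicE mem_set// mulr1. Qed.

Lemma cut_out I w x : ~ I `|w x| -> cut I w x = 0.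
Proof. by move=> Iw; rewrite /cut indicE memNset// mulr0. Qed.

Lemma cut_le_norm I w x : `|cut I w x| <= `|w x|.
Proof.
by have [Iw|nIw] := pselect (I `|w x|); [rewrite cut_in|rewrite cut_out// normr0].
Qed.

Lemma cut_le I w x (b : R) : 0 <= b -> (forall r, I r -> r <= b) -> `|cut I w x| <= b.
Proof.
move=> b0 Ib; have [Iw|nIw] := pselect (I `|w x|); first by rewrite cut_in// Ib.
by rewrite cut_out// normr0.
Qed.

Lemma cut_split w x (c b : R) : c <= b ->
  cut `]b, +oo[%classic w x + cut `]-oo, c[%classic w x + cut `[c, b]%classic w x = w x.
Proof.
move=> cb; have [lt1|le1] := ltP b `|w x|.
  rewrite cut_in /= ?in_itv/= ?lt1//.
  rewrite cut_out ?cut_out ?addr0//= in_itv/=.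
    by move=> /andP[_]; rewrite leNgt lt1.
  by move=> h; have := lt_trans h (le_lt_trans cb lt1); rewrite ltxx.
rewrite cut_out ?add0r/=; last by rewrite in_itv/= andbT ltNge le1.
have [lt2|le2] := ltP `|w x| c.
  rewrite cut_in/= ?in_itv// cut_out ?addr0//= in_itv/= => /andP[h _].
  by move: lt2; rewrite ltNge h.
rewrite cut_out/= ?add0r; last by rewrite in_itv/= ltNge le2.
by rewrite cut_in//= in_itv/= le2 le1.
Qed.

End cut.

Section potential.
Context d (T : measurableType d) (R : realType) (mu : {measure set T -> \bar R}).
Local Notation nrm := (ip_norm (@L2_dot d T R mu)).
Let ip := L2_inner_product mu.
Variables (p : R -> T -> T -> R) (hp : heat_kernel mu p) (H : op mu) (hH : heat_generator p H).
Variables (q : R) (q1 : 1 <= q).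
Variables (F1 : T -> R) (mF1 : measurable_fun [set: T] F1) (F1_gt0 : forall x, 0 < F1 x).
Hypothesis control : control_function p q F1.
Variables (v1 v2 V : T -> R).
Hypothesis mv1 : measurable_fun [set: T] v1.
Hypothesis mv2 : measurable_fun [set: T] v2.
Hypothesis int_v1 : (\int[mu]_x (`|v1 x| `^ (2 * q) * F1 x)%:E < +oo)%E.
Hypothesis lev_v2 : forall c : R, 0 < c ->
  (\int[mu]_(x in [set x | (c <= `|v2 x|)%R]) (F1 x)%:E < +oo)%E.
Variables (K2 : R).
Hypothesis bd_v2 : {ae mu, forall x, `|v2 x| <= K2}.
Hypothesis VE : {ae mu, forall x, V x = v1 x + v2 x}.

Let q0 : 0 < q. Proof. exact: lt_le_trans q1. Qed.

Lemma measurable_powR2q (w : T -> R) : measurable_fun [set: T] w ->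
  measurable_fun [set: T] (fun x => (`|w x| `^ (2 * q) * F1 x)%:E).
Proof.
move=> mw; apply/measurable_EFinP/measurable_funM => //.
apply: (@measurableT_comp _ _ _ _ _ _ (@powR R ^~ (2 * q))); first exact: measurable_powR.
exact: measurableT_comp.
Qed.

(** Dominated convergence with the integrand of [int_v1] as majorant: at each point the cut is
    eventually 0. *)
Lemma tail_small (M : R) : 0 < M -> exists N, forall n, (N <= n)%N ->
  (\int[mu]_x (`|cut `]n%:R, +oo[%classic v1 x| `^ (2 * q) * F1 x)%:E <= M%:E)%E.
Proof.
move=> M0; pose f n x := (`|cut `](n%:R : R), +oo[%classic v1 x| `^ (2 * q) * F1 x)%:E.
have f0 n x : (0 <= f n x)%E by rewrite lee_fin mulr_ge0 ?powR_ge0// ltW.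
have mf n : measurable_fun [set: T] (f n) by apply: measurable_powR2q; exact: measurable_cut.
have [] := @dominated_convergence _ T R mu _ measurableT f (cst 0%E)
  (fun x => (`|v1 x| `^ (2 * q) * F1 x)%:E).
- exact: mf.
- exact: measurable_cst.
- apply: nearW => x _; apply: cvg_near_cst.
  exists (Num.truncn `|v1 x|).+1 => // n /= nN; rewrite /f cut_out ?normr0.
    by rewrite powR0 ?mul0r// mulf_neq0 ?gt_eqF.
  rewrite /= in_itv/= andbT => h; have := lt_trans h (truncnS_gt `|v1 x|).
  by rewrite ltr_nat ltnNge nN.
- apply/integrableP; split; first exact: measurable_powR2q.
  apply: le_lt_trans int_v1; rewrite le_eqVlt; apply/orP; left; apply/eqP/eq_integral => x _.
  by rewrite /= ger0_norm// mulr_ge0 ?powR_ge0// ltW.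
- apply: nearW => x n _; rewrite gee0_abs//= lee_fin ler_wpM2r ?(ltW (F1_gt0 x))//.
  apply: ge0_ler_powR; rewrite ?nnegrE ?normr_ge0 ?cut_le_norm//.
  by rewrite mulr_ge0// ltW.
move=> _ _; rewrite integral_cst//= mul0e => fcvg.
have /fcvg : nbhs (0%E : \bar R) [set y | (y < M%:E)%E].
  by apply: open_nbhs_nbhs; split; [exact: open_ereal_lt_ereal|rewrite /= lte_fin].
by move=> [N _ NP]; exists N => n /NP /ltW.
Qed.

(** Both pieces are at most [b] and at least [c] where nonzero. For [v1] this gives
    [v1^2 <= b^2 c^(-2q) |v1|^(2q)], for [v2] a multiple of the indicator of [c <= |v2|]; the factor
    2 in [k1] and [k2] separates the square of the sum. *)
Lemma middle_integrable (c b : R) : 0 < c -> 0 <= b ->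
  (\int[mu]_x ((cut `[c, b]%classic v1 x + cut `[c, b]%classic v2 x) ^+ 2 * F1 x)%:E < +oo)%E.
Proof.
move=> c0 b0.
pose A := [set x | c <= `|v2 x|].
have mA : measurable A.
  have mnv : measurable_fun [set: T] (fun x => `|v2 x|) by exact: measurableT_comp.
  rewrite -[A]setTI (_ : A = (fun x => `|v2 x|) @^-1` `[c, +oo[%classic); first exact: mnv.
  by apply/seteqP; split => x; rewrite /A/= in_itv/= andbT.
pose k1 : R := 2 * b ^+ 2 * c `^ (- (2 * q)); pose k2 : R := 2 * b ^+ 2.
have k10 : 0 <= k1 by rewrite mulr_ge0 ?powR_ge0// mulr_ge0 ?sqr_ge0.
have k20 : 0 <= k2 by rewrite mulr_ge0 ?sqr_ge0.
have k10' : (0 <= k1%:E)%E by rewrite lee_fin.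
have k20' : (0 <= k2%:E)%E by rewrite lee_fin.
pose g1 x := (`|v1 x| `^ (2 * q) * F1 x)%:E.
pose g2 x : \bar R := ((fun x => (F1 x)%:E) \_ A) x.
have mg1 : measurable_fun [set: T] g1 by exact: measurable_powR2q.
have mg2 : measurable_fun [set: T] g2.
  have mA1 : measurable_fun A (EFin \o F1) by apply: measurable_funTS; exact/measurable_EFinP.
  exact: (measurable_restrictT (EFin \o F1) mA).1 mA1.
have g10 x : (0 <= g1 x)%E by rewrite lee_fin mulr_ge0 ?powR_ge0// ltW.
have g20 x : (0 <= g2 x)%E by rewrite /g2 patchE; case: ifPn => // _; rewrite lee_fin ltW.
apply: (@le_lt_trans _ _ (\int[mu]_x (k1%:E * g1 x + k2%:E * g2 x))%E); last first.
  rewrite ge0_integralD//; [|by move=> x _; exact: mule_ge0|exact: emeasurable_funM|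
    by move=> x _; exact: mule_ge0|exact: emeasurable_funM].
  rewrite !ge0_integralZl// lte_add_pinfty// lte_mul_pinfty//.
  by rewrite /g2 -integral_mkcond; exact: lev_v2.
apply: ge0_le_integral => //.
- by move=> x _; rewrite lee_fin mulr_ge0 ?sqr_ge0// ltW.
- apply/measurable_EFinP/measurable_funM => //; apply: measurable_funX.
  by apply: measurable_funD; exact: measurable_cut.
- by apply: emeasurable_funD; exact: emeasurable_funM.
move=> x _; set z1 := cut _ v1 x; set z2 := cut _ v2 x.
have F10 := ltW (F1_gt0 x).
have h1 : z1 ^+ 2 <= b ^+ 2 * c `^ (- (2 * q)) * `|v1 x| `^ (2 * q).
  rewrite /z1; have [Iv|nIv] := pselect (`[c, b]%classic `|v1 x|); last first.
    by rewrite cut_out// expr0n/= mulr_ge0 ?powR_ge0// mulr_ge0 ?sqr_ge0 ?powR_ge0.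
  rewrite cut_in//; move: Iv; rewrite /= in_itv/= => /andP[cv vb].
  have e1 : v1 x ^+ 2 <= b ^+ 2 by rewrite -real_normK ?num_real// ler_pXn2r// nnegrE.
  apply: le_trans e1 _; rewrite -mulrA -[leLHS]mulr1 ler_wpM2l ?sqr_ge0//.
  rewrite powRN mulrC ler_pdivlMr ?powR_gt0// mul1r.
  by apply: ge0_ler_powR; rewrite ?nnegrE ?(ltW c0)// mulr_ge0// ltW.
have h2 : ((z2 ^+ 2 * F1 x)%:E <= (b ^+ 2)%:E * g2 x)%E.
  rewrite /z2 /g2 patchE; have [Iv|nIv] := pselect (`[c, b]%classic `|v2 x|); last first.
    by rewrite cut_out// expr0n/= mul0r mule_ge0 ?lee_fin ?sqr_ge0//; case: ifPn.
  rewrite cut_in//; move: Iv; rewrite /= in_itv/= => /andP[cv vb].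
  rewrite mem_set// -EFinM lee_fin; apply: ler_wpM2r => //.
  by rewrite -real_normK ?num_real// ler_pXn2r// nnegrE.
apply: (@le_trans _ _ ((2 * z1 ^+ 2 * F1 x)%:E + (2 * (z2 ^+ 2 * F1 x))%:E)%E).
  rewrite -EFinD lee_fin; have := sqr_ge0 (z1 - z2); move: F10; move: (F1 x) => F; nra.
apply: leeD.
  rewrite /g1 -EFinM lee_fin [leRHS]mulrA; apply: (ler_wpM2r F10).
  rewrite /k1 -[leRHS]mulrA -[leRHS]mulrA; apply: ler_wpM2l => //.
  by rewrite mulrA.
rewrite EFinM /k2 (EFinM 2 (b ^+ 2)) -muleA; apply: lee_wpmul2l => //.
Qed.

(* The middle part [W] of [V] is bounded with [W^2 F1] integrable, and the rest
   is relatively small: a large tail of [v1] by the dyadic estimate, and the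
   values below [c] trivially. *)
Lemma potential_split (eps : R) : 0 < eps -> exists (W : T -> R) (K : R),
  [/\ measurable_fun [set: T] W, 0 <= K, forall x, `|W x| <= K,
      (\int[mu]_x (W x ^+ 2 * F1 x)%:E < +oo)%E &
      forall u v, H (u, v) -> exists2 y, nrm y <= eps * (nrm u + nrm v) &
        mul_op mu V (u, y + wmul W u)].
Proof.
move=> e0.
have [P [PE Plin Pcontr Psg Plip]] := heat_semigroup hH.
have [_ _ [F2 [mF2 F2_gt0 ctrl F2_int]]] := control.
(* The small parts of [v1] and [v2] are each at most [c], so [|S2| <= eps / 2]. *)
pose c : R := eps / 4.
have c0 : 0 < c by rewrite divr_gt0.
pose C0 := graph_constant q F2.
have C00 : 0 <= C0 by exact: graph_constant_ge0.
have C1 : 0 < C0 + 1 by rewrite ltr_wpDl.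
(* [M] is defined so that its power [1/(2q)] is [m], and [C0 m <= eps / 2]. *)
pose m : R := eps / 2 / (C0 + 1).
have m0 : 0 < m by rewrite divr_gt0// divr_gt0.
pose M : R := m `^ (2 * q).
have M0 : 0 < M by rewrite powR_gt0.
have Mm : M `^ (2 * q)^-1 = m.
  by rewrite /M -powRrM mulfV ?powRr1 ?(ltW m0)// mulf_neq0 ?gt_eqF.
have [N NP] := tail_small M0.
(* Beyond [N] the tail of [v1] is small; above [c] the cuts partition the sizes; above [K2] almost
   nothing of [v2] is cut off, so [v2] has no large part. *)
pose n := maxn N (Num.truncn (Num.max c K2)).+1.
pose b : R := n%:R.
have bmax : Num.max c K2 <= b.
  by apply/ltW/(lt_le_trans (truncnS_gt _)); rewrite ler_nat leq_maxr.
have cb : c <= b by apply: le_trans bmax; rewrite le_max lexx.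
have K2b : K2 <= b by apply: le_trans bmax; rewrite le_max lexx orbT.
have b0 : 0 <= b by rewrite ler0n.
pose W x := cut `[c, b]%classic v1 x + cut `[c, b]%classic v2 x.
pose S1 := cut `]b, +oo[%classic v1.
pose S2 x := cut `]-oo, c[%classic v1 x + cut `]-oo, c[%classic v2 x.
have mW : measurable_fun [set: T] W by apply: measurable_funD; exact: measurable_cut.
have mS1 : measurable_fun [set: T] S1 by exact: measurable_cut.
have mS2 : measurable_fun [set: T] S2 by apply: measurable_funD; exact: measurable_cut.
have Wb x : `|W x| <= b + b.
  apply: le_trans (ler_normD _ _) (lerD _ _); apply: cut_le => // r;
    by rewrite /= in_itv/= => /andP[].
have S2b x : `|S2 x| <= c + c.
  apply: le_trans (ler_normD _ _) (lerD _ _); apply: cut_le (ltW c0) _ => r;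
    by rewrite /= in_itv/= => /ltW.
exists W, (b + b); split => //; [exact: addr_ge0|exact: middle_integrable|].
move=> u v Huv.
have S1le := mul_graph_bound hp PE Plin Pcontr Psg Plip q1 mF1 F1_gt0 mF2 F2_gt0 ctrl F2_int
  mS1 M0 (NP _ (leq_maxl _ _)) Huv.
have S1L : Lp mu 2%:E (fun x => (S1 x)%:C * L2_repr u x).
  apply/Lp2P; split; first exact: measurable_mul_fun.
  by apply: le_lt_trans S1le _; rewrite ltry.
pose y1 := L2_of mu (fun x => (S1 x)%:C * L2_repr u x).
have uv0 : 0 <= nrm u + nrm v by rewrite addr_ge0 ?nrm_ge0.
have y1le : nrm y1 <= eps / 2 * (nrm u + nrm v).
  have := S1le; rewrite -(sqint_L2_of S1L) lee_fin -/C0 Mm.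
  have B0 : 0 <= C0 * m * (nrm u + nrm v) by rewrite mulr_ge0// mulr_ge0// ltW.
  rewrite ler_pXn2r ?nnegrE ?nrm_ge0// => /le_trans; apply.
  rewrite ler_wpM2r//.
  have : (C0 + 1) * m = eps / 2 by rewrite /m mulrC divfK// gt_eqF.
  by have := ltW m0; lra.
have y2le : nrm (wmul S2 u) <= eps / 2 * (nrm u + nrm v).
  have cc0 : 0 <= c + c by rewrite addr_ge0// ltW.
  apply: le_trans (nrm_wmul_le mS2 cc0 S2b u) _.
  have -> : c + c = eps / 2 by rewrite /c; lra.
  by rewrite ler_wpM2l ?lerDl ?nrm_ge0// divr_ge0// ltW.
exists (y1 + wmul S2 u).
  apply: le_trans (nrmD ip _ _) _; apply: le_trans (lerD y1le y2le) _.
  by rewrite -mulrDl -splitr.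
have E1 : {ae mu, forall x, L2_repr (y1 + wmul S2 u + wmul W u) x =
    L2_repr y1 x + L2_repr (wmul S2 u) x + L2_repr (wmul W u) x}.
  apply: filterS2 (L2_reprD (y1 + wmul S2 u) (wmul W u)) (L2_reprD y1 (wmul S2 u)) => x h1 h2.
  by rewrite h1// h2.
have E2 : {ae mu, forall x, L2_repr y1 x + L2_repr (wmul S2 u) x + L2_repr (wmul W u) x =
    (S1 x + S2 x + W x)%:C * L2_repr u x}.
  apply: filterS3 (L2_ofE S1L) (wmulE mS2 S2b u) (wmulE mW Wb u) => x h1 h2 h3.
  by rewrite h1// h2// h3// -!mulrDl -!RtoCD.
have E3 : {ae mu, forall x, V x = S1 x + S2 x + W x}.
  apply: filterS2 VE bd_v2 => x -> v2x.
  have v2c : cut `]b, +oo[%classic v2 x = 0.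
    by apply: cut_out; rewrite /= in_itv/= andbT ltNge (le_trans v2x).
  rewrite -[in LHS](cut_split v1 x cb) -[in LHS](cut_split v2 x cb) v2c /S1 /S2 /W; ring.
apply: filterS3 E1 E2 E3 => x h1 h2 h3 _ /=.
by rewrite h1 h2 h3.
Qed.

Lemma potential_domain u v : H (u, v) -> exists x, mul_op mu V (u, x).
Proof.
move=> Huv; have [W [K [_ _ _ _ WP]]] := potential_split ltr01.
by have [y _ uy] := WP _ _ Huv; exists (y + wmul W u).
Qed.

Lemma potential_rel_compact : rel_compact (@L2_dot d T R mu) H (mul_op mu V).
Proof.
move=> eps e0; have e3 : 0 < eps / 3 by rewrite divr_gt0.
have [W [K [mW K0 WK WF WP]]] := potential_split e3.
have [P [PE Plin Pcontr Psg Plip]] := heat_semigroup hH.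
have [_ _ [F2 [mF2 F2_gt0 ctrl F2_int]]] := control.
have K1 : 0 < K + 1 by rewrite ltr_wpDl.
(* Since [|u - P_t u| <= t |v|], this makes [|W (u - P_t u)| <= K t |v| <= (eps / 3) |v|]. *)
pose t : R := eps / 3 / (K + 1).
have t0 : 0 < t by rewrite divr_gt0.
have tt0 : 0 < t + t by rewrite addr_gt0.
have [n [e [g gP]]] := heat_wmul_finite_rank hp mF1 F1_gt0 mW WK t0 e3 (ltW (F2_gt0 _ tt0))
  (fun u => PE t u t0) (fun a u v => Plin t a u v t0) (fun x => ctrl _ x tt0) WF.
exists n, e, g => u v x Huv Vux.
have [y yle Vuy] := WP _ _ Huv.
have -> : x - \sum_i L2_dot u (e i) *: g i =
    y + (wmul W (u - P t u) + (wmul W (P t u) - \sum_i L2_dot u (e i) *: g i)).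
  rewrite (mul_op_functional Vux Vuy) -addrA; congr (_ + _).
  by rewrite (wmulB mW WK) addrA subrK.
have h1 : nrm (wmul W (u - P t u)) <= eps / 3 * nrm v.
  apply: le_trans (nrm_wmul_le mW K0 WK _) _.
  apply: le_trans (ler_wpM2l K0 (Plip _ _ _ t0 Huv)) _.
  rewrite mulrA ler_wpM2r ?nrm_ge0//.
  have : (K + 1) * t = eps / 3 by rewrite /t mulrC divfK// gt_eqF.
  by have := ltW t0; lra.
have h2 := gP u.
apply: le_trans (nrmD ip _ _) (le_trans (lerD yle (le_trans (nrmD ip _ _) (lerD h1 h2))) _).
by have := nrm_ge0 (@L2_dot d T R mu) u; have := nrm_ge0 (@L2_dot d T R mu) v; nra.
Qed.

End potential.

(** * Integral conditions extracted from the function spaces *)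

Section lp_parts.
Context d (T : measurableType d) (R : realType).
Implicit Type mu : {measure set T -> \bar R}.

Lemma Lp_integral_Re mu (r : R) (f : T -> R[i]) : 0 < r -> Lp mu r%:E f ->
  (\int[mu]_x (`|Re (f x)| `^ r)%:E < +oo)%E.
Proof.
move=> r0 [mf]; rewrite /finite_norm => nf.
have pow (g : T -> R) : measurable_fun [set: T] g ->
    measurable_fun [set: T] (fun x => (`|g x| `^ r)%:E).
  move=> mg; apply/measurable_EFinP.
  apply: (@measurableT_comp _ _ _ _ _ _ (@powR R ^~ r)); first exact: measurable_powR.
  exact: measurableT_comp.
apply: (@le_lt_trans _ _ (\int[mu]_x (`|normc (f x)| `^ r)%:E)%E).
  apply: ge0_le_integral => //.
  - by apply: pow; case: mf.
  - exact/pow/measurable_normc.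
  move=> x _; rewrite lee_fin ge0_ler_powR ?nnegrE ?(ltW r0)//.
  by rewrite (ger0_norm (normc_ge0 _)) ler_Re_normc.
have := powR_Lnorm mu (EFin \o (@normc R \o f)) (lt0r_neq0 r0).
by move=> /= <-; exact: poweR_lty.
Qed.

Lemma Loo_ae_bounded_Re mu (f : T -> R[i]) : Lp mu +oo%E f ->
  exists K, {ae mu, forall x, `|Re (f x)| <= K}.
Proof.
move=> [mf]; rewrite /finite_norm unlock /Lnorm.
(* The norm at [+oo] is the essential supremum only for a nonzero measure; for the zero measure
   every bound holds almost everywhere. *)
have [mu0|] := boolP (0 < mu [set: T])%E; last first.
  rewrite -leNgt measure_le0 => /eqP mu0 _; exists 0.
  by exists [set: T]; split.
set e := ess_sup _ _ => efin.
have [K eK] : exists K : R, (e <= K%:E)%E.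
  by move: efin; case: e => // [r _|_]; [exists r|exists 0; rewrite leNye].
exists K; apply: filterS (ess_sup_ge mu (abse \o (EFin \o (@normc R \o f)))) => x /= h.
have := le_trans h eK; rewrite lee_fin (ger0_norm (normc_ge0 _)).
exact/le_trans/ler_Re_normc.
Qed.

Lemma measurable_superlevel (g : T -> R) (c : R) : measurable_fun [set: T] g ->
  measurable [set x | c <= g x].
Proof.
move=> mg; rewrite -[X in measurable X]setTI.
rewrite (_ : [set x | _] = g @^-1` `[c, +oo[%classic); first exact: mg.
by apply/seteqP; split => x; rewrite /= in_itv/= andbT.
Qed.

Lemma L_oo_Re mu (f : T -> R[i]) (c : R) : L_oo mu f -> 0 < c ->
  (mu [set x | (c <= `|Re (f x)|)%R] < +oo)%E.
Proof.
move=> [mf ff] /ff; apply: le_lt_trans; apply: le_measure.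
- rewrite inE; apply: measurable_superlevel; apply: measurableT_comp => //; exact: mf.1.
- rewrite inE; exact: measurable_superlevel (measurable_normc mf).
- by move=> x /= /le_trans; apply; exact: ler_Re_normc.
Qed.

End lp_parts.

Theorem theorem2p7 (d : measure_display) (X : measurableType d) (R : realType)
    (mu : {sigma_finite_measure set X -> \bar R})
    (p : R -> X -> X -> R) (hp : heat_kernel mu p)
    (H : op mu) (hH : heat_generator p H)
    (q : R) (hq : 1 <= q)
    (F1 : X -> R) (mF1 : measurable_fun [set: X] F1)
    (F1_gt0 : forall x, 0 < F1 x) (hF1 : control_function p q F1)
    (V : X -> R) (mV : measurable_fun [set: X] V) (V1 V2 : X -> R[i])
    (hV : {ae mu, forall x, (V x)%:C = V1 x + V2 x})
    (hV12 :
      [/\ q = 1,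
          Lp (mdensity mu mF1 F1_gt0) 2%:E V1,
          L_oo (mdensity mu mF1 F1_gt0) V2 &
          Loo_oo mu V2] \/
      [/\ 1 < q,
          forall x, F1 x = 1,
          Lp mu (2 * q)%:E V1 &
          Loo_oo mu V2]) :
  (forall a : R, 0 < a ->
     compact_op (op_comp (mul_op mu V) (op_inv (op_add H (op_scalar mu a%:C)))))
  /\ [/\ dom (op_add H (mul_op mu V)) = dom H,
         selfadjoint (op_add H (mul_op mu V)),
         semibounded (op_add H (mul_op mu V)) &
         ess_spectrum (op_add H (mul_op mu V)) = ess_spectrum H].
Proof.
(* [V] is real, so the real parts of [V1] and [V2] also decompose it. Both alternatives give the
   same conditions: for [q = 1] the weight [F1] comes from [mdensity], for [q > 1] it is 1. *)
pose v1 x := Re (V1 x); pose v2 x := Re (V2 x).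
have [mv1 int_v1] : measurable_fun [set: X] v1 /\
    (\int[mu]_x (`|v1 x| `^ (2 * q) * F1 x)%:E < +oo)%E.
  have q2 : 0 < 2 * q by rewrite mulr_gt0// (lt_le_trans ltr01).
  case: hV12 => [[q1 LV1 _ _]|[_ F11 LV1 _]]; split; try by case: LV1 => -[].
    have := Lp_integral_Re (ltr0Sn R 1) LV1.
    rewrite integral_mdensity => [|x|]; rewrite ?lee_fin ?powR_ge0//.
      by rewrite q1 mulr1; under eq_integral do rewrite -EFinM.
    apply/measurable_EFinP.
    apply: (@measurableT_comp _ _ _ _ _ _ (@powR R ^~ 2)); first exact: measurable_powR.
    by apply: measurableT_comp => //; case: LV1 => -[].
  by under eq_integral do rewrite F11 mulr1; exact: Lp_integral_Re.
have [[[mv2 _] _] _] : Loo_oo mu V2 by case: hV12 => -[].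
(* For [q = 1] this integral is by definition the [mdensity] measure of the superlevel set. *)
have lev_v2 (c : R) : 0 < c -> (\int[mu]_(x in [set x | (c <= `|v2 x|)%R]) (F1 x)%:E < +oo)%E.
  move=> c0; case: hV12 => [[_ _ LV2 _]|[_ F11 _ [_ LV2]]]; first exact: L_oo_Re LV2 c0.
  under eq_integral do rewrite F11.
  rewrite integral_cst ?mul1e; first exact: L_oo_Re LV2 c0.
  by apply: measurable_superlevel; exact: measurableT_comp.
have [K2 bd_v2] : exists K, {ae mu, forall x, `|v2 x| <= K}.
  by apply: Loo_ae_bounded_Re; case: hV12 => [[_ _ _ []]|[_ _ _ []]].
have VE : {ae mu, forall x, V x = v1 x + v2 x}.
  by apply: filterS hV => x Vx; rewrite -[LHS]/(Re (V x)%:C) Vx ReD.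
have domV := potential_domain hp hH hq mF1 F1_gt0 hF1 mv1 mv2 int_v1 lev_v2 bd_v2 VE.
have cV := potential_rel_compact hp hH hq mF1 F1_gt0 hF1 mv1 mv2 int_v1 lev_v2 bd_v2 VE.
have [sH H0 _] := hH.
split; first by move=> a; exact: compact_mul_resolvent.
split; [exact: dom_add_mul|exact: selfadjoint_add_mul|exact: semibounded_add_mul|].
exact: ess_spectrum_add_mul.
Qed.
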